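(* Let $G=U(n)$. The basic bundle gerbe $\mathcal{B}_n=(L,Y)$ on $G$ is a strongly equivariant bundle gerbe for the adjoint action of $G$ on itself, $g\cdot h=h^{-1}gh$; here $G$ acts on $Y$ by $(z,g)\cdot h=(z,h^{-1}gh)$.
   Context: A bundle gerbe $(P,Y)$ over a manifold $M$ is a surjective submersion $Y\to M$ and a $U(1)$-bundle (equivalently Hermitian line bundle) $P\to Y^{[2]}=Y\times_MY$ with an associative product $P_{(y_1,y_2)}\otimes P_{(y_2,y_3)}\to P_{(y_1,y_3)}$. If a Lie group $G$ acts smoothly on the right of $M$, a strong action of $G$ on $(P,Y)$ is a smooth action of $G$ on $Y$ covering the action on $M$ and a smooth action of $G$ on $P\to Y^{[2]}$ by bundle morphisms covering the induced action on $Y^{[2]}$ and commuting with the bundle gerbe product; $(P,Y)$ with such an action is called strongly equivariant. The basic bundle gerbe. Let $Z=S^1\setminus\{1\}$, ordered via $(0,2\pi)\cong Z$, $\phi\mapsto e^{i\phi}$, and let $Y\subset Z\times G$ be the set of pairs $(z,g)$ with $z$ not an eigenvalue of $g$, with projection $Y\to G$, $(z,g)\mapsto g$. Points of $Y^{[2]}$ are triples $(z_1,z_2,g)$ with $(z_1,g),(z_2,g)\in Y$. A point is between $z_1$ and $z_2$ if it lies in the component of $S^1\setminus\{z_1,z_2\}$ not containing $1$. Let $Y^{[2]}_+$ (resp. $Y^{[2]}_-$) be the set of $(z_1,z_2,g)$ with $z_1<z_2$ (resp. $z_1>z_2$) and some eigenvalue of $g$ between $z_1$ and $z_2$, and $Y^{[2]}_0$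 the set where there is no eigenvalue of $g$ between $z_1$ and $z_2$; these are disjoint open sets covering $Y^{[2]}$. On $Y_+^{[2]}$ let $E_{(z_1,z_2,g)}=\bigoplus_{z_1<\lambda<z_2}E_\lambda(g)\subset\mathbb{C}^n$ be the sum of the eigenspaces of $g$ for eigenvalues between $z_1$ and $z_2$; this is a smooth vector bundle. Then $L\to Y^{[2]}$ is the smooth Hermitian line bundle with $L_{(z_1,z_2,g)}=\bigwedge^{\mathrm{top}}E_{(z_1,z_2,g)}$ on $Y_+^{[2]}$, $L_{(z_1,z_2,g)}=L_{(z_2,z_1,g)}^*$ on $Y_-^{[2]}$ and $L_{(z_1,z_2,g)}=\mathbb{C}$ on $Y_0^{[2]}$. The bundle gerbe product is induced by the wedge product, using $E_{(z_1,z_2,g)}\oplus E_{(z_2,z_3,g)}=E_{(z_1,z_3,g)}$ for $z_1<z_2<z_3$, and by duality in the other cases. *)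

(* Defs.v *)
From HB Require Import structures.
From mathcomp Require Import all_boot all_order all_algebra.
From mathcomp Require Import complex.
From mathcomp Require Import all_classical all_reals all_analysis.

Set Implicit Arguments.
Unset Strict Implicit.
Unset Printing Implicit Defensive.

Import Order.TTheory GRing.Theory Num.Theory.
Import numFieldNormedType.Exports.

Local Open Scope classical_set_scope.
Local Open Scope ring_scope.
Local Open Scope sesquilinear_scope.

(** * Smooth maps and embedded manifolds

   There is no library of abstract manifolds.  A "space" is a type together
   with an injection into some R^N; it carries the induced topology, and a map
   is smooth when it extends, locally in the ambient R^N, to a C^oo map.
   Manifolds are the spaces that are embedded submanifolds of R^N (by
   Whitney's theorem every manifold arises in this way). *)

Fixpoint Ck (R : realType) (V W : normedModType R) (k : nat) (U : set V)
    (f : V -> W) : Prop :=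
  match k with
  | 0 => forall x, U x -> {for x, continuous f}
  | k'.+1 => (forall x, U x -> differentiable f x) /\
             (forall v : V, Ck k' U (fun x => 'D_v f x))
  end.

(* U is meant to be open; since the domain is finite-dimensional, f is C^k.+1
   iff it is differentiable with C^k directional derivatives. *)
Definition Cinf (R : realType) (V W : normedModType R) (U : set V)
  (f : V -> W) : Prop := forall k, Ck k U f.

Record space (R : realType) := Space {
  pt :> Type;
  edim : nat;
  emb : pt -> 'rV[R]_edim;
  emb_inj : injective emb }.

Section Spaces.
Variable R : realType.
Implicit Types X Y : space R.

Definition opn X (U : set X) : Prop :=
  exists O : set 'rV[R]_(edim X), open O /\ (forall x, U x <-> O (emb x)).

Definition smooth_on X Y (U : set X) (f : X -> Y) : Prop :=
  forall x, U x ->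
    exists (O : set 'rV[R]_(edim X)) (F : 'rV[R]_(edim X) -> 'rV[R]_(edim Y)),
      [/\ open O, O (emb x), Cinf O F &
          forall x', U x' -> O (emb x') -> F (emb x') = emb (f x')].

Definition smooth X Y (f : X -> Y) : Prop := smooth_on setT f.

Definition is_manifold X : Prop :=
  exists d : nat, forall x : X,
    exists (O : set 'rV[R]_(edim X)) (W : set 'rV[R]_d)
           (phi : 'rV[R]_(edim X) -> 'rV[R]_d)
           (psi : 'rV[R]_d -> 'rV[R]_(edim X)),
      [/\ [/\ open O, O (emb x), open W, Cinf O phi & Cinf W psi],
          forall x' : X, O (emb x') ->
            W (phi (emb x')) /\ psi (phi (emb x')) = emb x' &
          forall w, W w ->
            phi (psi w) = w /\ exists2 x' : X, O (emb x') & emb x' = psi w].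

(* c is a curve in X, smooth near 0, with c 0 = x and velocity v at 0. *)
Definition curve_at X (x : X) (c : R -> X) (v : 'rV[R]_(edim X)) : Prop :=
  [/\ exists O : set R, [/\ open O, O 0 & Cinf O (fun t : R => emb (c t))],
      c 0 = x &
      is_derive (0 : R) (1 : R) (fun t : R => emb (c t)) v].

Definition tangent X (x : X) (v : 'rV[R]_(edim X)) : Prop :=
  exists c, curve_at x c v.

(* The graph of the differential of f at x. *)
Definition tangent_map X Y (f : X -> Y) (x : X)
    (v : 'rV[R]_(edim X)) (w : 'rV[R]_(edim Y)) : Prop :=
  exists2 c, curve_at x c v & curve_at (f x) (f \o c) w.

Definition submersion X Y (f : X -> Y) : Prop :=
  smooth f /\
  forall (x : X) (w : 'rV[R]_(edim Y)), tangent (f x) w ->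
    exists v, tangent_map f x v w.

Lemma prod_emb_inj X Y :
  injective (fun p : X * Y => row_mx (emb p.1) (emb p.2)).
Proof.
by move=> [x y] [x' y'] /= /eq_row_mx [] /emb_inj -> /emb_inj ->.
Qed.

Definition prod_space X Y : space R := Space (@prod_emb_inj X Y).

Lemma sub_emb_inj X (A : set X) :
  injective (fun p : {x : X | A x} => emb (sval p)).
Proof.
move=> [x Ax] [y Ay] /= /emb_inj exy; subst y.
by rewrite (Prop_irrelevance Ax Ay).
Qed.

Definition sub_space X (A : set X) : space R := Space (@sub_emb_inj X A).

(* A complex vector indexed by I as a real vector. *)
Definition realify (I : finType) (f : I -> R[i]) : 'rV[R]_(#|I| + #|I|) :=
  row_mx (\row_k complex.Re (f (enum_val k)))
         (\row_k complex.Im (f (enum_val k))).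

Lemma realify_inj (I : finType) (f f' : I -> R[i]) :
  realify f = realify f' -> f =1 f'.
Proof.
move=> /eq_row_mx [/rowP eR /rowP eI] j.
have := eR (enum_rank j); have := eI (enum_rank j).
by rewrite !mxE enum_rankK; case: (f j) => a b; case: (f' j) => a' b' /= -> ->.
Qed.

Lemma complex_emb_inj : injective (fun z : R[i] => realify (fun _ : unit => z)).
Proof. by move=> z z' /realify_inj /(_ tt). Qed.

Definition complex_space : space R := Space complex_emb_inj.

Lemma mx_emb_inj m n : injective (fun A : 'M[R[i]]_(m, n) =>
  realify (fun ij : 'I_m * 'I_n => A ij.1 ij.2)).
Proof. by move=> A B /realify_inj e; apply/matrixP => i j; apply: (e (i, j)). Qed.

Definition mx_space m n : space R := Space (@mx_emb_inj m n).

Lemma ffun_emb_inj (I : finType) :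
  injective (fun u : {ffun I -> R[i]^o} => realify (fun j => u j : R[i])).
Proof. by move=> u v /realify_inj e; apply/ffunP. Qed.

Definition ffun_space (I : finType) : space R := Space (@ffun_emb_inj I).

(** * Lie groups and smooth right actions *)

Record grp := Grp {
  gsp :> space R;
  gmul : gsp -> gsp -> gsp;
  gone : gsp;
  ginv : gsp -> gsp }.

Definition is_lie_group (G : grp) : Prop :=
  [/\ is_manifold G,
      [/\ associative (@gmul G), left_id (gone G) (@gmul G),
          right_id (gone G) (@gmul G),
          left_inverse (gone G) (@ginv G) (@gmul G) &
          right_inverse (gone G) (@ginv G) (@gmul G)],
      smooth (fun p : prod_space G G => gmul p.1 p.2 : G) &
      smooth (fun g : G => ginv g : G)].

Definition smooth_right_action (G : grp) X (a : X -> G -> X) : Prop :=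
  [/\ forall x, a x (gone G) = x,
      forall x g h, a (a x g) h = a x (gmul g h) &
      smooth (fun p : prod_space X G => a p.1 p.2 : X)].

(** * Hermitian line bundles

   The smooth structure is given by an atlas of local frames: [frame U s] says
   that s, restricted to the open set U, is a nowhere zero section belonging to
   the atlas (the values of s outside U are irrelevant), i.e. that
   (x, a) |-> a *: s x is one of the chosen trivialisations of the bundle
   over U.  A fibrewise linear map is smooth iff its coefficient in such frames
   is a smooth function. *)

Record lbundle X := LBundle {
  fib :> X -> vectType R[i];
  hdot : forall x, fib x -> fib x -> R[i];
  frame : set X -> (forall x, fib x) -> Prop }.

Definition is_hermitian_line_bundle X (P : lbundle X) : Prop :=
  [/\ forall x, \dim {: P x} = 1%N,
      forall x,
        [/\ forall v : P x, linear (fun u : P x => hdot u v : R[i]^o),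
            forall u v : P x, hdot v u = (hdot u v)^* &
            forall u : P x, u != 0 -> 0 < hdot u u],
      forall x, exists U s, @frame X P U s /\ U x,
      forall U s, @frame X P U s ->
        [/\ opn U, forall x, U x -> s x != 0 &
            smooth_on U (fun x => hdot (s x) (s x) : complex_space)] &
      forall U s V t, @frame X P U s -> @frame X P V t ->
        exists2 c : X -> complex_space, smooth_on (U `&` V) c &
          forall x, (U `&` V) x -> t x = (c x : R[i]) *: s x].

(** * Bundle gerbes *)

Definition fib2 X Y (f : Y -> X) : space R :=
  sub_space (fun p : prod_space Y Y => f p.1 = f p.2).

Definition fib3 X Y (f : Y -> X) : space R :=
  sub_space (fun p : prod_space (prod_space Y Y) Y =>
    f p.1.1 = f p.1.2 /\ f p.1.2 = f p.2).

Section FibreProducts.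
Variables (X Y : space R) (f : Y -> X).

Definition p12 (y : fib3 f) : fib2 f :=
  exist _ ((sval y).1.1, (sval y).1.2) (svalP y).1.

Definition p23 (y : fib3 f) : fib2 f :=
  exist _ ((sval y).1.2, (sval y).2) (svalP y).2.

Definition p13 (y : fib3 f) : fib2 f :=
  exist _ ((sval y).1.1, (sval y).2) (etrans (svalP y).1 (svalP y).2).

(* a = (y1, y2), b = (y2, y3), c = (y1, y3) for some y1, y2, y3 *)
Definition composable (a b c : fib2 f) : Prop :=
  [/\ (sval a).2 = (sval b).1, (sval c).1 = (sval a).1 &
      (sval c).2 = (sval b).2].

End FibreProducts.

(* The value of the product [bprod] is meaningful for composable triples only;
   indexing by three points of Y^[2] instead of a point of Y^[3] avoids
   transporting elements of fibres along equalities of base points. *)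
Record gerbe X := Gerbe {
  gY : space R;
  gpi : gY -> X;
  gP : lbundle (fib2 gpi);
  bprod : forall a b c : fib2 gpi, gP a -> gP b -> gP c }.

Definition bprod_smooth X (B : gerbe X) : Prop :=
  forall U s V t W r,
    @frame _ (gP B) U s -> @frame _ (gP B) V t -> @frame _ (gP B) W r ->
    exists2 c : fib3 (@gpi X B) -> complex_space,
      smooth_on [set y | [/\ U (p12 y), V (p23 y) & W (p13 y)]] c &
      forall y, U (p12 y) -> V (p23 y) -> W (p13 y) ->
        bprod (p13 y) (s (p12 y)) (t (p23 y)) = (c y : R[i]) *: r (p13 y).

(* A bilinear map of lines which multiplies norms is the same thing as a
   unitary isomorphism from the tensor product. *)
Definition is_bundle_gerbe X (B : gerbe X) : Prop :=
  [/\ [/\ is_manifold X, is_manifold (gY B),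
          forall x, exists y, @gpi X B y = x & submersion (@gpi X B)],
      is_hermitian_line_bundle (gP B),
      forall a b c : fib2 (@gpi X B), composable a b c ->
        [/\ forall p : gP B a, linear (fun q : gP B b => bprod c p q),
            forall q : gP B b, linear (fun p : gP B a => bprod c p q) &
            forall (p : gP B a) (q : gP B b),
              hdot (bprod c p q) (bprod c p q) = hdot p p * hdot q q],
      bprod_smooth B &
      forall y12 y23 y34 y13 y24 y14 : fib2 (@gpi X B),
        composable y12 y23 y13 -> composable y23 y34 y24 ->
        composable y13 y34 y14 -> composable y12 y24 y14 ->
        forall (p : gP B y12) (q : gP B y23) (r : gP B y34),
          bprod y14 (bprod y13 p q) r = bprod y14 p (bprod y24 q r)].

(** * Strong actions *)

Section StrongAction.
Variables (G : grp) (X : space R) (B : gerbe X).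
Variables (aX : X -> G -> X) (aY : gY B -> G -> gY B).

(* y' is the image of y under the action of h induced on Y^[2] *)
Definition moved (y : fib2 (@gpi X B)) (h : G) (y' : fib2 (@gpi X B)) : Prop :=
  (sval y').1 = aY (sval y).1 h /\ (sval y').2 = aY (sval y).2 h.

(* The action on P of the element h is [aP y h y' : P_y -> P_y'] with y' = y.h;
   only these y' are relevant. *)
Variable aP : forall (y : fib2 (@gpi X B)) (h : G) (y' : fib2 (@gpi X B)),
  gP B y -> gP B y'.

Definition is_right_action_on_P : Prop :=
  (forall y, moved y (gone G) y ->
     forall p : gP B y, aP (gone G) y p = p) /\
  (forall y y' y'' g h, moved y g y' -> moved y' h y'' ->
     forall p : gP B y, aP h y'' (aP g y' p) = aP (gmul g h) y'' p).

Definition acts_by_bundle_morphisms : Prop :=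
  forall y h y', moved y h y' ->
    linear (@aP y h y') /\
    (forall p q : gP B y, hdot (aP h y' p) (aP h y' q) = hdot p q).

Definition smooth_on_P : Prop :=
  forall U s V t, @frame _ (gP B) U s -> @frame _ (gP B) V t ->
    exists2 c : prod_space (fib2 (@gpi X B)) G -> complex_space,
      smooth_on (fun p : prod_space (fib2 (@gpi X B)) G =>
                   U p.1 /\ exists2 y', moved p.1 p.2 y' & V y') c &
      forall y h y', moved y h y' -> U y -> V y' ->
        aP h y' (s y) = (c (y, h) : R[i]) *: t y'.

Definition commutes_with_product : Prop :=
  forall a b c a' b' c' h, composable a b c -> composable a' b' c' ->
    moved a h a' -> moved b h b' -> moved c h c' ->
    forall (p : gP B a) (q : gP B b),
      aP h c' (bprod c p q) = bprod c' (aP h a' p) (aP h b' q).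

Definition is_strong_action : Prop :=
  [/\ smooth_right_action aY,
      forall y h, @gpi X B (aY y h) = aX (@gpi X B y) h,
      is_right_action_on_P,
      acts_by_bundle_morphisms &
      smooth_on_P /\ commutes_with_product].

End StrongAction.

(* B is a bundle gerbe over the G-manifold (X, aX), and it has a strong action
   of G whose part on Y is aY. *)
Definition strongly_equivariant_bundle_gerbe (G : grp) X (aX : X -> G -> X)
    (B : gerbe X) (aY : gY B -> G -> gY B) : Prop :=
  [/\ is_lie_group G, smooth_right_action aX, is_bundle_gerbe B &
      exists aP, @is_strong_action G X B aX aY aP].

End Spaces.

(** * U(n) and its adjoint action *)

Section Unitary.
Variables (R : realType) (n : nat).
Local Notation C := R[i].

Definition Uspace : space R :=
  sub_space (fun g : mx_space R n n => (g : 'M[C]_n) \is unitarymx).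

Lemma Umul_subproof (g h : Uspace) :
  ((sval g : 'M[C]_n) *m sval h : 'M[C]_n) \is unitarymx.
Proof. by rewrite mul_unitarymx ?(svalP g) ?(svalP h). Qed.

Lemma Uone_subproof : (1%:M : 'M[C]_n) \is unitarymx.
Proof. by apply/unitarymxP; rewrite trmx1 map_mx1 mulmx1. Qed.

Lemma Uinv_subproof (g : Uspace) : ((sval g : 'M[C]_n)^t* : 'M[C]_n) \is unitarymx.
Proof. by rewrite trmxC_unitary (svalP g). Qed.

Definition Un : grp R := @Grp R Uspace
  (fun g h => exist _ ((sval g : 'M[C]_n) *m sval h) (Umul_subproof g h))
  (exist _ (1%:M : 'M[C]_n) Uone_subproof)
  (fun g => exist _ ((sval g : 'M[C]_n)^t*) (Uinv_subproof g)).

Definition mx_of (g : Un) : 'M[C]_n := sval g.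

Definition adj (g h : Un) : Un := gmul (gmul (ginv h) g) h.

(** * The space Y *)

Definition eigval (A : 'M[C]_n) (z : C) : Prop :=
  exists2 v : 'cV[C]_n, v != 0 & A *m v = z *: v.

Definition circle : set (complex_space R) := [set z : C | `|z| = 1].

Definition Zspace : space R :=
  sub_space (circle `&` [set z : complex_space R | (z : C) <> 1]).

Definition Yspace : space R :=
  sub_space (fun p : prod_space Zspace Un => ~ eigval (mx_of p.2) (sval p.1)).

Definition Ypi (y : Yspace) : Un := (sval y).2.

Lemma adjY_subproof (y : Yspace) (h : Un) :
  ~ eigval (mx_of (adj (sval y).2 h)) (sval (sval y).1).
Proof.
case: y => [[z g] /= nz] [v v0 ev]; apply: nz => /=.
have uh : mx_of h *m (mx_of h)^t* = 1%:M by apply/unitarymxP; apply: svalP h.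
have hu : (mx_of h)^t* *m mx_of h = 1%:M by apply: mulmx1C.
exists (mx_of h *m v).
  apply/eqP => hv; move/eqP: v0; apply.
  by rewrite -[v]mul1mx -hu -mulmxA hv mulmx0.
have eg : mx_of g = mx_of h *m mx_of (adj g h) *m (mx_of h)^t*.
  by rewrite /mx_of /= !mulmxA uh mul1mx -mulmxA uh mulmx1.
have hv : (mx_of h)^t* *m (mx_of h *m v) = v by rewrite mulmxA hu mul1mx.
have {}ev : mx_of (adj g h) *m v = sval z *: v by [].
by move: (mx_of (adj g h)) eg ev => B -> ev; rewrite -!mulmxA hv ev -scalemxAr.
Qed.

Definition adjY (y : Yspace) (h : Un) : Yspace :=
  exist _ ((sval y).1, adj (sval y).2 h) (@adjY_subproof y h).

(* The order on Z: phi |-> e^{i phi} is a bijection from ]0, 2 pi[ onto Z. *)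
Definition expi (phi : R) : C := (cos phi +i* sin phi)%C.

Definition Zlt (z w : C) : Prop :=
  exists phi psi : R,
    [/\ 0 < phi, phi < psi, psi < 2 * pi, z = expi phi & w = expi psi].

Definition Zle (z w : C) : Prop := z = w \/ Zlt z w.

(* x is in S^1 minus {z1, z2}, but not in the component of 1. *)
Definition between (z1 z2 x : complex_space R) : Prop :=
  let A := circle `&` ~` [set z1; z2] in
  A x /\
  ~ connected_component [set emb a | a in A] (emb (1 : complex_space R)) (emb x).

(** * Exterior powers

   The exterior algebra of C^n, in the basis e_S = e_i1 /\ ... /\ e_ik indexed
   by the subsets S = {i1 < ... < ik}. *)

Definition ext : vectType C := {ffun {set 'I_n} -> C^o}.

Definition inversions (S T : {set 'I_n}) : nat :=
  #|[pred p : 'I_n * 'I_n | [&& p.1 \in S, p.2 \in T & (p.2 < p.1)%N]]|.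

Definition wedge (u v : ext) : ext :=
  [ffun S : {set 'I_n} => \sum_(T : {set 'I_n} | T \subset S)
     (-1) ^+ inversions T (S :\: T) * (u T * v (S :\: T)) : C^o].

Definition ext1 : ext := [ffun S : {set 'I_n} => (S == finset.set0)%:R : C^o].

Definition ext_vec (v : 'cV[C]_n) : ext :=
  [ffun S : {set 'I_n} => \sum_(i < n | S == [set i]%SET) v i 0 : C^o].

(* The inner product for which (e_S) is orthonormal. *)
Definition ext_dot (u v : ext) : C := \sum_(S : {set 'I_n}) u S * (v S)^*.

(* For k = dim W the k-th exterior power of W is the line spanned by
   w_1 /\ ... /\ w_k, for any basis (w_i) of W. *)
Definition ext_top (W : {vspace 'cV[C]_n}) : {vspace ext} :=
  <[ \big[wedge/ext1]_(w <- vbasis W) ext_vec w ]>%VS.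

(** * The line bundle L *)

(* The eigenvalues of A, listed with multiplicities *)
Definition eigvals (A : 'M[C]_n) : seq C :=
  sval (closed_field_poly_normal (char_poly A)).

Definition eigsp (A : 'M[C]_n) (x : C) : {vspace 'cV[C]_n} :=
  lker (linfun (fun v : 'cV[C]_n => A *m v - x *: v)).

Definition Esum (z1 z2 : C) (g : Un) : {vspace 'cV[C]_n} :=
  (\sum_(x <- eigvals (mx_of g) | `[< Zlt z1 x /\ Zlt x z2 >])
     eigsp (mx_of g) x)%VS.

Definition Y2 : space R := fib2 Ypi.

Definition z1_of (y : Y2) : C := sval (sval (sval y).1).1.
Definition z2_of (y : Y2) : C := sval (sval (sval y).2).1.
Definition g_of (y : Y2) : Un := Ypi (sval y).1.

Definition eig_between (y : Y2) : Prop :=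
  exists2 x : C, eigval (mx_of (g_of y)) x & between (z1_of y) (z2_of y) x.

Inductive sign := Pos | Neg | Nul.

(* Which one of Y^[2]_+, Y^[2]_-, Y^[2]_0 contains y *)
Definition sign_of (y : Y2) : sign :=
  if `[< Zlt (z1_of y) (z2_of y) /\ eig_between y >] then Pos
  else if `[< Zlt (z2_of y) (z1_of y) /\ eig_between y >] then Neg
  else Nul.

(* The line det E_(z1, z2, g) on Y^[2]_+, and det E_(z2, z1, g) on Y^[2]_-.
   On Y^[2]_0 it is the 0-th exterior power C ext1. *)
Definition det_line (y : Y2) : {vspace ext} :=
  if `[< Zlt (z1_of y) (z2_of y) >] then ext_top (Esum (z1_of y) (z2_of y) (g_of y))
  else ext_top (Esum (z2_of y) (z1_of y) (g_of y)).

Definition fibre (s : sign) (l : {vspace ext}) : vectType C :=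
  match s with
  | Pos => subvs_of l
  | Neg => 'Hom(subvs_of l, C^o)
  | Nul => C^o
  end.

Definition Lfib (y : Y2) : vectType C := fibre (sign_of y) (det_line y).

(* Views of the fibres, for l = det_line y: for s = Pos, Nul as vectors of l
   (where l = C ext1 in the second case), for s = Neg, Nul as linear
   functionals on l.  The values in the remaining cases are irrelevant. *)
Definition as_vec s l : fibre s l -> ext :=
  match s return fibre s l -> ext with
  | Pos => fun u => vsval u
  | Neg => fun _ => 0
  | Nul => fun c => (c : C) *: ext1
  end.

Definition of_vec s l (u : ext) : fibre s l :=
  match s return fibre s l with
  | Pos => vsproj l u
  | Neg => 0
  | Nul => u finset.set0
  end.

Definition as_fun s l : fibre s l -> ext -> C :=
  match s return fibre s l -> ext -> C with
  | Pos => fun _ _ => 0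
  | Neg => fun f u => f (vsproj l u)
  | Nul => fun c u => (c : C) * u finset.set0
  end.

Definition of_fun s l (f : ext -> C) : fibre s l :=
  match s return fibre s l with
  | Pos => 0
  | Neg => linfun (fun u : subvs_of l => f (vsval u) : C^o)
  | Nul => f ext1
  end.

(* On Neg: the dual metric, computed with an arbitrary nonzero u in l. *)
Definition fibre_dot s l : fibre s l -> fibre s l -> C :=
  match s return fibre s l -> fibre s l -> C with
  | Pos => fun u v => ext_dot (vsval u) (vsval v)
  | Neg => fun f f' => let u := vpick l in
      f (vsproj l u) * (f' (vsproj l u) : C)^* / ext_dot u u
  | Nul => fun c c' => (c : C) * (c' : C)^*
  end.

(* The frames are: over open subsets of Y^[2]_+ and Y^[2]_0, the nowhere zero
   sections which are smooth as maps to the exterior algebra; over open subsets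
   of Y^[2]_-, the duals of smooth nowhere zero sections of the line det E. *)
Definition Lframe (V : set Y2) (s : forall y, Lfib y) : Prop :=
  opn V /\
  [\/ [/\ (forall y, V y -> sign_of y = Pos), (forall y, V y -> s y != 0) &
          smooth_on V (fun y => as_vec (s y) : ffun_space R {set 'I_n})],
      (forall y, V y -> sign_of y = Neg) /\
        (exists2 u : Y2 -> ffun_space R {set 'I_n}, smooth_on V u &
         forall y, V y -> (u y : ext) \in det_line y /\ as_fun (s y) (u y) = 1) |
      [/\ (forall y, V y -> sign_of y = Nul), (forall y, V y -> s y != 0) &
          smooth_on V (fun y => as_vec (s y) : ffun_space R {set 'I_n})]].

Definition L : lbundle Y2 :=
  @LBundle R Y2 Lfib (fun y => @fibre_dot (sign_of y) (det_line y)) Lframe.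

(** * The product *)

(* The scalar k with w = k *: b, for b != 0 and w on the line through b *)
Definition quot (w b : ext) : C := coord [tuple b] ord0 w.

(* The product of p in L_(z1,z2,g) and q in L_(z2,z3,g).  Write l_ij for the
   line det E_(zi,zj,g), for zi <= zj, so that wedging identifies
   l_ij (x) l_jk with l_ik.  By duality the product is characterised by:
     z1 <= z2 <= z3:  p q = p /\ q;
     z1 <= z3 <= z2:  (p q) /\ y = q(y) p        for y in l_32;
     z2 <= z1 <= z3:  x /\ (p q) = p(x) q        for x in l_21;
     z2 <= z3 <= z1:  (p q)(y) = p(q /\ y)       for y in l_31;
     z3 <= z1 <= z2:  (p q)(x) = q(x /\ p)       for x in l_31;
     z3 <= z2 <= z1:  (p q)(x /\ y) = q(x) p(y)  for x in l_32, y in l_21.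
   In the second, third and last case we use the nonzero vectors picked by
   [vpick]; the result does not depend on them. *)
Definition Lprod (a b c : Y2) (p : Lfib a) (q : Lfib b) : Lfib c :=
  let z1 := z1_of a in let z2 := z2_of a in let z3 := z2_of b in
  let l12 := vpick (det_line a) in
  let l23 := vpick (det_line b) in
  let l13 := vpick (det_line c) in
  if `[< Zle z1 z2 /\ Zle z2 z3 >] then
    of_vec (sign_of c) (det_line c) (wedge (as_vec p) (as_vec q))
  else if `[< Zle z1 z3 /\ Zle z3 z2 >] then
    of_vec (sign_of c) (det_line c)
      ((quot (as_vec p) (wedge l13 l23) * as_fun q l23) *: l13)
  else if `[< Zle z2 z1 /\ Zle z1 z3 >] then
    of_vec (sign_of c) (det_line c)
      ((quot (as_vec q) (wedge l12 l13) * as_fun p l12) *: l13)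
  else if `[< Zle z2 z3 /\ Zle z3 z1 >] then
    of_fun (sign_of c) (det_line c) (fun y => as_fun p (wedge (as_vec q) y))
  else if `[< Zle z3 z1 /\ Zle z1 z2 >] then
    of_fun (sign_of c) (det_line c) (fun x => as_fun q (wedge x (as_vec p)))
  else
    of_fun (sign_of c) (det_line c)
      (fun w => quot w (wedge l23 l12) * (as_fun q l23 * as_fun p l12)).

Definition basic_gerbe : gerbe Un := @Gerbe R Un Yspace Ypi L Lprod.

End Unitary.

(* Main.v *)
(* All the algebra takes place at one unitary g at a time. Diagonalise g = h D h^*, with the
   eigenvalues sorted along the circle from 1. If N(z) is the number of eigenvalues preceding z,
   then det E_(z1, z2, g) is spanned by the unit vector h_*(e_N(z1) /\ ... /\ e_(N(z2) - 1)), and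
   in the resulting coordinates the product of L is the multiplication of C. The element k of
   U(n) acts by pushing forward with k^-1, and since k^-1 h diagonalises k^-1 g k, this action
   preserves the coordinates; so it is unitary, multiplicative and compatible with the product.

   For smoothness, let z1 < z2. The imaginary part of (z2 - z1)(x - z1)^* is affine in x,
   positive exactly on the open arc between z1 and z2, and negative on the complementary open
   arc. Hence the projector onto E_(z1, z2, g) is (1 + Q)/2, where Q is the sign of the Hermitian
   matrix that this function yields at g. The sign is smooth on invertible Hermitian matrices:
   the difference quotient of Q solves a Sylvester equation with positive definite coefficients.
   Transporting a basis of E by the projector gives local sections of det E; every coefficient
   to be checked is then a quotient <a, b> / <b, b> of wedge products of smooth sections. *)
From HB Require Import structures.
Require Import Defs.
From mathcomp Require Import all_boot all_order all_algebra.
From mathcomp Require Import perm complex ring lra.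
From mathcomp Require Import all_classical all_reals all_analysis.
Import Defs.

Set Implicit Arguments.
Unset Strict Implicit.
Unset Printing Implicit Defensive.

Import Order.TTheory GRing.Theory Num.Theory.
Import numFieldNormedType.Exports.

Local Open Scope classical_set_scope.
Local Open Scope ring_scope.
Local Open Scope sesquilinear_scope.

(** * Differential calculus *)

(** A diagonalising h cannot be chosen continuously in g: its columns jump where eigenvalues
    collide, and the numbering jumps when an eigenvalue crosses 1. So [sdiag] is used only at one
    point, to compare elements of a fibre that are already defined; whatever has to vary smoothly is
    built from the projector, which involves no choice. The vectors [veps] are never claimed to be
    smooth: frames are compared through ratios, in which the phases of h cancel. The sign is
    characterised algebraically, which yields an exact equation for the difference of two signs and
    avoids contour integrals. The trace of the projector is continuous with natural values, hence
    locally constant; this is why the type of the fibre is locally constant. The projector requires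
    z1 < z2, so near points with z1 = z2 the eigenvalues are counted relative to an auxiliary third
    point of Z. Closure of smoothness under algebraic operations is proved once, for an abstract
    [smooth_class], and used both for C^k functions on open sets and for functions that extend
    smoothly near a point of a space. *)

Section Expansion.
Variables (R : realType) (V W : normedModType R).

(** The o-notation is traded for explicit estimates, which are easy to transfer along local
    equalities and to obtain from difference quotients. *)
Lemma diff_expand (f : V -> W) (df : {linear V -> W}) x :
  continuous df ->
  (forall e : R, 0 < e -> \forall h \near (0 : V),
     `|f (h + x) - f x - df h| <= e * `|h|) ->
  differentiable f x /\ 'd f x = df :> (V -> W).
Proof.
move=> cdf H.
have E : f \o shift x = cst (f x) + df +o_ (0 : V) id.
  apply/eqaddoP => _/posnumP[e] /=; near=> h.
  have : `|f (h + x) - f x - df h| <= e%:num * `|h| by near: h; exact: H.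
  by rewrite -addrA -opprD.
have dE := diff_unique cdf E.
by split=> //; apply/diff_locallyP; rewrite dE.
Unshelve. all: by end_near. Qed.

Lemma diff_expandP (f : V -> W) x : differentiable f x ->
  forall e : R, 0 < e -> \forall h \near (0 : V),
     `|f (h + x) - f x - 'd f x h| <= e * `|h|.
Proof.
move=> /diff_locally E e e0.
have /eqaddoP/(_ e e0) := E.
by apply: filterS => h /=; rewrite -addrA -opprD.
Qed.

Lemma near_eq_diff (f g : V -> W) x : (\forall y \near x, f y = g y) ->
  differentiable f x -> differentiable g x /\ 'd g x = 'd f x :> (V -> W).
Proof.
move=> fg df; apply: diff_expand; first exact: diff_continuous.
move=> e e0; have fgx : f x = g x by exact: nbhs_singleton fg.
have fg' : \forall h \near (0 : V), f (h + x) = g (h + x).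
  by move: fg; rewrite (near_shift 0) subr0.
by apply: filterS2 fg' (diff_expandP df e0) => h <-; rewrite -fgx.
Qed.

End Expansion.

Section CkTheory.
Variables (R : realType) (V : normedModType R).

Lemma differentiable_mx_coord m n (M : V -> 'M[R]_(m, n)) x :
  (forall i j, differentiable (fun y => M y i j) x) -> differentiable M x.
Proof.
move=> dM.
have -> : M = \sum_(i < m) (\sum_(j < n) (fun y => M y i j *: delta_mx i j)).
  apply/funext => y; rewrite [LHS]matrix_sum_delta fct_sumE; apply: eq_bigr => i _.
  by rewrite fct_sumE.
by apply: differentiable_sum => i; apply: differentiable_sum => j; apply: differentiableZl.
Qed.

(** A derivative at a point of U only sees f near that point, so U must be open. In the inductions
    below this replaces ['D_v f] by a formula that is valid on U alone. *)
Lemma Ck_eq (W : normedModType R) k (U : set V) (f g : V -> W) :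
  open U -> (forall x, U x -> f x = g x) -> Ck k U f -> Ck k U g.
Proof.
move=> oU; elim: k f g => [|k IH] f g fg /=.
  move=> cf x Ux; have H : f @ x --> f x := cf x Ux.
  change (g @ x --> g x); rewrite -(fg x Ux); apply: cvg_trans H.
  apply: near_eq_cvg; near=> y; rewrite fg //; near: y.
  exact: open_nbhs_nbhs.
have nfg x : U x -> \forall y \near x, f y = g y.
  by move=> Ux; near=> y; apply: fg; near: y; apply: open_nbhs_nbhs.
move=> [df Df]; split=> [x Ux|v].
  exact: (near_eq_diff (nfg x Ux) (df x Ux)).1.
apply: IH (Df v) => x Ux; have [dg eg] := near_eq_diff (nfg x Ux) (df x Ux).
by rewrite (deriveE _ dg) (deriveE _ (df x Ux)) eg.
Unshelve. all: by end_near. Qed.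

Lemma Ck_sub (W : normedModType R) k (U U' : set V) (f : V -> W) :
  U' `<=` U -> Ck k U f -> Ck k U' f.
Proof.
move=> sU; elim: k f => [|k IH] f /= cf; first by move=> x /sU; apply: cf.
by split=> [x /sU|v]; [apply: cf.1 | apply: IH; apply: cf.2].
Qed.

Lemma Ck_continuous (W : normedModType R) k (U : set V) (f : V -> W) :
  Ck k U f -> forall x, U x -> {for x, continuous f}.
Proof.
by case: k => [|k] //= [df _] x Ux; apply: differentiable_continuous; apply: df.
Qed.

Lemma CkW (W : normedModType R) k (U : set V) (f : V -> W) :
  Ck k.+1 U f -> Ck k U f.
Proof.
elim: k f => [|k IH] f cf; first exact: Ck_continuous cf.
by case: cf => df Df; split=> // v; apply: IH.
Qed.

Lemma Ck_cst (W : normedModType R) k (U : set V) (a : W) : Ck k U (fun=> a).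
Proof.
elim: k a => [|k IH] a /=; first by move=> x _; apply: cst_continuous.
split=> [x _|v]; first exact: differentiable_cst.
by have -> : (fun x : V => 'D_v (fun=> a) x) = (fun=> 0)
  by apply/funext => x; rewrite derive_cst.
Qed.

Lemma Ck_linear (W : normedModType R) k (U : set V) (f : {linear V -> W}) :
  continuous f -> Ck k U f.
Proof.
move=> cf; case: k => [|k] /=; first by move=> x _; apply: cf.
split=> [x _|v]; first exact: linear_differentiable.
have -> : (fun x : V => 'D_v f x) = (fun=> f v).
  apply/funext => x; rewrite deriveE ?diff_lin //; exact: linear_differentiable.
exact: Ck_cst.
Qed.

Lemma CkD (W : normedModType R) k (U : set V) (f g : V -> W) : open U ->
  Ck k U f -> Ck k U g -> Ck k U (fun x => f x + g x).
Proof.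
move=> oU; elim: k f g => [|k IH] f g /=.
  by move=> cf cg x Ux; apply: continuousD; [apply: cf|apply: cg].
move=> [df Df] [dg Dg]; split=> [x Ux|v].
  by apply: differentiableD; [apply: df|apply: dg].
apply: (Ck_eq oU _ (IH _ _ (Df v) (Dg v))) => x Ux.
by rewrite deriveD //; apply: diff_derivable; [apply: df|apply: dg].
Qed.

Lemma CkM k (U : set V) (f g : V -> R) : open U ->
  Ck k U f -> Ck k U g -> Ck k U (fun x => f x * g x).
Proof.
move=> oU; elim: k f g => [|k IH] f g.
  by move=> cf cg x Ux; apply: continuousM; [apply: cf|apply: cg].
move=> Cf Cg; have cf := CkW Cf; have cg := CkW Cg.
case: Cf Cg => [df Df] [dg Dg]; split=> [x Ux|v].
  by apply: differentiableM; [apply: df|apply: dg].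
apply: (Ck_eq oU _ (CkD oU (IH _ _ cf (Dg v)) (IH _ _ cg (Df v)))) => x Ux.
by rewrite deriveM //; apply: diff_derivable; [apply: df|apply: dg].
Qed.

Lemma CkN k (U : set V) (f : V -> R) : open U ->
  Ck k U f -> Ck k U (fun x => - f x).
Proof.
move=> oU cf; apply: (Ck_eq oU _ (CkM oU (Ck_cst k U (-1 : R)) cf)) => x _.
by rewrite mulN1r.
Qed.

Lemma CkV k (U : set V) (f : V -> R) : open U -> (forall x, U x -> f x != 0) ->
  Ck k U f -> Ck k U (fun x => (f x)^-1).
Proof.
move=> oU f0; elim: k => [|k IH].
  by move=> cf x Ux; apply: continuousV; [apply: f0 | apply: cf].
move=> Cf; have /IH cf := CkW Cf; case: Cf => df Df; split=> [x Ux|v].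
  by apply: differentiableV; [apply: df|apply: f0].
have := CkN oU (CkM oU (CkM oU cf cf) (Df v)).
apply: (Ck_eq oU) => x Ux.
rewrite deriveV ?f0 //; last by apply: diff_derivable; apply: df.
by rewrite scaleNr; congr (- _); rewrite /GRing.scale /= expr2 invfM.
Qed.

Lemma Ck_sum (I : Type) (r : seq I) (P : pred I) k (U : set V) (F : I -> V -> R) :
  open U -> (forall i, P i -> Ck k U (F i)) ->
  Ck k U (fun x => \sum_(i <- r | P i) F i x).
Proof.
move=> oU cF; elim: r => [|i r IH].
  by apply: (Ck_eq oU _ (Ck_cst k U (0 : R))) => x _; rewrite big_nil.
case: (boolP (P i)) => Pi.
  apply: (Ck_eq oU _ (CkD oU (cF i Pi) IH)) => x _.
  by rewrite big_cons Pi.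
by apply: (Ck_eq oU _ IH) => x _; rewrite big_cons (negbTE Pi).
Qed.

Lemma derive_lincomp (W W' : normedModType R) (L : {linear W -> W'})
    (f : V -> W) x v : continuous L -> differentiable f x ->
  differentiable (L \o f) x /\ 'D_v (L \o f) x = L ('D_v f x).
Proof.
move=> cL df; have dL := linear_differentiable (f x) cL.
have dc : differentiable (L \o f) x by apply: differentiable_comp.
by split=> //; rewrite !deriveE // diff_comp //= diff_lin.
Qed.

Lemma Ck_lincomp (W W' : normedModType R) (L : {linear W -> W'}) k (U : set V)
    (f : V -> W) : open U -> continuous L -> Ck k U f -> Ck k U (fun x => L (f x)).
Proof.
move=> oU cL; elim: k f => [|k IH] f.
  by move=> cf x Ux; apply: continuous_comp; [apply: cf | apply: cL].
move=> [df Df]; split=> [x Ux|v]; first exact: (derive_lincomp 0 cL (df x Ux)).1.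
apply: (Ck_eq oU _ (IH _ (Df v))) => x Ux.
by rewrite (derive_lincomp v cL (df x Ux)).2.
Qed.

Lemma continuous_mx_coord m n (M : V -> 'M[R]_(m, n)) x :
  (forall i j, {for x, continuous (fun y => M y i j)}) -> {for x, continuous M}.
Proof.
move=> cM; apply/cvgrPdist_le => /= e e0; near=> y.
rewrite /Num.Def.normr/= mx_normrE (bigmax_le _ (ltW e0))//= => i _.
rewrite !mxE; move: i; near: y; apply: filter_forall => /= i.
by have /cvgrPdist_le/(_ _ e0) := cM i.1 i.2.
Unshelve. all: by end_near. Qed.

Lemma Ck_mx m n k (U : set V) (M : V -> 'M[R]_(m, n)) : open U ->
  (forall i j, Ck k U (fun x => M x i j)) <-> Ck k U M.
Proof.
move=> oU; split.
  elim: k M => [|k IH] M cM.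
    by move=> x Ux; apply: continuous_mx_coord => i j; apply: cM.
  split=> [x Ux|v].
    by apply: differentiable_mx_coord => i j; apply: (cM i j).1.
  apply: IH => i j; apply: (Ck_eq oU _ ((cM i j).2 v)) => x Ux.
  rewrite derive_mx ?mxE //; apply/derivable_mxP => i' j'.
  by apply: diff_derivable; apply: (cM i' j').1.
move=> cM i j.
have lc : linear (fun A : 'M[R]_(m, n) => A i j : R) by move=> a u v; rewrite !mxE.
pose L := GRing.isLinear.Build _ _ _ _ _ lc.
pose LL : {linear 'M[R]_(m, n) -> R} := HB.pack (fun A : 'M[R]_(m, n) => A i j : R) L.
exact: (@Ck_lincomp _ _ LL _ _ _ oU (@coord_continuous _ _ _ i j) cM).
Qed.

End CkTheory.

Section CkComp.
Variables (R : realType) (V : normedModType R) (m : nat).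

Definition rowdot (c h : 'rV[R]_m) : R := \sum_j c 0 j * h 0 j.

Fact rowdot_linear c : linear (rowdot c).
Proof.
move=> a u v; rewrite /rowdot scaler_sumr -big_split; apply: eq_bigr => j _.
by rewrite !mxE mulrDr mulrCA.
Qed.

HB.instance Definition _ c :=
  GRing.isLinear.Build _ _ _ _ (rowdot c) (rowdot_linear c).

Lemma rowdot_continuous c : continuous (rowdot c).
Proof.
move=> x; have : Ck 0 [set: 'rV[R]_m] (rowdot c).
  apply: Ck_sum => [|j _]; [exact: openT|].
  apply: CkM => [||x' _]; [exact: openT|exact: Ck_cst|exact: coord_continuous].
by apply.
Qed.

(** Caratheodory's form of differentiability: an exact factorisation of the increment with slopes
    continuous at x. It suits functions whose difference quotient is given by an algebraic formula,
    such as the matrix sign. *)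
Lemma caratheodory (f : 'rV[R]_m -> R) (G : 'I_m -> 'rV[R]_m -> R) x :
  (\forall y \near x, f y - f x = \sum_j G j y * (y - x) 0 j) ->
  (forall j, {for x, continuous (G j)}) ->
  differentiable f x /\ forall v, 'D_v f x = \sum_j G j x * v 0 j.
Proof.
move=> E cG; pose c := \row_j G j x.
suff [df dE] : differentiable f x /\ 'd f x = rowdot c :> (_ -> _).
  split=> // v; rewrite deriveE // dE; apply: eq_bigr => j _; by rewrite mxE.
apply: diff_expand; first exact: rowdot_continuous.
move=> e e0.
have E' : \forall h \near (0 : 'rV[R]_m), f (h + x) - f x = \sum_j G j (h + x) * h 0 j.
  move: E; rewrite (near_shift 0) subr0; apply: filterS => h /= ->.
  by rewrite addrK.
(* The m terms are each at most d |h|; the successor keeps the quotient meaningful for m = 0. *)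
pose d := e / m.+1%:R; have d0 : 0 < d by rewrite divr_gt0.
have H0 j : \forall h \near (0 : 'rV[R]_m), `|G j x - G j (h + x)| <= d.
  have : \forall t \near x, `|G j x - G j t| <= d.
    by have /cvgrPdist_le/(_ _ d0) := cG j.
  by rewrite (near_shift 0 x) subr0.
have H := filter_forall (nbhs_filter _) H0.
apply: filterS2 E' H => h -> H.
rewrite /rowdot -sumrB (le_trans (ler_norm_sum _ _ _)) //.
apply: (@le_trans _ _ (\sum_(j < m) d * `|h|)).
  apply: ler_sum => j _; rewrite mxE -mulrBl normrM distrC ler_pM //.
  by rewrite [leRHS]/Num.Def.normr/= mx_normrE; apply: (le_bigmax _ _ (ord0, j)).
rewrite sumr_const card_ord -mulr_natl mulrA ler_wpM2r // /d mulrCA ger_pMr //.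
by rewrite ler_pdivrMr // mul1r ler_nat.
Qed.

(** Chain rule in coordinates: the derivative of F o G along v is a finite sum of products of
    ['D_v G] with partial derivatives of F at G. The induction is on k with F and G general, since
    it is applied to these partial derivatives. *)
Lemma Ck_comp k (U : set V) (O : set 'rV[R]_m) (G : V -> 'rV[R]_m)
    (F : 'rV[R]_m -> R) :
  open U -> open O -> (forall x, U x -> O (G x)) ->
  Ck k U G -> Ck k O F -> Ck k U (fun x => F (G x)).
Proof.
move=> oU oO UO; elim: k F G UO => [|k IH] F G UO.
  move=> cG cF x Ux; apply: continuous_comp; first exact: cG.
  by apply: cF; apply: UO.
move=> CG CF; have cG := CkW CG; case: CG CF => [dG DG] [dF DF].
split=> [x Ux|v]; first by apply: differentiable_comp; [apply: dG | apply/dF/UO].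
have := @Ck_sum _ _ _ (index_enum 'I_m) predT k U
  (fun j x => 'D_v G x 0 j * 'D_(delta_mx 0 j) F (G x)) oU.
have H j : true -> Ck k U (fun x => 'D_v G x 0 j * 'D_(delta_mx 0 j) F (G x)).
  move=> _; apply: CkM => //; last exact: IH (DF _).
  by have /(Ck_mx _ _ oU) := DG v; apply.
move=> /(_ H); apply: (Ck_eq oU) => x Ux.
have dFx := dF _ (UO _ Ux); have dGx := dG _ Ux.
have dFG : differentiable (F \o G) x by apply: differentiable_comp.
change (\sum_j (fun j x => 'D_v G x 0 j * 'D_(delta_mx 0 j) F (G x)) j x = 'D_v (F \o G) x).
rewrite [RHS]deriveE //.
rewrite (diff_comp dGx dFx) /=.
rewrite -(deriveE v dGx).
rewrite [in RHS](matrix_sum_delta ('D_v G x)) big_ord1 linear_sum /=.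
by apply: eq_bigr => j _; rewrite linearZ (deriveE _ dFx).
Qed.

End CkComp.

(* Classes of real functions stable under the field operations; the functions
   in the class may be inverted when they do not vanish on N. *)
Record smooth_class (R : realType) (T : Type) (N : set T) := SmoothClass {
  scl :> (T -> R) -> Prop;
  scl_cst : forall a, scl (fun=> a);
  sclD : forall f g, scl f -> scl g -> scl (fun x => f x + g x);
  sclM : forall f g, scl f -> scl g -> scl (fun x => f x * g x);
  sclV : forall f, (forall x, N x -> f x != 0) -> scl f -> scl (fun x => (f x)^-1)
}.

(** * Complex and matrix-valued functions over a class of smooth functions *)

Section SmoothClass.
Variables (R : realType) (T : Type) (N : set T) (S : @smooth_class R T N).
Local Notation C := R[i].
Implicit Types f g : T -> C.

Lemma scl_ext (f g : T -> R) : f =1 g -> S f -> S g.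
Proof. by move=> /funext ->. Qed.

Lemma sclN (f : T -> R) : S f -> S (fun x => - f x).
Proof.
move=> Sf; apply: scl_ext (sclM (scl_cst S (-1)) Sf) => x.
by rewrite mulN1r.
Qed.

Definition csc f :=
  S (fun x => complex.Re (f x)) /\ S (fun x => complex.Im (f x)).

Lemma csc_ext f g : f =1 g -> csc f -> csc g.
Proof. by move=> /funext ->. Qed.

Lemma csc_cst a : csc (fun=> a).
Proof. by split; apply: scl_cst. Qed.

Lemma cscD f g : csc f -> csc g -> csc (fun x => f x + g x).
Proof.
move=> [f1 f2] [g1 g2]; split.
  by apply: scl_ext (sclD f1 g1) => x; case: (f x) => a b; case: (g x).
by apply: scl_ext (sclD f2 g2) => x; case: (f x) => a b; case: (g x).
Qed.

Lemma cscM f g : csc f -> csc g -> csc (fun x => f x * g x).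
Proof.
move=> [f1 f2] [g1 g2]; split.
  apply: scl_ext (sclD (sclM f1 g1) (sclN (sclM f2 g2))) => x.
  by case: (f x) => a b; case: (g x).
apply: scl_ext (sclD (sclM f1 g2) (sclM f2 g1)) => x.
by case: (f x) => a b; case: (g x).
Qed.

Lemma cscN f : csc f -> csc (fun x => - f x).
Proof.
move=> Sf; apply: csc_ext (cscM (csc_cst (-1)) Sf) => x.
by rewrite mulN1r.
Qed.

Lemma csc_conj f : csc f -> csc (fun x => (f x)^*).
Proof.
move=> [f1 f2]; split.
  by apply: scl_ext f1 => x; case: (f x).
by apply: scl_ext (sclN f2) => x; case: (f x).
Qed.

Lemma cscV f : (forall x, N x -> f x != 0) -> csc f -> csc (fun x => (f x)^-1).
Proof.
move=> f0 Sf; case: (Sf) => f1 f2.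
pose d x := complex.Re (f x) * complex.Re (f x) + complex.Im (f x) * complex.Im (f x).
have Sd : S (fun x => (d x)^-1).
  apply: sclV => [x Nx|]; last exact: sclD (sclM _ _) (sclM _ _).
  apply: contra_neq (f0 x Nx) => /eqP; rewrite /d -!expr2 paddr_eq0 ?sqr_ge0 //.
  by rewrite !sqrf_eq0; case: (f x) => a b /= /andP[/eqP -> /eqP ->].
split.
  apply: scl_ext (sclM f1 Sd) => x; rewrite /d; case: (f x) => a b /=.
  by rewrite !expr2.
apply: scl_ext (sclM (sclN f2) Sd) => x; rewrite /d; case: (f x) => a b /=.
by rewrite -!expr2 mulNr.
Qed.

Lemma csc_sum (I : Type) (r : seq I) (P : pred I) (F : I -> T -> C) :
  (forall i, P i -> csc (F i)) -> csc (fun x => \sum_(i <- r | P i) F i x).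
Proof.
move=> SF; elim: r => [|i r IH].
  by apply: csc_ext (csc_cst 0) => x; rewrite big_nil.
case: (boolP (P i)) => Pi.
  by apply: csc_ext (cscD (SF i Pi) IH) => x; rewrite big_cons Pi.
by apply: csc_ext IH => x; rewrite big_cons (negbTE Pi).
Qed.

Lemma csc_prod (I : Type) (r : seq I) (P : pred I) (F : I -> T -> C) :
  (forall i, P i -> csc (F i)) -> csc (fun x => \prod_(i <- r | P i) F i x).
Proof.
move=> SF; elim: r => [|i r IH].
  by apply: csc_ext (csc_cst 1) => x; rewrite big_nil.
case: (boolP (P i)) => Pi.
  by apply: csc_ext (cscM (SF i Pi) IH) => x; rewrite big_cons Pi.
by apply: csc_ext IH => x; rewrite big_cons (negbTE Pi).
Qed.

Definition msc m n (A : T -> 'M[C]_(m, n)) := forall i j, csc (fun x => A x i j).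

Lemma msc_cst m n (A : 'M[C]_(m, n)) : msc (fun=> A).
Proof. by move=> i j; apply: csc_cst. Qed.

Lemma mscD m n (A B : T -> 'M[C]_(m, n)) :
  msc A -> msc B -> msc (fun x => A x + B x).
Proof.
by move=> SA SB i j; apply: csc_ext (cscD (SA i j) (SB i j)) => x; rewrite mxE.
Qed.

Lemma mscN m n (A : T -> 'M[C]_(m, n)) : msc A -> msc (fun x => - A x).
Proof. by move=> SA i j; apply: csc_ext (cscN (SA i j)) => x; rewrite mxE. Qed.

Lemma mscB m n (A B : T -> 'M[C]_(m, n)) :
  msc A -> msc B -> msc (fun x => A x - B x).
Proof. by move=> SA SB; apply: mscD => //; apply: mscN. Qed.

Lemma mscZ m n f (A : T -> 'M[C]_(m, n)) :
  csc f -> msc A -> msc (fun x => f x *: A x).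
Proof.
by move=> Sf SA i j; apply: csc_ext (cscM Sf (SA i j)) => x; rewrite mxE.
Qed.

Lemma msc_mul m n p (A : T -> 'M[C]_(m, n)) (B : T -> 'M[C]_(n, p)) :
  msc A -> msc B -> msc (fun x => A x *m B x).
Proof.
move=> SA SB i j.
apply: csc_ext (csc_sum (index_enum _) (P := predT)
  (F := fun k x => A x i k * B x k j) _) => [x|k _]; first by rewrite mxE.
exact: cscM.
Qed.

Lemma msc_trC m n (A : T -> 'M[C]_(m, n)) : msc A -> msc (fun x => (A x)^t*).
Proof.
by move=> SA i j; apply: csc_ext (csc_conj (SA j i)) => x; rewrite !mxE.
Qed.

Lemma csc_tr n (A : T -> 'M[C]_n) : msc A -> csc (fun x => \tr (A x)).
Proof. by move=> SA; apply: csc_sum => i _. Qed.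

Lemma csc_det n (A : T -> 'M[C]_n) : msc A -> csc (fun x => \det (A x)).
Proof.
move=> SA; apply: csc_sum => s _; apply: cscM; first exact: csc_cst.
by apply: csc_prod => i _.
Qed.

Lemma msc_adj n (A : T -> 'M[C]_n) : msc A -> msc (fun x => \adj (A x)).
Proof.
move=> SA i j; have : csc (fun x => cofactor (A x) j i).
  apply: cscM; first exact: csc_cst.
  apply: csc_det => k l; apply: csc_ext (SA (lift j k) (lift i l)) => x.
  by rewrite !mxE.
by apply: csc_ext => x; rewrite mxE.
Qed.

(** Cramer's formula displays the inverse as a rational expression in the entries; the definition of
    [invmx] by cases does not. *)
Lemma msc_inv n (A : T -> 'M[C]_n) : (forall x, N x -> A x \in unitmx) ->
  msc A -> msc (fun x => (\det (A x))^-1 *: \adj (A x)).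
Proof.
move=> uA SA; apply: mscZ; last exact: msc_adj.
by apply: cscV => [x /uA|]; [rewrite unitmxE unitfE | exact: csc_det].
Qed.

End SmoothClass.

Section CkClass.
Variables (R : realType) (V : normedModType R) (k : nat) (U : set V).
Hypothesis oU : open U.

Definition Ck_class : smooth_class R U := @SmoothClass R V U (fun f => Ck k U f)
  (fun a => Ck_cst k U (a : R)) (fun f g => @CkD R V R k U f g oU)
  (fun f g => @CkM R V k U f g oU) (fun f f0 => @CkV R V k U f oU f0).

End CkClass.

(** * Smooth functions on subsets of embedded spaces *)

Section RsmClass.
Variables (R : realType) (X : space R).
Implicit Types (U : set X) (f g : X -> R).

(** Smoothness at the single point x relative to U. Keeping x fixed lets the domains of several
    extensions be intersected or shrunk around it. *)
Definition rsm U x f := exists (O : set 'rV[R]_(edim X)) (F : 'rV[R]_(edim X) -> R),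
  [/\ open O, O (emb x), Cinf O F &
      forall x', U x' -> O (emb x') -> F (emb x') = f x'].

Lemma rsm_cst U x a : rsm U x (fun=> a).
Proof.
by exists setT, (fun=> a); split=> //; [exact: openT | move=> k; exact: Ck_cst].
Qed.

Lemma rsmD U x f g : rsm U x f -> rsm U x g -> rsm U x (fun x => f x + g x).
Proof.
move=> [ O [F [oO Ox cF eF]]] [ O' [F' [oO' Ox' cF' eF']]].
exists (O `&` O'), (fun y => F y + F' y); split=> //.
- exact: openI.
- move=> k; apply: CkD; first exact: openI.
    by apply: Ck_sub (cF k) => y [].
  by apply: Ck_sub (cF' k) => y [].
- by move=> y Uy [Oy Oy']; rewrite eF // eF'.
Qed.

Lemma rsmM U x f g : rsm U x f -> rsm U x g -> rsm U x (fun x => f x * g x).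
Proof.
move=> [ O [F [oO Ox cF eF]]] [ O' [F' [oO' Ox' cF' eF']]].
exists (O `&` O'), (fun y => F y * F' y); split=> //.
- exact: openI.
- move=> k; apply: CkM; first exact: openI.
    by apply: Ck_sub (cF k) => y [].
  by apply: Ck_sub (cF' k) => y [].
- by move=> y Uy [Oy Oy']; rewrite eF // eF'.
Qed.

Lemma open_preimage_Ck (V W : normedModType R) k (O : set V) (F : V -> W) (A : set W) :
  open O -> Ck k O F -> open A -> open (O `&` F @^-1` A).
Proof.
move=> oO cF oA; rewrite openE => y [Oy Ay].
apply: filterI; first exact: open_nbhs_nbhs.
apply: (Ck_continuous cF Oy); exact: open_nbhs_nbhs.
Qed.

Lemma rsmV U x f : U x -> f x != 0 -> rsm U x f -> rsm U x (fun x => (f x)^-1).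
Proof.
move=> Ux f0 [ O [F [oO Ox cF eF]]].
pose O' := O `&` F @^-1` [set r | r != 0].
have oO' : open O' by apply: (open_preimage_Ck oO (cF 0%N)); exact: open_neq.
exists O', (fun y => (F y)^-1); split=> //.
- by split=> //=; rewrite eF.
- by move=> k; apply: CkV => // [y []//|]; apply: Ck_sub (cF k) => y [].
- by move=> y Uy [Oy _]; rewrite eF.
Qed.

Lemma rsm_sub U U' x f : U' `<=` U -> rsm U x f -> rsm U' x f.
Proof.
by move=> sU [ O [F [oO Ox cF eF]]]; exists O, F; split=> // x' /sU; apply: eF.
Qed.

Lemma rsm_eq U x f g : (forall x, U x -> f x = g x) -> rsm U x f -> rsm U x g.
Proof.
move=> fg [ O [F [oO Ox cF eF]]]; exists O, F; split=> // x' Ux' Ox'.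
by rewrite eF // fg.
Qed.

(** Inversion asks for f x != 0 at the one point x only: an extension that does not vanish at x does
    not vanish nearby, and its domain may be shrunk. *)
Definition rsm_class U x (Ux : U x) : smooth_class R [set x] :=
  @SmoothClass R X [set x] (rsm U x)
    (@rsm_cst U x) (fun f g => @rsmD U x f g) (fun f g => @rsmM U x f g)
    (fun f nz => @rsmV U x f Ux (nz x erefl)).

End RsmClass.

Section SmoothOn.
Variable R : realType.
Implicit Types X Y Z : space R.

Lemma Cinf_mx (V : normedModType R) m n (O : set V) (F : V -> 'M[R]_(m, n)) :
  open O -> (forall i j, Cinf O (fun x => F x i j)) <-> Cinf O F.
Proof.
move=> oO; split=> [cF k|cF i j k]; last by have /(Ck_mx _ _ oO) := cF k; apply.
by apply/Ck_mx => // i j; apply: cF.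
Qed.

(** The extensions of the coordinates live on different domains; being finitely many, these have an
    open intersection. *)
Lemma smooth_onP X Y (U : set X) (f : X -> Y) :
  smooth_on U f <-> forall x, U x -> forall j, rsm U x (fun x' => emb (f x') 0 j).
Proof.
split=> [sf x Ux j|sf x Ux].
  have [ O [F [oO Ox cF eF]]] := sf x Ux.
  exists O, (fun y => F y 0 j); split=> //; last by move=> x' Ux' Ox'; rewrite eF.
  by have /(Cinf_mx _ oO) := cF; apply.
have /choice[OF H] : forall j, exists OF : set 'rV[R]_(edim X) * ('rV[R]_(edim X) -> R),
    [/\ open OF.1, OF.1 (emb x), Cinf OF.1 OF.2 &
      forall x', U x' -> OF.1 (emb x') -> OF.2 (emb x') = emb (f x') 0 j].
  by move=> j; have [ O [F H]] := sf x Ux j; exists (O, F).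
pose O := [set y | forall j, (OF j).1 y].
have oO : open O.
  rewrite openE => y Oy.
  have Hj j : nbhs y (OF j).1.
    by have [oj _ _ _] := H j; apply: open_nbhs_nbhs; split; last exact: Oy.
  exact: filter_forall (nbhs_filter _) Hj.
exists O, (fun y => \row_j (OF j).2 y); split=> //.
- by move=> j; case: (H j).
- apply/Cinf_mx => // i j.
  have -> : (fun y => (\row_j (OF j).2 y) i j) = (OF j).2.
    by apply/funext => y; rewrite mxE.
  by move=> k; have [_ _ cF _] := H j; apply: Ck_sub (cF k) => y /(_ j).
- move=> x' Ux' Ox'; apply/rowP => j; rewrite mxE.
  by have [_ _ _ ->] := H j => //; apply: Ox'.
Qed.

Lemma smooth_on_comp X Y Z (U : set X) (V : set Y) (f : X -> Y) (g : Y -> Z) :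
  (forall x, U x -> V (f x)) -> smooth_on U f -> smooth_on V g ->
  smooth_on U (fun x => g (f x)).
Proof.
move=> UV sf /smooth_onP sg; apply/smooth_onP => x Ux j.
have [ O [F [oO Ox cF eF]]] := sf x Ux.
have [ O' [F' [oO' Ox' cF' eF']]] := sg (f x) (UV x Ux) j.
pose O2 := O `&` F @^-1` O'.
have oO2 : open O2 by apply: (open_preimage_Ck oO (cF 0%N)).
exists O2, (fun y => F' (F y)); split=> //.
- by split=> //=; rewrite eF.
- move=> k; apply: (@Ck_comp _ _ _ k O2 O') => //; first by move=> y [].
  by apply: Ck_sub (cF k) => y [].
- by move=> y Uy [Oy] /=; rewrite eF // => Oy'; rewrite eF' //; apply: UV.
Qed.

Lemma smooth_on_sub X Y (U U' : set X) (f : X -> Y) :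
  U' `<=` U -> smooth_on U f -> smooth_on U' f.
Proof.
move=> sU /smooth_onP sf; apply/smooth_onP => x Ux j.
by apply: rsm_sub (sf x (sU x Ux) j).
Qed.

Lemma smooth_on_eq X Y (U : set X) (f g : X -> Y) :
  (forall x, U x -> f x = g x) -> smooth_on U f -> smooth_on U g.
Proof.
move=> fg /smooth_onP sf; apply/smooth_onP => x Ux j.
by apply: rsm_eq (sf x Ux j) => x' /fg ->.
Qed.

Lemma smooth_on_cst X Y (U : set X) (y : Y) : smooth_on U (fun=> y).
Proof. by apply/smooth_onP => x Ux j; apply: rsm_cst. Qed.

Lemma rsm_emb X (U : set X) x j : rsm U x (fun x' => emb x' 0 j).
Proof.
exists setT, (fun y => y 0 j); split=> //; first exact: openT.
have cid : Cinf setT (fun y : 'rV[R]_(edim X) => y).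
  by move=> k; apply: (@Ck_linear _ _ _ k setT idfun) => y.
exact: (Cinf_mx _ (@openT _)).2 cid 0 j.
Qed.

(** Covers projections and inclusions of subspaces, whose coordinates are coordinates of the
    source. *)
Lemma smooth_on_emb X Y (U : set X) (f : X -> Y) (s : 'I_(edim Y) -> 'I_(edim X)) :
  (forall x j, emb (f x) 0 j = emb x 0 (s j)) -> smooth_on U f.
Proof.
move=> H; apply/smooth_onP => x Ux j.
by apply: rsm_eq (rsm_emb U x (s j)) => x' _; rewrite H.
Qed.

Lemma smooth_on_fst X Y (U : set (prod_space X Y)) :
  smooth_on U (fun p => p.1 : X).
Proof. by apply: (@smooth_on_emb (prod_space X Y) X U (fun p => p.1) (@lshift _ _)) => x j; rewrite row_mxEl. Qed.

Lemma smooth_on_snd X Y (U : set (prod_space X Y)) :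
  smooth_on U (fun p => p.2 : Y).
Proof. by apply: (@smooth_on_emb (prod_space X Y) Y U (fun p => p.2) (@rshift _ _)) => x j; rewrite row_mxEr. Qed.

Lemma smooth_on_val X (A : set X) (U : set (sub_space A)) :
  smooth_on U (fun p : sub_space A => sval p : X).
Proof. by apply: (@smooth_on_emb (sub_space A) X U (fun p => sval p) id). Qed.

Lemma smooth_on_pair X Y Z (U : set X) (f : X -> prod_space Y Z) :
  smooth_on U (fun x => (f x).1 : Y) -> smooth_on U (fun x => (f x).2 : Z) ->
  smooth_on U f.
Proof.
move=> /smooth_onP s1 /smooth_onP s2; apply/smooth_onP => x Ux j.
rewrite -(splitK j); case: (fintype.split j) => i /=.
  by apply: rsm_eq (s1 x Ux i) => x' _; rewrite row_mxEl.
by apply: rsm_eq (s2 x Ux i) => x' _; rewrite row_mxEr.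
Qed.

Lemma smooth_on_subspace X Y (A : set Y) (U : set X) (f : X -> sub_space A) :
  smooth_on U (fun x => sval (f x) : Y) -> smooth_on U f.
Proof. by []. Qed.

Lemma rsm_realify X (U : set X) x (I : finType) (f : X -> I -> R[i]) :
  (forall j, rsm U x (fun x' => realify (f x') 0 j)) <->
  (forall i, rsm U x (fun x' => complex.Re (f x' i)) /\
             rsm U x (fun x' => complex.Im (f x' i))).
Proof.
split=> [H i|H j].
  split.
    apply: rsm_eq (H (lshift _ (enum_rank i))) => x' _.
    by rewrite row_mxEl mxE enum_rankK.
  apply: rsm_eq (H (rshift _ (enum_rank i))) => x' _.
  by rewrite row_mxEr mxE enum_rankK.
rewrite -(splitK j); case: (fintype.split j) => i /=.
  by apply: rsm_eq (H (enum_val i)).1 => x' _; rewrite row_mxEl mxE.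
by apply: rsm_eq (H (enum_val i)).2 => x' _; rewrite row_mxEr mxE.
Qed.

Definition csm X (U : set X) (f : X -> R[i]) :=
  smooth_on U (f : X -> complex_space R).

Lemma csmP X (U : set X) (f : X -> R[i]) :
  csm U f <-> forall x (Ux : U x), csc (rsm_class Ux) f.
Proof.
split=> [/smooth_onP H x Ux|H].
  exact: ((rsm_realify U x (fun x' (_ : unit) => f x')).1 (H x Ux) tt).
apply/smooth_onP => x Ux.
by apply: (rsm_realify U x (fun x' (_ : unit) => f x')).2 => -[]; apply: H.
Qed.

Lemma smooth_on_mxP X m n (U : set X) (f : X -> mx_space R m n) :
  smooth_on U f <->
  forall x (Ux : U x), msc (rsm_class Ux) (f : X -> 'M[R[i]]_(m, n)).
Proof.
split=> [/smooth_onP H x Ux i j|H].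
  exact: ((rsm_realify U x (fun x' (ij : 'I_m * 'I_n) =>
    (f x' : 'M[R[i]]_(m, n)) ij.1 ij.2)).1 (H x Ux) (i, j)).
apply/smooth_onP => x Ux.
by apply: (rsm_realify U x (fun x' (ij : 'I_m * 'I_n) =>
  (f x' : 'M[R[i]]_(m, n)) ij.1 ij.2)).2 => -[i j]; apply: H.
Qed.

Lemma smooth_on_ffunP X (I : finType) (U : set X) (f : X -> ffun_space R I) :
  smooth_on U f <->
  forall i, csm U (fun x => (f x : {ffun I -> R[i]^o}) i).
Proof.
split=> [/smooth_onP H i|H].
  apply/csmP => x Ux.
  exact: ((rsm_realify U x (fun x' j => (f x' : {ffun I -> R[i]^o}) j)).1 (H x Ux) i).
apply/smooth_onP => x Ux.
apply: (rsm_realify U x (fun x' j => (f x' : {ffun I -> R[i]^o}) j)).2 => i.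
by have /csmP/(_ x Ux) := H i.
Qed.

Lemma opn_local X (U : set X) : (forall x, U x -> exists O : set 'rV[R]_(edim X),
  [/\ open O, O (emb x) & forall x', O (emb x') -> U x']) -> opn U.
Proof.
move=> H; exists (\bigcup_(O in [set O | open O /\ forall x', O (emb x') -> U x']) O).
split; first by apply: bigcup_open => O [].
move=> x; split=> [Ux|[ O [_ OU] Ox]]; last exact: OU.
by have [ O [oO Ox OU]] := H x Ux; exists O.
Qed.

Lemma opnP X (U : set X) : opn U -> forall x, U x -> exists O : set 'rV[R]_(edim X),
  [/\ open O, O (emb x) & forall x', O (emb x') -> U x'].
Proof.
move=> [ O [oO UO]] x Ux; exists O; split=> //; first exact/UO.
by move=> x' /UO.
Qed.

Lemma opnI X (U V : set X) : opn U -> opn V -> opn (U `&` V).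
Proof.
move=> [ O [oO UO]] [ O' [oO' UO']]; exists (O `&` O'); split; first exact: openI.
by move=> x; split=> [[/UO ? /UO' ?]|[/UO ? /UO' ?]].
Qed.

Lemma opnT X : opn [set: X].
Proof. by exists setT; split; [exact: openT|]. Qed.

Lemma opn_rsm X (U : set X) (f : X -> R) (A : set R) : opn U -> open A ->
  (forall x, U x -> rsm U x f) -> opn [set x | U x /\ A (f x)].
Proof.
move=> oU oA sf; apply: opn_local => x [Ux Ax].
have [ O [oO Ox OU]] := opnP oU Ux; have [ O' [F [oO' Ox' cF eF]]] := sf x Ux.
exists (O `&` (O' `&` F @^-1` A)); split.
- apply: openI => //; exact: (open_preimage_Ck oO' (cF 0%N)).
- by split=> //; split=> //=; rewrite eF.
- by move=> x' [/OU Ux' [Ox2 /=]]; rewrite eF.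
Qed.

Lemma opn_csm X (U : set X) (f : X -> R[i]) : opn U -> csm U f ->
  opn [set x | U x /\ f x != 0].
Proof.
move=> oU /csmP sf.
pose g x := complex.Re (f x) ^+ 2 + complex.Im (f x) ^+ 2.
have := @opn_rsm X U g [set r | r != 0] oU (@open_neq _ _).
rewrite (_ : [set x | U x /\ [set r | r != 0] (g x)] = [set x | U x /\ f x != 0]).
  apply => x Ux; have [f1 f2] := sf x Ux.
  by apply: (@sclD _ _ _ (rsm_class Ux)); apply: (@sclM _ _ _ (rsm_class Ux)).
apply/seteqP; split=> x /= [Ux]; rewrite /g.
  by move=> H; split=> //; apply: contra_neq H => ->; rewrite /= expr0n addr0.
move=> H; split=> //; apply: contra_neq H => /eqP.
rewrite paddr_eq0 ?sqr_ge0 // !sqrf_eq0; case: (f x) => a b /=.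
by move=> /andP[/eqP -> /eqP ->].
Qed.

Lemma opn_csm_pos X (U : set X) (f : X -> R[i]) : opn U -> csm U f ->
  opn [set x | U x /\ 0 < complex.Re (f x)].
Proof.
move=> oU /csmP sf.
apply: (@opn_rsm X U (fun x => complex.Re (f x)) [set r | 0 < r] oU (@open_gt _ _)).
by move=> x Ux; have [] := sf x Ux.
Qed.

Lemma opn_preimage X Y (U : set Y) (f : X -> Y) :
  smooth f -> opn U -> opn [set x | U (f x)].
Proof.
move=> sf oU; apply: opn_local => x Ux.
have [ O [oO Ox OU]] := opnP oU Ux; have [ O' [F [oO' Ox' cF eF]]] := sf x I.
exists (O' `&` F @^-1` O); split.
- exact: (open_preimage_Ck oO' (cF 0%N)).
- by split=> //=; rewrite eF.
- by move=> x' [Ox2 /=]; rewrite eF // => /OU.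
Qed.

End SmoothOn.

(** * Manifolds *)

Section Manifolds.
Variable R : realType.
Implicit Types X Y : space R.

Lemma Cinf_coord (V : normedModType R) m n (U : set V) (M : V -> 'M[R]_(m, n)) i j :
  open U -> Cinf U M -> Cinf U (fun x => M x i j).
Proof. by move=> oU /(Cinf_mx _ oU); apply. Qed.

Lemma Cinf_id (V : normedModType R) (U : set V) : Cinf U (fun x : V => x).
Proof. by move=> k; apply: (@Ck_linear _ _ _ k U idfun) => y. Qed.

Lemma Cinf_sub (V W : normedModType R) (U U' : set V) (f : V -> W) :
  U' `<=` U -> Cinf U f -> Cinf U' f.
Proof. by move=> sU cf k; apply: Ck_sub (cf k). Qed.

Lemma Cinf_comp (V : normedModType R) m n (U : set V) (O : set 'rV[R]_m)
    (G : V -> 'rV[R]_m) (F : 'rV[R]_m -> 'rV[R]_n) :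
  open U -> open O -> (forall x, U x -> O (G x)) ->
  Cinf U G -> Cinf O F -> Cinf U (fun x => F (G x)).
Proof.
move=> oU oO UO cG cF; apply/Cinf_mx => // i j k.
apply: (@Ck_comp _ _ _ k U O G (fun y => F y i j)) => //; exact: Cinf_coord.
Qed.

Lemma Cinf_row_mx (V : normedModType R) m n (U : set V)
    (F : V -> 'rV[R]_m) (G : V -> 'rV[R]_n) : open U ->
  Cinf U F -> Cinf U G -> Cinf U (fun x => row_mx (F x) (G x)).
Proof.
move=> oU cF cG; apply/Cinf_mx => // i j k.
rewrite -(splitK j); case: (fintype.split j) => l /=.
  by apply: Ck_eq (Cinf_coord i l oU cF k) => // x Ux; rewrite row_mxEl.
by apply: Ck_eq (Cinf_coord i l oU cG k) => // x Ux; rewrite row_mxEr.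
Qed.

Lemma Cinf_lsubmx m n (U : set 'rV[R]_(m + n)) : open U ->
  Cinf U (fun x : 'rV[R]_(m + n) => lsubmx x).
Proof.
move=> oU; apply/Cinf_mx => // i j k.
apply: Ck_eq (Cinf_coord i (lshift n j) oU (@Cinf_id _ U) k) => // x _.
by rewrite mxE.
Qed.

Lemma Cinf_rsubmx m n (U : set 'rV[R]_(m + n)) : open U ->
  Cinf U (fun x : 'rV[R]_(m + n) => rsubmx x).
Proof.
move=> oU; apply/Cinf_mx => // i j k.
apply: Ck_eq (Cinf_coord i (rshift m j) oU (@Cinf_id _ U) k) => // x _.
by rewrite mxE.
Qed.

Lemma open_lrsub m n (A : set 'rV[R]_m) (B : set 'rV[R]_n) : open A -> open B ->
  open [set z : 'rV[R]_(m + n) | A (lsubmx z) /\ B (rsubmx z)].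
Proof.
move=> oA oB; rewrite -[X in open X]setTI.
have -> : [set z : 'rV[R]_(m + n) | A (lsubmx z) /\ B (rsubmx z)] =
  (setT `&` (fun z : 'rV[R]_(m + n) => lsubmx z) @^-1` A) `&`
  (setT `&` (fun z : 'rV[R]_(m + n) => rsubmx z) @^-1` B).
  by apply/seteqP; split=> z /=; [case | case=> -[] _ ? [] _ ?].
rewrite setTI; apply: openI.
  exact: open_preimage_Ck openT (Cinf_lsubmx openT 0) oA.
exact: open_preimage_Ck openT (Cinf_rsubmx openT 0) oB.
Qed.

Lemma is_manifold_prod X Y :
  is_manifold X -> is_manifold Y -> is_manifold (prod_space X Y).
Proof.
move=> [d1 M1] [d2 M2]; exists (d1 + d2)%N => -[x y].
have [ O1 [W1 [f1 [g1 [[oO1 O1x oW1 cf1 cg1] H1 H1']]]]] := M1 x.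
have [ O2 [W2 [f2 [g2 [[oO2 O2y oW2 cf2 cg2] H2 H2']]]]] := M2 y.
exists [set z | O1 (lsubmx z) /\ O2 (rsubmx z)],
  [set z | W1 (lsubmx z) /\ W2 (rsubmx z)],
  (fun z => row_mx (f1 (lsubmx z)) (f2 (rsubmx z))),
  (fun z => row_mx (g1 (lsubmx z)) (g2 (rsubmx z))).
have oO := open_lrsub oO1 oO2; have oW := open_lrsub oW1 oW2.
split.
- split=> //; first by rewrite /= row_mxKl row_mxKr.
    apply: Cinf_row_mx => //.
      by apply: (Cinf_comp oO oO1) cf1 => [z []//|]; apply: Cinf_lsubmx.
    by apply: (Cinf_comp oO oO2) cf2 => [z []//|]; apply: Cinf_rsubmx.
  apply: Cinf_row_mx => //.
    by apply: (Cinf_comp oW oW1) cg1 => [z []//|]; apply: Cinf_lsubmx.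
  by apply: (Cinf_comp oW oW2) cg2 => [z []//|]; apply: Cinf_rsubmx.
- move=> [x' y'] /=; rewrite !row_mxKl !row_mxKr => -[/H1 [? ->] /H2 [? ->]].
  by [].
- move=> w [/= /H1' [e1 [x' Ox' ex']] /H2' [e2 [y' Oy' ey']]].
  rewrite !row_mxKl !row_mxKr e1 e2 hsubmxK; split=> //.
  by exists (x', y') => /=; rewrite ?row_mxKl ?row_mxKr ?ex' ?ey' // -ex' -ey'.
Qed.

Lemma is_manifold_open X (U : set X) :
  opn U -> is_manifold X -> is_manifold (sub_space U).
Proof.
move=> oU [d M]; exists d => -[x Ux].
have [ O [W [f [g [[oO Ox oW cf cg] H H']]]]] := M x.
have [ O1 [oO1 O1x O1U]] := opnP oU Ux.
(* The parameters are restricted to those whose image under the parametrisation stays in U. *)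
pose W' := W `&` g @^-1` O1.
have oW' : open W' by apply: (open_preimage_Ck oW (cg 0%N)).
exists (O `&` O1), W', f, g; split.
- split=> //; first exact: openI.
    by apply: Cinf_sub cf => z [].
  by apply: Cinf_sub cg => z [].
- by move=> [x' Ux'] [Ox' O1x'] /=; have [? e] := H x' Ox'; rewrite /W' /= e.
- move=> w [Ww /= O1w]; have [e [x' Ox' ex']] := H' w Ww; split=> //.
  have Ux' : U x' by apply: O1U; rewrite ex'.
  by exists (exist _ x' Ux'); rewrite //= ex' in Ox' O1w *; split.
Qed.

End Manifolds.

(** * The Cayley chart of the circle without 1 *)

Section CircleChart.
Variable R : realType.
Local Notation C := R[i].

(* The Cayley transform: Z is parametrised by the real line, tau being the inverse
   of zof, and tau reverses the order of Z. *)
Definition zof (t : R) : C :=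
  ((t ^+ 2 - 1) / (t ^+ 2 + 1) +i* (2 * t / (t ^+ 2 + 1)))%C.

Definition tau (z : C) : R := complex.Im z / (1 - complex.Re z).

Lemma sqrD1_neq0 (t : R) : t ^+ 2 + 1 != 0.
Proof. by rewrite gt_eqF // ltr_wpDl ?sqr_ge0. Qed.

Lemma normc1P (z : C) : `|z| = 1 <-> complex.Re z ^+ 2 + complex.Im z ^+ 2 = 1.
Proof.
case: z => a b /=; rewrite normc_def /=; split.
  move=> [/(congr1 (fun x => x ^+ 2))]; rewrite expr1n sqr_sqrtr //.
  by rewrite addr_ge0 ?sqr_ge0.
by move=> ->; rewrite sqrtr1.
Qed.

Lemma circle_Re_neq1 (z : C) : `|z| = 1 -> z <> 1 -> 1 - complex.Re z != 0.
Proof.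
move=> /normc1P e z1; apply: contra_not_neq z1 => /eqP; rewrite subr_eq0 => /eqP e1.
move: e; rewrite -e1 expr1n => /(canRL (addKr _)); rewrite addNr => /eqP.
by rewrite sqrf_eq0; case: z e1 => a b /= <- /eqP ->.
Qed.

Lemma zof_norm t : `|zof t| = 1.
Proof. by apply/normc1P => /=; have t0 := sqrD1_neq0 t; field. Qed.

Lemma zof_neq1 t : zof t <> 1.
Proof.
move=> [/eqP]; rewrite -subr_eq0; have t0 := sqrD1_neq0 t.
have -> : (t ^+ 2 - 1) / (t ^+ 2 + 1) - 1 = - 2 / (t ^+ 2 + 1) by field.
by rewrite mulf_eq0 oppr_eq0 pnatr_eq0 invr_eq0 (negbTE t0).
Qed.

Lemma zofK : cancel zof tau.
Proof.
move=> t; rewrite /tau /=; have t0 := sqrD1_neq0 t.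
have -> : 1 - (t ^+ 2 - 1) / (t ^+ 2 + 1) = 2 / (t ^+ 2 + 1) by field.
by field; rewrite ?t0 ?pnatr_eq0.
Qed.

Lemma tauK (z : C) : `|z| = 1 -> z <> 1 -> zof (tau z) = z.
Proof.
move=> z1 zn1; have := circle_Re_neq1 z1 zn1; move/normc1P: z1.
case: z zn1 => a b _ /= e a1; rewrite /zof /tau /=.
have eb : b ^+ 2 = (1 - a) * (1 + a) by rewrite -[RHS](_ : 1 - a ^+ 2 = _); [rewrite -e addrC addKr | ring].
have e1 : (b / (1 - a)) ^+ 2 = (1 + a) / (1 - a) by rewrite expr_div_n eb; field.
rewrite e1.
have e2 : (1 + a) / (1 - a) + 1 = 2 / (1 - a) by field.
have e3 : (1 + a) / (1 - a) - 1 = 2 * a / (1 - a) by field.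
rewrite e2 e3; have t2 : (2 : R) != 0 by rewrite pnatr_eq0.
by congr (_ +i* _)%C; field; rewrite ?a1 ?t2.
Qed.

(** Left inverse of [realify], defined on the whole ambient space because charts are functions of
    ambient points. *)
Definition unreal (I : finType) (x : 'rV[R]_(#|I| + #|I|)) (i : I) : C :=
  (x 0 (lshift _ (enum_rank i)) +i* x 0 (rshift _ (enum_rank i)))%C.

Lemma realifyK (I : finType) (f : I -> C) i : unreal (realify f) i = f i.
Proof.
by rewrite /unreal row_mxEl row_mxEr !mxE enum_rankK; case: (f i).
Qed.

Lemma csc_unreal k (I : finType) (U : set 'rV[R]_(#|I| + #|I|)) (oU : open U) (i : I) :
  csc (Ck_class k oU) (fun x => unreal x i).
Proof. by split; apply: (Cinf_coord _ _ oU (@Cinf_id _ _ U)). Qed.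

Lemma Ck_realify (V : normedModType R) k (U : set V) (oU : open U) (I : finType)
    (f : V -> I -> C) :
  (forall i, csc (Ck_class k oU) (fun x => f x i)) -> Ck k U (fun x => realify (f x)).
Proof.
move=> H; apply/Ck_mx => // i j; rewrite ord1 -(splitK j).
case: (fintype.split j) => l /=.
  by apply: Ck_eq (H (enum_val l)).1 => // x Ux; rewrite row_mxEl mxE.
by apply: Ck_eq (H (enum_val l)).2 => // x Ux; rewrite row_mxEr mxE.
Qed.

Lemma is_manifold_Z : is_manifold (Zspace R).
Proof.
exists 1%N => -[z [z1 zn1]].
pose O : set 'rV[R]_(#|{: unit}| + #|{: unit}|) := [set x | 1 - complex.Re (unreal x tt) != 0].
have oO : open O.
  rewrite -[X in open X]setTI.
  have := @open_preimage_Ck _ _ _ 0 setT (fun x : 'rV[R]_(#|{: unit}| + #|{: unit}|) =>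
    1 - complex.Re (unreal x tt) : R) [set r | r != 0] openT.
  apply; last exact: open_neq.
  apply: CkD => //; [exact: openT|exact: Ck_cst|apply: CkN; first exact: openT].
  by case: (csc_unreal 0 (@openT _) tt).
exists O, setT, (fun x => const_mx (tau (unreal x tt))),
  (fun w : 'rV[R]_1 => realify (fun _ : unit => zof (w 0 0))).
split.
- split=> //.
  + change (1 - complex.Re (unreal (realify (fun _ : unit => z)) tt) != 0).
    by rewrite realifyK; apply: circle_Re_neq1.
  + exact: openT.
  + apply/Cinf_mx => // i j k; have [u1 u2] := csc_unreal k oO tt.
    apply: (Ck_eq (f := fun x => complex.Im (unreal x tt) / (1 - complex.Re (unreal x tt)))) => //.
      by move=> x _; rewrite mxE.
    apply: CkM => //; apply: CkV => //.
    by apply: CkD => //; [exact: Ck_cst | exact: CkN].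
  + move=> k; have oT := @openT ('rV[R]_1).
    apply: (Ck_realify (oU := oT)) => _.
    have ct : Ck k setT (fun w : 'rV[R]_1 => w 0 0) by apply: (Cinf_coord _ _ oT (@Cinf_id _ _ _)).
    have ct2 := CkM oT ct ct.
    have c1 (a : R) : Ck k setT (fun w : 'rV[R]_1 => a) by apply: Ck_cst.
    have cd : Ck k setT (fun w : 'rV[R]_1 => (w 0 0 * w 0 0 + 1)^-1).
      by apply: CkV => // [x _|]; [rewrite -expr2 sqrD1_neq0|apply: CkD].
    split.
      by apply: Ck_eq (CkM oT (CkD oT ct2 (c1 (-1))) cd) => // x _ /=; rewrite -!expr2.
    by apply: Ck_eq (CkM oT (CkM oT (c1 2) ct) cd) => // x _ /=; rewrite -!expr2.
- move=> [z' [z'1 z'n1]] /= _; split=> //; congr realify.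
  by apply/funext => -[]; rewrite mxE realifyK tauK.
- move=> w _; split.
    by apply/rowP => i; rewrite mxE realifyK zofK ord1.
  exists (exist _ (zof (w 0 0)) (conj (zof_norm _) (@zof_neq1 _))) => //.
  change (1 - complex.Re (unreal (realify (fun _ : unit => zof (w 0 0))) tt) != 0).
  by rewrite realifyK; apply: circle_Re_neq1; [exact: zof_norm|exact: zof_neq1].
Qed.

End CircleChart.

(** * U(n) as a manifold, by the Cayley transform *)

Section UnManifold.
Variables (R : realType) (n : nat).
Local Notation C := R[i].

Lemma trC_mul m p q (A : 'M[C]_(m, p)) (B : 'M[C]_(p, q)) :
  (A *m B)^t* = B^t* *m A^t*.
Proof. by rewrite trmx_mul map_mxM. Qed.

Lemma trCK m p (A : 'M[C]_(m, p)) : A^t* ^t* = A.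
Proof. by apply/matrixP => i j; rewrite !mxE conjCK. Qed.

Lemma trCD m p (A B : 'M[C]_(m, p)) : (A + B)^t* = A^t* + B^t*.
Proof. by apply/matrixP => i j; rewrite !mxE rmorphD. Qed.

Lemma trCN m p (A : 'M[C]_(m, p)) : (- A)^t* = - A^t*.
Proof. by apply/matrixP => i j; rewrite !mxE rmorphN. Qed.

Lemma trCZ m p (a : C) (A : 'M[C]_(m, p)) : (a *: A)^t* = a^* *: A^t*.
Proof. by apply/matrixP => i j; rewrite !mxE rmorphM. Qed.

Lemma trC1 p : (1%:M : 'M[C]_p)^t* = 1%:M.
Proof. by apply/matrixP => i j; rewrite !mxE eq_sym; case: eqP => _; rewrite ?conjC1 ?conjC0. Qed.

Lemma rowsq_eq0 p (x : 'rV[C]_p) : x *m x^t* = 0 -> x = 0.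
Proof.
move=> /matrixP/(_ 0 0); rewrite !mxE => /eqP.
rewrite psumr_eq0 => [/allP H|i _]; last by rewrite !mxE mul_conjC_ge0.
apply/rowP => i; have := H i (mem_index_enum _); rewrite /= !mxE.
by rewrite mul_conjC_eq0 => /eqP.
Qed.

Lemma unitary_mulV (u : 'M[C]_n) : u \is unitarymx -> u *m u^t* = 1%:M.
Proof. by move/unitarymxP. Qed.

Lemma unitary_Vmul (u : 'M[C]_n) : u \is unitarymx -> u^t* *m u = 1%:M.
Proof. by move=> /unitarymxP /mulmx1C. Qed.

Definition inv_mx (A : 'M[C]_n) : 'M[C]_n := (\det A)^-1 *: \adj A.

Lemma inv_mxE (A : 'M[C]_n) : A \in unitmx -> inv_mx A = invmx A.
Proof. by rewrite /inv_mx /invmx => ->. Qed.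

(** If x V = 0 for a row x, then x x^* = x V x^* + x V^* x^* = 0, so x = 0. *)
Lemma cayley_unit (V : 'M[C]_n) : V + V^t* = 1%:M -> V \in unitmx.
Proof.
move=> VV; rewrite -row_free_unit -kermx_eq0; apply/eqP/row_matrixP => i.
rewrite row0; set x := row i _.
have xV : x *m V = 0 by apply/sub_kermxP; exact: row_sub.
apply: rowsq_eq0; rewrite -[X in X *m _]mulmx1 -VV mulmxDr xV add0r.
by rewrite -mulmxA -trC_mul xV trmx0 map_mx0 mulmx0.
Qed.

(** V^* = 1 - V commutes with V, and V^-1 - 1 = V^-1 V^* is the quotient of V^* by V. *)
Lemma cayley_unitary (V : 'M[C]_n) : V + V^t* = 1%:M ->
  invmx V - 1%:M \is unitarymx.
Proof.
move=> VV; have uV := cayley_unit VV; apply/unitarymxP.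
have VE : V^t* = 1%:M - V by rewrite -VV addrC addKr.
have e1 : invmx V - 1%:M = invmx V *m V^t*.
  by rewrite VE mulmxBr mulmx1 mulVmx.
have e2 : (invmx V - 1%:M)^t* = V *m (invmx V)^t*.
  by rewrite e1 trC_mul trCK.
rewrite {}e2 {}e1 mulmxA -(mulmxA (invmx V)).
have -> : V^t* *m V = V *m V^t* by rewrite VE mulmxBl mulmxBr mul1mx mulmx1.
rewrite mulmxA mulVmx // mul1mx -trC_mul mulVmx //; exact: trC1.
Qed.

(** V u = 1 - V, so it suffices that V^* = V u. As (1 + u)^* = u^* (1 + u), the matrix V u is a
    right inverse of (1 + u)^*, whose inverse is V^*. *)
Lemma cayley_inv (u : 'M[C]_n) : u \is unitarymx -> 1%:M + u \in unitmx ->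
  let V := invmx (1%:M + u) in V + V^t* = 1%:M.
Proof.
move=> uu u1 V; have V1 : V *m (1%:M + u) = 1%:M by apply: mulVmx.
have Vu : V *m u = 1%:M - V by rewrite -V1 mulmxDr mulmx1 addrC addKr.
have -> : V^t* = V *m u; last by rewrite Vu addrC subrK.
have e : (1%:M + u)^t* *m (V *m u) = 1%:M.
  have -> : (1%:M + u)^t* = u^t* *m (1%:M + u).
    by rewrite mulmxDr mulmx1 unitary_Vmul // trCD trC1 addrC.
  by rewrite -mulmxA (mulmxA _ V) mulmxV // mul1mx unitary_Vmul.
have e' : V^t* *m (1%:M + u)^t* = 1%:M by rewrite -trC_mul mulmxV // trC1.
by rewrite -[LHS]mulmx1 -e mulmxA e' mul1mx.
Qed.

Definition mxu (x : 'rV[R]_(#|{: 'I_n * 'I_n}| + #|{: 'I_n * 'I_n}|)) : 'M[C]_n :=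
  \matrix_(i, j) unreal x (i, j).

Lemma mxu_realify (A : 'M[C]_n) : mxu (realify (fun ij => A ij.1 ij.2)) = A.
Proof. by apply/matrixP => i j; rewrite mxE realifyK. Qed.

Lemma msc_mxu k U (oU : open U) : msc (Ck_class k oU) mxu.
Proof.
by move=> i j; apply: csc_ext (csc_unreal k oU (i, j)) => x; rewrite mxE.
Qed.

(** A real-linear bijection from real matrices w onto skew-Hermitian ones: twice the antisymmetric
    part of w becomes the real part, twice the symmetric part the imaginary part. *)
Definition skew (w : 'rV[R]_#|{: 'I_n * 'I_n}|) : 'M[C]_n :=
  \matrix_(i, j) ((w 0 (enum_rank (i, j)) - w 0 (enum_rank (j, i))) +i*
                  (w 0 (enum_rank (i, j)) + w 0 (enum_rank (j, i))))%C.

Definition unskew (S : 'M[C]_n) : 'rV[R]_#|{: 'I_n * 'I_n}| :=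
  \row_k ((complex.Re (S (enum_val k).1 (enum_val k).2) +
           complex.Im (S (enum_val k).1 (enum_val k).2)) / 2).

Lemma skewP w : skew w + (skew w)^t* = 0.
Proof.
apply/matrixP => i j; rewrite !mxE; simpc.
by congr (_ +i* _)%C; ring.
Qed.

Lemma skewK w : unskew (skew w) = w.
Proof.
apply/rowP => k; rewrite !mxE /= -surjective_pairing enum_valK.
by field.
Qed.

Lemma unskewK (S : 'M[C]_n) : S + S^t* = 0 -> skew (unskew S) = S.
Proof.
move=> /matrixP SS; apply/matrixP => i j; rewrite !mxE !enum_rankK /=.
have := SS i j; rewrite !mxE; case: (S i j) => a b; case: (S j i) => c d /=.
case=> /eqP; rewrite addr_eq0 => /eqP -> /eqP; rewrite subr_eq0 => /eqP ->.
by congr (_ +i* _)%C; field.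
Qed.

Lemma open_csc (V : normedModType R) (U : set V) (oU : open U) (F : V -> C) :
  csc (Ck_class 0 oU) F -> open (U `&` [set x | F x != 0]).
Proof.
move=> [F1 F2].
have := CkD oU (CkM oU F1 F1) (CkM oU F2 F2).
move=> /open_preimage_Ck => /(_ _ oU (@open_neq _ 0)).
congr open; apply/seteqP; split=> x /= [Ux H]; split=> //; apply: contra_neq H.
  by move=> ->; rewrite /= !mulr0 addr0.
move=> /eqP; rewrite -!expr2 paddr_eq0 ?sqr_ge0 // !sqrf_eq0; case: (F x) => a b /=.
by move=> /andP[/eqP -> /eqP ->].
Qed.

(** The centre of the affine space of matrices V with V + V^* = 1: subtracting it leaves a
    skew-Hermitian matrix. *)
Definition half_mx : 'M[C]_n := (2^-1)%:M.

Lemma half_mxP : half_mx + half_mx^t* = 1%:M.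
Proof.
have -> : half_mx^t* = half_mx.
  by rewrite /half_mx -scalemx1 trCZ trC1 fmorphV rmorph_nat.
by rewrite /half_mx -raddfD /=; congr (_%:M); field.
Qed.

(* Chart at g0: the Cayley transform sends g to the skew-Hermitian matrix
   S = (1 + g0^* g)^-1 - 1/2, and S is coded by the real matrix Re S + Im S. *)
Lemma is_manifold_Un : is_manifold (Un R n).
Proof.
exists #|{: 'I_n * 'I_n}|; case=> g0' ug0'.
pose g0 : 'M[C]_n := g0'; have ug0 : g0 \is unitarymx by exact: ug0'.
pose uu x := g0^t* *m mxu x.
pose O := [set x | \det (1%:M + uu x) != 0].
have msc_uu k U (oU : open U) : msc (Ck_class k oU) (fun x => 1%:M + uu x).
  apply: mscD; first exact: msc_cst.
  by apply: msc_mul; [exact: msc_cst | exact: msc_mxu].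
have oO : open O by rewrite -[X in open X]setTI; apply: (open_csc (oU := openT)); apply: csc_det; apply: msc_uu.
exists O, setT, (fun x => unskew (inv_mx (1%:M + uu x) - half_mx)),
  (fun w => realify (fun ij : 'I_n * 'I_n =>
     (g0 *m (inv_mx (half_mx + skew w) - 1%:M)) ij.1 ij.2)).
have VP w : (half_mx + skew w) + (half_mx + skew w)^t* = 1%:M.
  by rewrite trCD addrACA skewP addr0 half_mxP.
have uE (g : 'M[C]_n) : uu (realify (fun ij => g ij.1 ij.2)) = g0^t* *m g.
  by rewrite /uu mxu_realify.
split.
- split.
  + exact: oO.
  + change (\det (1%:M + uu (realify (fun ij => g0 ij.1 ij.2))) != 0).
    rewrite uE unitary_Vmul // -[1%:M]scale1r -scalerDl scalemx1 det_scalar.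
    by rewrite expf_neq0 // -[1 + 1]/(2%:R) pnatr_eq0.
  + exact: openT.
  + move=> k; apply/Ck_mx => // i j.
    have : msc (Ck_class k oO) (fun x => inv_mx (1%:M + uu x) - half_mx).
      apply: mscB; last exact: msc_cst.
      by apply: msc_inv => // x; rewrite unitmxE unitfE.
    move=> /(_ (enum_val j).1 (enum_val j).2) [s1 s2].
    apply: (Ck_eq oO _ (CkM oO (CkD oO s1 s2) (Ck_cst k O (2^-1 : R)))) => x _.
    by rewrite [in RHS]mxE.
  + move=> k; apply: (Ck_realify (oU := openT)) => -[i j] /=.
    move: i j; apply: msc_mul; first exact: msc_cst.
    apply: mscB; last exact: msc_cst.
    apply: msc_inv => [w _|]; first exact: cayley_unit.
    apply: mscD; first exact: msc_cst.
    have cw i : Ck k setT (fun w : 'rV[R]_#|{: 'I_n * 'I_n}| => w 0 i).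
      by apply: Cinf_coord; [exact: openT|exact: Cinf_id].
    move=> i j; split.
      apply: (Ck_eq openT _ (CkD openT (cw (enum_rank (i, j)))
        (CkN openT (cw (enum_rank (j, i)))))) => x _.
      by rewrite mxE.
    apply: (Ck_eq openT _ (CkD openT (cw (enum_rank (i, j)))
        (cw (enum_rank (j, i))))) => x _.
    by rewrite mxE.
- suff H (g : 'M[C]_n) : g \is unitarymx -> \det (1%:M + g0^t* *m g) != 0 ->
      g0 *m (inv_mx (half_mx + skew (unskew (inv_mx (1%:M + g0^t* *m g) - half_mx)))
             - 1%:M) = g.
    case=> g ug; change (emb _) with (realify (fun ij : 'I_n * 'I_n => (g : 'M[C]_n) ij.1 ij.2)).
    rewrite /O /mkset uE => /(H _ ug) e; split=> //.
    by congr realify; apply/funext => ij; rewrite e.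
  move=> ug gO.
  have gU : 1%:M + g0^t* *m g \in unitmx by rewrite unitmxE unitfE.
  have ugg : g0^t* *m g \is unitarymx.
    by apply: mul_unitarymx ug; rewrite trmxC_unitary.
  rewrite (inv_mxE gU); set V := invmx _.
  have V1 : V + V^t* = 1%:M by exact: cayley_inv ugg gU.
  rewrite unskewK; last first.
    by rewrite trCD trCN addrACA -opprD V1 half_mxP subrr.
  rewrite (addrC half_mx) subrK inv_mxE ?unitmx_inv // invmxK.
  by rewrite (addrC 1%:M) addrK mulmxA unitary_mulV // mul1mx.
- move=> w _; have uV := cayley_unit (VP w); have uuV := cayley_unitary (VP w).
  have ug := mul_unitarymx ug0 uuV.
  have e : uu (realify (fun ij : 'I_n * 'I_n =>
      (g0 *m (inv_mx (half_mx + skew w) - 1%:M)) ij.1 ij.2)) =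
      invmx (half_mx + skew w) - 1%:M.
    by rewrite uE mulmxA (unitary_Vmul ug0) mul1mx (inv_mxE uV).
  split.
    rewrite e (addrC 1%:M) subrK inv_mxE ?unitmx_inv // invmxK.
    by rewrite (addrC half_mx) addrK skewK.
  exists (exist _ (g0 *m (invmx (half_mx + skew w) - 1%:M)) ug).
    change (\det (1%:M + uu (realify (fun ij : 'I_n * 'I_n =>
      (g0 *m (invmx (half_mx + skew w) - 1%:M)) ij.1 ij.2))) != 0).
    rewrite -(inv_mxE uV) e (addrC 1%:M) subrK -unitfE -unitmxE.
    by rewrite unitmx_inv.
  change (realify (fun ij : 'I_n * 'I_n => (g0 *m (invmx (half_mx + skew w) - 1%:M)) ij.1 ij.2) =
    realify (fun ij : 'I_n * 'I_n => (g0 *m (inv_mx (half_mx + skew w) - 1%:M)) ij.1 ij.2)).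
  by congr realify; apply/funext => ij; rewrite (inv_mxE uV).
Qed.

End UnManifold.

(** * The Lie group U(n), its actions on itself and on Y, and the submersion Y -> U(n) *)

Section LieGroup.
Variables (R : realType) (n : nat).
Local Notation C := R[i].
Implicit Types X : space R.

Lemma smooth_on_mulmx X m p q (U : set X) (f : X -> mx_space R m p)
    (g : X -> mx_space R p q) : smooth_on U f -> smooth_on U g ->
  smooth_on U (fun x => (f x : 'M[C]_(m, p)) *m (g x : 'M[C]_(p, q)) : mx_space R m q).
Proof.
move=> /smooth_on_mxP sf /smooth_on_mxP sg; apply/smooth_on_mxP => x Ux.
by apply: msc_mul; [apply: sf | apply: sg].
Qed.

Lemma smooth_on_trC X m p (U : set X) (f : X -> mx_space R m p) :
  smooth_on U f -> smooth_on U (fun x => (f x : 'M[C]_(m, p))^t* : mx_space R p m).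
Proof.
move=> /smooth_on_mxP sf; apply/smooth_on_mxP => x Ux.
by apply: msc_trC; apply: sf.
Qed.

Lemma Un_eq (g h : Un R n) : mx_of g = mx_of h -> g = h.
Proof. by move: g h => [g ug] [h uh] /= e; apply: eq_exist. Qed.

Lemma mx_of_unitary (g : Un R n) : mx_of g \is unitarymx.
Proof. exact: svalP g. Qed.

Lemma smooth_on_mx_of X (U : set X) (f : X -> Un R n) :
  smooth_on U f -> smooth_on U (fun x => mx_of (f x) : mx_space R n n).
Proof. by []. Qed.

Lemma is_lie_group_Un : is_lie_group (Un R n).
Proof.
split.
- exact: is_manifold_Un.
- split.
  + by move=> a b c; apply: Un_eq => /=; rewrite /mx_of /= mulmxA.
  + by move=> a; apply: Un_eq; rewrite /mx_of /= mul1mx.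
  + by move=> a; apply: Un_eq; rewrite /mx_of /= mulmx1.
  + move=> a; apply: Un_eq; exact: (unitary_Vmul (mx_of_unitary a)).
  + move=> a; apply: Un_eq; exact: (unitary_mulV (mx_of_unitary a)).
- apply: smooth_on_subspace; apply: smooth_on_mulmx.
    by apply: (@smooth_on_comp _ (prod_space (Un R n) (Un R n)) (Un R n) _ _ setT
      (fun p => p.1) sval) => //; [exact: smooth_on_fst|exact: smooth_on_val].
  by apply: (@smooth_on_comp _ (prod_space (Un R n) (Un R n)) (Un R n) _ _ setT
    (fun p => p.2) sval) => //; [exact: smooth_on_snd|exact: smooth_on_val].
- by apply: smooth_on_subspace; apply: smooth_on_trC; exact: smooth_on_val.
Qed.

Lemma mx_of_adj (g h : Un R n) : mx_of (adj g h) = (mx_of h)^t* *m mx_of g *m mx_of h.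
Proof. by []. Qed.

Lemma smooth_on_adj X (U : set X) (f g : X -> Un R n) :
  smooth_on U f -> smooth_on U g -> smooth_on U (fun x => adj (f x) (g x)).
Proof.
move=> sf sg; apply: smooth_on_subspace.
by apply: smooth_on_mulmx => //; apply: smooth_on_mulmx => //; apply: smooth_on_trC.
Qed.

Lemma adj1 (g : Un R n) : adj g (gone (Un R n)) = g.
Proof.
by apply: Un_eq; rewrite mx_of_adj /mx_of /= trC1 mul1mx mulmx1.
Qed.

Lemma adjM (g h k : Un R n) : adj (adj g h) k = adj g (gmul h k).
Proof.
by apply: Un_eq; rewrite !mx_of_adj {5 6}/mx_of /= trC_mul !mulmxA.
Qed.

Lemma smooth_right_action_adj : smooth_right_action (@adj R n).
Proof.
split; [exact: adj1 | exact: adjM |].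
by apply: smooth_on_adj; [exact: smooth_on_fst | exact: smooth_on_snd].
Qed.

Lemma Y_eq (y y' : Yspace R n) :
  sval (sval y).1 = sval (sval y').1 -> (sval y).2 = (sval y').2 -> y = y'.
Proof.
move: y y' => [[[z Zz] g] yg] [[[z' Zz'] g'] yg'] /= e1 e2; subst g'.
by apply: eq_exist; congr pair; apply: eq_exist.
Qed.

Lemma smooth_right_action_adjY : smooth_right_action (@adjY R n).
Proof.
split.
- by move=> y; apply: Y_eq => //=; rewrite adj1.
- by move=> y g h; apply: Y_eq => //=; rewrite adjM.
- apply: smooth_on_subspace; apply: smooth_on_pair => /=.
    apply: (@smooth_on_comp _ (prod_space (Yspace R n) (Un R n)) (Yspace R n) _ _ setT
      (fun p => p.1) (fun y => (sval y).1)) => //; first exact: smooth_on_fst.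
    apply: (@smooth_on_comp _ (Yspace R n) (prod_space (Zspace R) (Un R n)) _ _ setT
      sval (fun y => y.1)) => //; [exact: smooth_on_val|exact: smooth_on_fst].
  apply: smooth_on_adj; last exact: smooth_on_snd.
  apply: (@smooth_on_comp _ (prod_space (Yspace R n) (Un R n)) (Yspace R n) _ _ setT
    (fun p => p.1) (fun y => (sval y).2)) => //; first exact: smooth_on_fst.
  apply: (@smooth_on_comp _ (Yspace R n) (prod_space (Zspace R) (Un R n)) _ _ setT
    sval (fun y => y.2)) => //; [exact: smooth_on_val|exact: smooth_on_snd].
Qed.

Lemma eigvalP (A : 'M[C]_n) z : eigval A z <-> \det (A - z%:M) = 0.
Proof.
rewrite -det_tr; split.
  move=> [v v0 Av]; apply/eqP/det0P; exists v^T; first by rewrite trmx_eq0.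
  by rewrite -trmx_mul mulmxBl Av mul_scalar_mx subrr trmx0.
move=> /eqP/det0P[v v0 vA]; exists v^T; first by rewrite trmx_eq0.
apply/eqP; rewrite -subr_eq0 -mul_scalar_mx -mulmxBl.
by rewrite -[X in _ *m X]/(v^T) -[A - _]trmxK -trmx_mul vA trmx0.
Qed.

(** [eigenvalue] speaks of row vectors and [eigval] of columns, hence the transposes. *)
Lemma eigval_root (A : 'M[C]_n) z : eigval A z <-> root (char_poly A) z.
Proof.
have -> : char_poly A = char_poly A^T.
  rewrite /char_poly -[LHS]det_tr /char_poly_mx raddfB /= tr_scalar_mx.
  by rewrite map_trmx.
rewrite -eigenvalue_root_char; split.
  move=> [v v0 Av]; apply/eigenvalueP; exists v^T; last by rewrite trmx_eq0.
  by rewrite -trmx_mul Av linearZ.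
move=> /eigenvalueP[v vA v0]; exists v^T; first by rewrite trmx_eq0.
by rewrite -[A]trmxK -trmx_mul vA linearZ.
Qed.

(** Y is the open subset det (g - z) != 0 of the product Z x U(n). *)
Lemma is_manifold_Y : is_manifold (Yspace R n).
Proof.
apply: is_manifold_open; last first.
  by apply: is_manifold_prod; [exact: is_manifold_Z | exact: is_manifold_Un].
pose f (p : prod_space (Zspace R) (Un R n)) : C := \det (mx_of p.2 - (sval p.1 : C)%:M).
suff : opn [set p : prod_space (Zspace R) (Un R n) | setT p /\ f p != 0].
  congr opn; apply/seteqP; split=> p /=; rewrite eigvalP /f; first by case=> _ /eqP.
  by move=> H; split=> //; apply/eqP.
apply: opn_csm; first exact: opnT.
apply/csmP => p Tp; apply: csc_det.
have s2 : smooth (fun p : prod_space (Zspace R) (Un R n) => mx_of p.2 : mx_space R n n).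
  apply: (@smooth_on_comp _ (prod_space (Zspace R) (Un R n)) (Un R n) _ _ setT
    (fun p => p.2) sval) => //; [exact: smooth_on_snd|exact: smooth_on_val].
have s1 : csm setT (fun p : prod_space (Zspace R) (Un R n) => sval p.1 : C).
  apply: (@smooth_on_comp _ (prod_space (Zspace R) (Un R n)) (Zspace R) _ _ setT
    (fun p => p.1) sval) => //; [exact: smooth_on_fst|exact: smooth_on_val].
apply: mscB; first by have /smooth_on_mxP := s2; apply.
move=> i j; have := (csmP _ _).1 s1 p Tp => sz.
apply: csc_ext (cscM sz (csc_cst _ ((i == j)%:R))) => x.
by rewrite mxE mulr_natr.
Qed.

Definition Zpt (t : R) : Zspace R := exist _ (zof t) (conj (zof_norm _) (@zof_neq1 _ t)).

Lemma zof_inj : injective (@zof R).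
Proof. exact: can_inj (@zofK R). Qed.

(** The points [zof i] with i below the size of the characteristic polynomial are more numerous than
    its roots. *)
Lemma Ypi_surj (g : Un R n) : exists y, Ypi y = g.
Proof.
have [t ht] : exists t, ~ eigval (mx_of g) (zof t).
  apply: contrapT => /forallNP H.
  have p0 : char_poly (mx_of g) != 0 by apply: monic_neq0; exact: char_poly_monic.
  pose s := [seq zof (i%:R : R) | i <- iota 0 (size (char_poly (mx_of g)))].
  have rs : all (root (char_poly (mx_of g))) s.
    by apply/allP => z /mapP[i _ ->]; apply/eigval_root; exact: contrapT (H _).
  have us : uniq s.
    by rewrite map_inj_uniq ?iota_uniq // => i j /zof_inj /eqP; rewrite eqr_nat => /eqP.
  by have := max_poly_roots p0 rs us; rewrite size_map size_iota ltnn.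
by exists (exist (fun p : prod_space (Zspace R) (Un R n) => ~ eigval (mx_of p.2) (sval p.1)) (Zpt t, g) ht).
Qed.

Lemma smooth_Ypi : smooth (@Ypi R n).
Proof.
apply: (@smooth_on_comp _ (Yspace R n) (prod_space (Zspace R) (Un R n)) _ _ setT
    sval (fun y => y.2)) => //; [exact: smooth_on_val|exact: smooth_on_snd].
Qed.

Lemma csc_realify (V : normedModType R) k (I : finType) (U : set V) (oU : open U)
    (f : V -> I -> C) :
  Cinf U (fun x => realify (f x)) -> forall i, csc (Ck_class k oU) (fun x => f x i).
Proof.
move=> cf i; split.
  apply: Ck_eq (Cinf_coord 0 (lshift _ (enum_rank i)) oU cf k) => // x _.
  by rewrite row_mxEl mxE enum_rankK.
apply: Ck_eq (Cinf_coord 0 (rshift _ (enum_rank i)) oU cf k) => // x _.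
by rewrite row_mxEr mxE enum_rankK.
Qed.

(** A curve c in U(n) through g lifts to (z, c) with z constant: z stays outside the spectrum of c t
    for small t. The tangent vector w thus lifts to (0, w). *)
Lemma submersion_Ypi : submersion (@Ypi R n).
Proof.
split; first exact: smooth_Ypi.
move=> y w [c [[ O [oO O0 cO]] c0 dc]].
pose z := (sval y).1; pose F t := \det (mx_of (c t) - (sval z : C)%:M).
have cF : csc (Ck_class 0 oO) F.
  apply: csc_det; apply: mscB; last exact: msc_cst.
  move=> i j; have := (csc_realify 0 oO (f := fun t (ij : 'I_n * 'I_n) =>
    mx_of (c t) ij.1 ij.2) cO (i, j)).
  by apply.
have oO' := open_csc cF; set O' := O `&` _ in oO'.
have okP t : O' t -> ~ eigval (mx_of (c t)) (sval z).
  by move=> [_ /= Ft] /eigvalP; apply/eqP.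
have O'0 : O' 0.
  by split=> //=; apply/eqP => /eigvalP; rewrite c0; exact: svalP y.
(* Away from the times where z is not an eigenvalue of c t the lift takes the default value y; only
   its germ at 0 matters. *)
pose yt t : Yspace R n := match pselect (~ eigval (mx_of (c t)) (sval z)) with
  | left h => exist (fun p : prod_space (Zspace R) (Un R n) =>
      ~ eigval (mx_of p.2) (sval p.1)) (z, c t) h
  | right _ => y end.
have ytE t : O' t -> sval (yt t) = (z, c t).
  by rewrite /yt => /okP; case: pselect.
have yt0 : yt 0 = y by apply: Y_eq; rewrite ytE //= c0.
have cO' : Cinf O' (fun t => row_mx (emb z) (emb (c t))).
  apply: Cinf_row_mx => //; first by move=> k; apply: Ck_cst.
  by apply: Cinf_sub cO => t [].
have near_yt : \forall t \near (0 : R), row_mx (emb z) (emb (c t)) = emb (yt t).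
  have : nbhs (0 : R) O' by apply: open_nbhs_nbhs.
  by apply: filterS => t /ytE /= ->.
exists (row_mx 0 w), yt.
  split=> //.
    by exists O'; split=> // k; apply: Ck_eq (cO' k) => // t /ytE /= ->.
  apply: (near_eq_is_derive near_yt).
  have /derivable_mxP dc' := @ex_derive _ _ _ _ _ _ _ dc.
  have d : derivable (fun t => row_mx (emb z) (emb (c t))) 0 1.
    apply/derivable_mxP => i j; rewrite -(splitK j); case: (fintype.split j) => l /=.
      have -> : (fun t => row_mx (emb z) (emb (c t)) i (lshift _ l)) = cst (emb z i l).
        by apply/funext => t; rewrite row_mxEl.
      exact: derivable_cst.
    have -> : (fun t => row_mx (emb z) (emb (c t)) i (rshift _ l)) =
        (fun t => emb (c t) i l).
      by apply/funext => t; rewrite row_mxEr.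
    exact: dc'.
  apply: DeriveDef => //; rewrite derive_mx //; apply/matrixP => i j; rewrite mxE.
  rewrite -(splitK j); case: (fintype.split j) => l /=.
    rewrite row_mxEl mxE.
    have -> : (fun t => row_mx (emb z) (emb (c t)) i (lshift _ l)) = cst (emb z i l).
      by apply/funext => t; rewrite row_mxEl.
    exact: derive_cst.
  rewrite row_mxEr.
  have -> : (fun t => row_mx (emb z) (emb (c t)) i (rshift _ l)) =
      (fun t => emb (c t) i l).
    by apply/funext => t; rewrite row_mxEr.
  by rewrite -(@derive_val _ _ _ _ _ _ _ dc) (derive_mx (@ex_derive _ _ _ _ _ _ _ dc)) mxE.
split=> //=; last 2 first.
- by rewrite yt0.
- apply: (near_eq_is_derive _ dc).
  have : nbhs (0 : R) O' by apply: open_nbhs_nbhs.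
  by apply: filterS => t /ytE; rewrite /Ypi => ->.
exists O'; split=> // k; apply: (Ck_eq oO' _ (Ck_sub _ (cO k))) => [t|t []//].
by move=> /ytE; rewrite /Ypi /= => ->.
Qed.

End LieGroup.

(** * The sign of an invertible Hermitian matrix *)

Section Spectral.
Variables (R : realType) (n : nat).
Local Notation C := R[i].
Local Notation M := 'M[C]_n.

Definition udiag (h : M) (d : 'rV[C]_n) : M := h *m diag_mx d *m h^t*.

Lemma udiag_mul h d e : h \is unitarymx ->
  udiag h d *m udiag h e = udiag h (\row_i (d 0 i * e 0 i)).
Proof.
move=> uh; rewrite /udiag !mulmxA -(mulmxA _ (h^t*) h) (unitary_Vmul uh) mulmx1.
by rewrite -(mulmxA h) mulmx_diag.
Qed.

Lemma udiag1 h : h \is unitarymx -> udiag h (const_mx 1) = 1%:M.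
Proof. by move=> uh; rewrite /udiag diag_const_mx mulmx1 (unitary_mulV uh). Qed.

Lemma udiag_trC h d : (udiag h d)^t* = udiag h (map_mx Num.conj d).
Proof.
by rewrite /udiag trC_mul trC_mul (trCK h) mulmxA tr_diag_mx map_diag_mx.
Qed.

Lemma udiagD h d e : udiag h d + udiag h e = udiag h (d + e).
Proof. by rewrite /udiag linearD mulmxDr mulmxDl. Qed.

Lemma udiagZ h a d : a *: udiag h d = udiag h (a *: d).
Proof. by rewrite /udiag linearZ [LHS]scalemxAl scalemxAr. Qed.

Lemma udiag_tr h d : h \is unitarymx -> \tr (udiag h d) = \sum_i d 0 i.
Proof.
by move=> uh; rewrite /udiag mxtrace_mulC mulmxA (unitary_Vmul uh) mul1mx mxtrace_diag.
Qed.

Lemma udiag_det h d : h \is unitarymx -> \det (udiag h d) = \prod_i d 0 i.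
Proof.
move=> uh; rewrite /udiag !det_mulmx mulrAC -det_mulmx (unitary_mulV uh) det1 mul1r.
by rewrite det_diag.
Qed.

Lemma udiag_inj h d e : h \is unitarymx -> udiag h d = udiag h e -> d = e.
Proof.
move=> uh H; have H' : h^t* *m udiag h d *m h = h^t* *m udiag h e *m h by rewrite H.
have E c : h^t* *m udiag h c *m h = diag_mx c.
  by rewrite /udiag !mulmxA (unitary_Vmul uh) mul1mx -mulmxA (unitary_Vmul uh) mulmx1.
move: H'; rewrite !E => /matrixP H'; apply/rowP => i.
by have := H' i i; rewrite !mxE eqxx.
Qed.

Lemma normal_udiag (A : M) : A \is normalmx ->
  exists h d, h \is unitarymx /\ A = udiag h d.
Proof.
move=> /orthomx_spectralP E; exists ((spectralmx A)^t*), (spectral_diag A).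
rewrite trmxC_unitary spectral_unitarymx; split=> //.
rewrite {1}E /udiag trCK invmx_unitary //; exact: spectral_unitarymx.
Qed.

Definition qf (B : M) (x : 'rV[C]_n) : C := (x *m B *m x^t*) 0 0.

(* Not assumed Hermitian; [0 < s] forces s to be real. *)
Definition pd (B : M) := exists2 s : C, 0 < s & forall x, s * qf 1%:M x <= qf B x.

Lemma qf_tr (B : M) m (X : 'M[C]_(m, n)) :
  \tr (X *m B *m X^t*) = \sum_i qf B (row i X).
Proof.
apply: eq_bigr => i _; rewrite /qf -row_mul.
by rewrite [LHS]mxE [RHS]mxE; apply: eq_bigr => j _; rewrite !mxE.
Qed.

Lemma qf1 x : qf 1%:M x = \sum_i `|x 0 i| ^+ 2.
Proof.
rewrite /qf mulmx1 mxE; apply: eq_bigr => i _.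
by rewrite !mxE -normCK.
Qed.

Lemma qf1_ge0 x : 0 <= qf 1%:M x.
Proof. by rewrite qf1; apply: sumr_ge0 => i _; rewrite exprn_ge0. Qed.

Lemma pd_ge0 B x : pd B -> 0 <= qf B x.
Proof.
by move=> [s s0 H]; apply: le_trans (H x); rewrite mulr_ge0 ?qf1_ge0 // ltW.
Qed.

Lemma udiag_qf h d x : qf (udiag h d) x = \sum_i d 0 i * `|(x *m h) 0 i| ^+ 2.
Proof.
rewrite /qf /udiag !mulmxA -mulmxA -trC_mul mxE; apply: eq_bigr => i _.
rewrite mul_mx_diag !mxE mulrAC mulrC; congr (_ * _).
by rewrite -normCK.
Qed.

Lemma pd_udiag (h : M) (d : 'rV[C]_n) : h \is unitarymx -> (forall i, 0 < d 0 i) -> pd (udiag h d).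
Proof.
move=> uh d0; have S0 : 0 <= \sum_i (d 0 i)^-1.
  by apply: sumr_ge0 => i _; rewrite invr_ge0 ltW.
(* A lower bound for all the d_i at once, without choosing a minimum; the summand 1 keeps it
   positive when n = 0. *)
exists (1 + \sum_i (d 0 i)^-1)^-1; first by rewrite invr_gt0 ltr_pwDl.
move=> x; rewrite -(udiag1 uh) !udiag_qf mulr_sumr; apply: ler_sum => i _.
rewrite mxE mul1r ler_wpM2r ?exprn_ge0 // -[leRHS]invrK lef_pV2 ?posrE ?invr_gt0 //.
  rewrite (bigD1 i) //= addrCA lerDl addr_ge0 // sumr_ge0 // => j _.
  by rewrite invr_ge0 ltW.
by rewrite ltr_pwDl.
Qed.

(** Q A is then the absolute value of A, and Q the unitary factor of its polar decomposition. No
    eigenvalue appears, so two signs can be compared by matrix algebra. *)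
Definition is_sgn (A Q : M) :=
  [/\ A^t* = A, Q^t* = Q, Q *m Q = 1%:M, Q *m A = A *m Q & pd (Q *m A)].

Lemma is_sgn_udiag (h : M) (d : 'rV[C]_n) : h \is unitarymx ->
  (forall i, d 0 i \is Num.real) -> (forall i, d 0 i != 0) ->
  is_sgn (udiag h d) (udiag h (\row_i (d 0 i / `|d 0 i|))).
Proof.
move=> uh dr d0; have n0 i : `|d 0 i| != 0 by rewrite normr_eq0.
have rr i : `|d 0 i| \is Num.real by exact: normr_real.
split.
- by rewrite udiag_trC; congr udiag; apply/rowP => i; rewrite mxE (CrealP (dr i)).
- rewrite udiag_trC; congr udiag; apply/rowP => i; rewrite !mxE.
  by rewrite rmorphM fmorphV /= (CrealP (dr i)) (CrealP (rr i)).
- rewrite (udiag_mul _ _ uh) -(udiag1 uh); congr udiag; apply/rowP => i; rewrite !mxE.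
  rewrite mulf_div -!expr2 -normrX ger0_norm ?divff ?sqrf_eq0 //.
  by rewrite -realEsqr.
- by rewrite !(udiag_mul _ _ uh); congr udiag; apply/rowP => i; rewrite !mxE mulrC.
- rewrite (udiag_mul _ _ uh); apply: pd_udiag => // i; rewrite !mxE.
  rewrite mulrAC -expr2 -(@ger0_norm _ (d 0 i ^+ 2)); last by rewrite -realEsqr.
  by rewrite normrX expr2 mulfK // normr_gt0.
Qed.

Lemma sgn_exists (A : M) : A^t* = A -> \det A != 0 -> exists Q, is_sgn A Q.
Proof.
move=> Ah A0.
have [h [d [uh E]]] : exists h d, h \is unitarymx /\ A = udiag h d.
  by apply: normal_udiag; apply/normalmxP; rewrite Ah.
exists (udiag h (\row_i (d 0 i / `|d 0 i|))); rewrite E; apply: is_sgn_udiag => //.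
  move=> i; have : map_mx Num.conj d = d.
    by apply: (udiag_inj uh); rewrite -udiag_trC -E Ah.
  by move=> /rowP/(_ i); rewrite mxE => /CrealP.
move: A0; rewrite E udiag_det // => /prodf_neq0 H i; exact: H.
Qed.

(* For fixed signs this is a Sylvester equation for Q' - Q with positive definite
   coefficients, hence uniquely solvable. *)
Lemma sgn_sylvester (A Q A' Q' : M) : is_sgn A Q -> is_sgn A' Q' ->
  (Q' *m A') *m (Q' - Q) + (Q' - Q) *m (Q *m A) =
  (A' - A) - Q' *m (A' - A) *m Q.
Proof.
move=> [_ _ QQ QA _] [_ _ QQ' QA' _].
have e1 : Q' *m A' *m Q' = A' by rewrite QA' -mulmxA QQ' mulmx1.
have e2 : Q *m (Q *m A) = A by rewrite mulmxA QQ mul1mx.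
rewrite mulmxBr mulmxBl e1 e2 mulmxBr mulmxBl -!mulmxA QA mulmxA.
by rewrite opprB addrACA [- _ - A]addrC -addrACA.
Qed.

(** Multiplying by X^* and taking the trace gives tr X B X^* + tr X^* B' X = 0. Both terms are
    nonnegative, so both vanish, and the lower bound for B kills every row of X. *)
Lemma pd_sylvester (B B' X : M) : pd B -> pd B' ->
  B' *m X + X *m B = 0 -> X = 0.
Proof.
move=> [s s0 H] pB' E.
have e : \tr (X *m B *m X^t*) + \tr (X^t* *m B' *m X^t* ^t*) = 0.
  by rewrite trCK mxtrace_mulC -mulmxA -mxtraceD -mulmxDr addrC E mulmx0 mxtrace0.
move: e; rewrite !qf_tr => /eqP; rewrite paddr_eq0; first last.
- by apply: sumr_ge0 => i _; apply: pd_ge0.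
- by apply: sumr_ge0 => i _; apply: pd_ge0; exists s.
move=> /andP[/eqP e _]; apply/row_matrixP => i; rewrite row0.
apply: rowsq_eq0; apply/matrixP => i0 j0; rewrite !ord1 [RHS]mxE.
have /eqP := e; rewrite psumr_eq0 => [/allP/(_ i (mem_index_enum _))|k _]; last first.
  by apply: pd_ge0; exists s.
move=> /eqP qi; have := H (row i X); rewrite qi pmulr_rle0 // => q0.
have : qf 1%:M (row i X) = 0 by apply: le_anti; rewrite q0 qf1_ge0.
by rewrite /qf mulmx1.
Qed.

Lemma sgn_unique (A Q Q' : M) : is_sgn A Q -> is_sgn A Q' -> Q = Q'.
Proof.
move=> s s'; have := sgn_sylvester s s'; rewrite subrr mulmx0 mul0mx subrr.
have [[_ _ _ _ p] [_ _ _ _ p']] := (s, s').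
by move=> /(pd_sylvester p p')/eqP; rewrite subr_eq0 => /eqP.
Qed.

(** The Sylvester operator as a square matrix acting on vectorised matrices, so that solving the
    equation is a matrix inversion and therefore smooth in the coefficients. *)
Definition sylv (B' B : M) : 'M[C]_(n * n) :=
  lin_mx (fun X : M => B' *m X + X *m B).

Lemma sylvE B' B X : mxvec X *m sylv B' B = mxvec (B' *m X + X *m B).
Proof.
pose f X := B' *m X + X *m B.
have lf : linear f.
  by move=> a u v; rewrite /f mulmxDr mulmxDl -scalemxAr -scalemxAl scalerDr addrACA.
pose fL : {linear M -> M} := HB.pack f (GRing.isLinear.Build _ _ _ _ f lf).
exact: (mul_vec_lin fL).
Qed.

Lemma sylv_unit B' B : pd B -> pd B' -> sylv B' B \in unitmx.
Proof.
move=> pB pB'; rewrite -row_free_unit -kermx_eq0; apply/eqP/row_matrixP => i.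
rewrite row0; set x := row i _.
have xV : x *m sylv B' B = 0 by apply/sub_kermxP; exact: row_sub.
move: xV; rewrite -[x]vec_mxK sylvE => /(congr1 vec_mx); rewrite mxvecK raddf0.
by move=> /(pd_sylvester pB pB') ->; rewrite raddf0.
Qed.

Lemma msc_sylv T N (S : @smooth_class R T N) (B' B : T -> M) :
  msc S B' -> msc S B -> msc S (fun x => sylv (B' x) (B x)).
Proof.
move=> sB' sB i j.
have s : msc S (fun x => B' x *m vec_mx (delta_mx 0 i) + vec_mx (delta_mx 0 i) *m B x).
  by apply: mscD; apply: msc_mul => //; apply: msc_cst.
case/mxvec_indexP: j => a b; apply: csc_ext (s a b) => x.
rewrite -(mxvecE (_ + _)) -sylvE vec_mxK -rowE.
by rewrite [in LHS]mxE.
Qed.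

(** Taking the Hermitian part first makes the sign a function on an open set of all matrices, so
    that it has a smooth extension in the ambient real vector space. *)
Definition hpart (A : M) : M := half_mx R n *m (A + A^t*).

Lemma hpart_herm A : (hpart A)^t* = hpart A.
Proof.
rewrite /hpart /half_mx !mul_scalar_mx trCZ trCD trCK addrC.
by rewrite fmorphV rmorph_nat.
Qed.

(* [xget] returns 0 when the Hermitian part of A is singular. *)
Definition sgn_mx (A : M) : M := xget 0 (is_sgn (hpart A)).

Lemma sgn_mxP A : \det (hpart A) != 0 -> is_sgn (hpart A) (sgn_mx A).
Proof.
by move=> A0; have [Q sQ] := sgn_exists (hpart_herm A) A0; apply: (xgetI 0 sQ).
Qed.

(** A Hermitian involution is unitary, so its rows have norm 1. *)
Lemma sgn_entry (A Q : M) i j : is_sgn A Q -> `|Q i j| <= 1.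
Proof.
move=> [_ Qh QQ _ _].
have e : \sum_k `|Q i k| ^+ 2 = 1.
  have : (Q *m Q^t*) i i = 1 by rewrite Qh QQ mxE eqxx.
  by rewrite mxE => <-; apply: eq_bigr => k _; rewrite !mxE -normCK.
rewrite -(@ler_pXn2r _ 2) ?nnegrE // expr1n -e (bigD1 j) //= lerDl.
by apply: sumr_ge0 => k _; rewrite exprn_ge0.
Qed.

Lemma mulmx_entry_le p q r (A : 'M[C]_(p, q)) (B : 'M[C]_(q, r)) (a b : C) i j :
  0 <= a -> (forall i j, `|A i j| <= a) -> (forall i j, `|B i j| <= b) ->
  `|(A *m B) i j| <= q%:R * (a * b).
Proof.
move=> a0 Ha Hb; rewrite mxE (le_trans (ler_norm_sum _ _ _)) //.
apply: (@le_trans _ _ (\sum_(k < q) a * b)).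
  by apply: ler_sum => k _; rewrite normrM ler_pM.
by rewrite sumr_const card_ord -[leLHS]mulr_natl.
Qed.

Lemma mxBE p q (A B : 'M[C]_(p, q)) i j : (A - B) i j = A i j - B i j.
Proof. by rewrite !mxE. Qed.

Lemma sgn_lipschitz (A Q : M) : is_sgn A Q ->
  exists2 K : C, 0 <= K & forall A' Q' (d : C), is_sgn A' Q' ->
    (forall i j, `|(A' - A) i j| <= d) -> forall i j, `|(Q' - Q) i j| ^+ 2 <= K * d.
Proof.
move=> sQ; have [_ Qh QQ QA [s s0 H]] := sQ.
(* The entries of the right-hand side Y are at most d (1 + n^2), those of X at most 2; the trace of
   X Y contributes the two outer factors n, and s is divided out. *)
exists (s^-1 * (n%:R * (n%:R * (2 * (1 + n%:R * (1 * (n%:R * 1))))))).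
  by rewrite !(mulr_ge0, addr_ge0, invr_ge0) ?ler0n // ltW.
move=> A' Q' d sQ' Hd i j; have [_ Qh' QQ' QA' p'] := sQ'.
have d0 : 0 <= d by apply: le_trans (Hd i j).
set X := Q' - Q; have Xh : X^t* = X by rewrite trCD trCN Qh Qh'.
have E := sgn_sylvester sQ sQ'; rewrite -/X in E.
set Y := _ - _ in E.
have X2 k l : `|X k l| <= 2.
  rewrite !mxE (le_trans (ler_normB _ _)) // -[2]/(1 + 1) lerD //.
    exact: sgn_entry sQ'.
  exact: sgn_entry sQ.
have Y2 k l : `|Y k l| <= d + n%:R * (n%:R * (1 * d) * 1).
  rewrite mxBE (le_trans (ler_normB _ _)) // lerD //.
  apply: mulmx_entry_le => [|k' l'|k' l']; first by rewrite !mulr_ge0.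
    by apply: mulmx_entry_le => // a b; apply: sgn_entry sQ'.
  exact: sgn_entry sQ.
have tE : \tr (X *m (Q' *m A') *m X^t*) + \tr (X *m (Q *m A) *m X^t*) = \tr (X *m Y).
  rewrite -E mulmxDr [RHS]mxtraceD Xh; congr (_ + _); first by rewrite -mulmxA.
  by rewrite mxtrace_mulC.
have t1 : 0 <= \tr (X *m (Q' *m A') *m X^t*).
  by rewrite qf_tr sumr_ge0 // => k _; apply: pd_ge0.
have t2 : s * `|X i j| ^+ 2 <= \tr (X *m (Q *m A) *m X^t*).
  rewrite qf_tr; apply: (@le_trans _ _ (\sum_k s * qf 1%:M (row k X))); last exact: ler_sum.
  rewrite (bigD1 i) //= qf1 (bigD1 j) //= !mxE mulrDr -addrA lerDl addr_ge0 //.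
    by rewrite mulr_ge0 ?(ltW s0) // sumr_ge0 // => k _; rewrite exprn_ge0.
  by rewrite sumr_ge0 // => k _; rewrite mulr_ge0 ?(ltW s0) // qf1_ge0.
have t3 : \tr (X *m Y) <= n%:R * (n%:R * (2 * (d + n%:R * (n%:R * (1 * d) * 1)))).
  have tr_real : \tr (X *m Y) \is Num.real.
    apply: ger0_real; rewrite -tE; apply: addr_ge0 t1 (le_trans _ t2).
    by apply: mulr_ge0 (ltW s0) (exprn_ge0 _ _).
  apply: le_trans (real_ler_norm tr_real) _.
  rewrite (le_trans (ler_norm_sum _ _ _)) //.
  apply: (@le_trans _ _ (\sum_(k < n) n%:R * (2 * (d + n%:R * (n%:R * (1 * d) * 1))))).
    by apply: ler_sum => k _; apply: mulmx_entry_le.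
  by rewrite sumr_const card_ord -[leLHS]mulr_natl.
rewrite -(ler_pM2l s0); apply: le_trans t2 _.
apply: (@le_trans _ _ (\tr (X *m Y))); first by rewrite -tE lerDr.
apply: le_trans t3 _; rewrite le_eqVlt; apply/orP; left; apply/eqP.
by field; rewrite gt_eqF.
Qed.

End Spectral.

(** * Smoothness of the sign *)

Section SgnSmooth.
Variables (R : realType) (n : nat).
Local Notation C := R[i].
Local Notation M := 'M[C]_n.
Local Notation N := (#|{: 'I_n * 'I_n}| + #|{: 'I_n * 'I_n}|)%N.
Local Notation V := 'rV[R]_N.

Lemma mscT (T : Type) (N' : set T) (S : @smooth_class R T N') m p (A : T -> 'M[C]_(m, p)) :
  msc S A -> msc S (fun x => mxvec (A x)).
Proof.
move=> sA i j; case/mxvec_indexP: j => a b; apply: csc_ext (sA a b) => x.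
by rewrite ord1 mxvecE.
Qed.

Lemma msc_vec_mx (T : Type) (N' : set T) (S : @smooth_class R T N') m p (A : T -> 'rV[C]_(m * p)) :
  msc S A -> msc S (fun x => vec_mx (A x)).
Proof.
by move=> sA i j; apply: csc_ext (sA 0 (mxvec_index i j)) => x; rewrite mxE.
Qed.

Lemma msc_hpart (T : Type) (N' : set T) (S : @smooth_class R T N') (A : T -> M) :
  msc S A -> msc S (fun x => hpart (A x)).
Proof.
move=> sA; apply: msc_mul; first exact: msc_cst.
by apply: mscD => //; apply: msc_trC.
Qed.

Definition hp (x : V) : M := hpart (mxu x).

Lemma hpD x y : hp (x + y) = hp x + hp y.
Proof.
rewrite /hp /hpart -mulmxDr addrACA -trCD; congr (_ *m (_ + _^t*));
  by apply/matrixP => i j; rewrite !mxE /unreal !mxE; simpc.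
Qed.

Lemma hpZ a x : hp (a *: x) = a%:C%C *: hp x.
Proof.
have e : mxu (a *: x) = a%:C%C *: mxu x :> M.
  by apply/matrixP => i j; rewrite !mxE /unreal !mxE; simpc.
rewrite /hp /hpart e trCZ; have -> : (a%:C%C : C)^* = a%:C%C by exact: conjc_real.
by rewrite -scalerDr scalemxAr.
Qed.

Lemma hp_sum x : hp x = \sum_m (x 0 m)%:C%C *: hp (delta_mx 0 m).
Proof.
rewrite {1}(row_sum_delta x); elim/big_rec2: _ => [|m A y _ <-].
  by rewrite -(scale0r 0) hpZ scale0r.
by rewrite hpD hpZ.
Qed.

Definition sgn_dom : set V := [set x | \det (hp x) != 0].

Lemma open_sgn_dom : open sgn_dom.
Proof.
rewrite -[X in open X]setTI; apply: (open_csc (oU := openT)); apply: csc_det.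
by apply: msc_hpart; apply: msc_mxu.
Qed.

Lemma msc_hp k : msc (Ck_class k open_sgn_dom) hp.
Proof. by apply: msc_hpart; apply: msc_mxu. Qed.

Definition sg (x : V) : M := sgn_mx (mxu x).

Lemma sgP x : sgn_dom x -> is_sgn (hp x) (sg x).
Proof. by move=> Ox; apply: sgn_mxP. Qed.

(* The solution of the Sylvester equation for the m-th coordinate direction. At y = x it is
   the partial derivative of sg, which is therefore as smooth as sg itself. *)
Definition sg_slope (m : 'I_N) (y x : V) : M :=
  vec_mx (mxvec (hp (delta_mx 0 m) - sg y *m hp (delta_mx 0 m) *m sg x) *m
          inv_mx (sylv (sg y *m hp y) (sg x *m hp x))).

(** The right-hand side of the Sylvester equation is linear in hp (y - x); expanding it in
    coordinates and inverting the operator gives the exact factorisation that [caratheodory]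
    requires. *)
Lemma sg_sub x y : sgn_dom x -> sgn_dom y ->
  sg y - sg x = \sum_m ((y - x) 0 m)%:C%C *: sg_slope m y x.
Proof.
move=> /sgP sx /sgP sy; have E := sgn_sylvester sx sy.
have [[_ _ _ _ px] [_ _ _ _ py]] := (sx, sy).
have uS := sylv_unit px py.
have dE : hp y - hp x = hp (y - x) by rewrite -scaleN1r hpD -[- x]scaleN1r hpZ rmorphN1.
have E2 : hp (y - x) - sg y *m hp (y - x) *m sg x =
    \sum_m ((y - x) 0 m)%:C%C *:
      (hp (delta_mx 0 m) - sg y *m hp (delta_mx 0 m) *m sg x).
  rewrite (hp_sum (y - x)) mulmx_sumr mulmx_suml -sumrB.
  by apply: eq_bigr => m _; rewrite -scalemxAr -scalemxAl -scalerBr.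
rewrite dE E2 in E.
apply: (can_inj mxvecK); rewrite -[LHS](mulmxK uS) sylvE E.
rewrite [in LHS]linear_sum [in LHS]mulmx_suml [RHS]linear_sum.
have L c (A : M) : mxvec (c *: A) = c *: mxvec A by exact: linearZ.
apply: eq_bigr => m _ /=; rewrite L L -scalemxAl /sg_slope vec_mxK.
by rewrite (inv_mxE uS).
Qed.

(** Two maps f and g are allowed because two cases occur: the diagonal, for the smoothness of the
    derivative, and a fixed second argument, for the continuity of the slope. *)
Lemma msc_sg_slope (T : Type) (N' : set T) (S : @smooth_class R T N') m (f g : T -> V) :
  (forall x, N' x -> sgn_dom (f x) /\ sgn_dom (g x)) ->
  msc S (fun x => sg (f x)) -> msc S (fun x => sg (g x)) ->
  msc S (fun x => hp (f x)) -> msc S (fun x => hp (g x)) ->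
  msc S (fun x => sg_slope m (f x) (g x)).
Proof.
move=> fgO sf sg' hf hg; apply: msc_vec_mx; apply: msc_mul.
  apply: mscT; apply: mscB; first exact: msc_cst.
  by apply: msc_mul => //; apply: msc_mul => //; apply: msc_cst.
apply: msc_inv; last by apply: msc_sylv; apply: msc_mul.
move=> x /fgO [/sgP [_ _ _ _ pf] /sgP [_ _ _ _ pg]]; exact: sylv_unit.
Qed.

Lemma normc_le_ReIm (z : C) (e : R) :
  `|complex.Re z| <= e -> `|complex.Im z| <= e -> `|z| <= (2 * e)%:C%C.
Proof.
move=> He Hi; have e0 : 0 <= e by apply: le_trans He.
rewrite normc_def lecR -[2 * e]ger0_norm ?mulr_ge0 // -sqrtr_sqr ler_wsqrtr //.
have := ler_pM (normr_ge0 _) (normr_ge0 _) He He.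
have := ler_pM (normr_ge0 _) (normr_ge0 _) Hi Hi.
by rewrite -!expr2 !real_normK ?num_real //; nra.
Qed.

Lemma normc_ge_Im (z : C) : `|complex.Im z|%:C%C <= `|z|.
Proof.
by rewrite normc_def lecR -sqrtr_sqr ler_wsqrtr // lerDr sqr_ge0.
Qed.

Lemma sg_continuous : msc (Ck_class 0 open_sgn_dom) sg.
Proof.
have cont x (e : R) : sgn_dom x -> 0 < e ->
    \forall y \near x, forall i j, `|(sg y - sg x) i j| <= e%:C%C.
  move=> Ox e0; have [K K0 HK] := sgn_lipschitz (sgP Ox).
  have KE : K = (complex.Re K)%:C%C by move: K0; case: (K) => a b; rewrite lecE /= => /andP[/eqP -> _].
  set k := complex.Re K in KE; have k0 : 0 <= k by rewrite -lecR -KE.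
  (* Real and imaginary parts within d bound the complex entries by 2 d, and K (2 d) = e^2 k / (k +
     1) is at most e^2. The denominator k + 1 allows k = 0. *)
  pose d := e ^+ 2 / (2 * (k + 1)).
  have d0 : 0 < d by rewrite divr_gt0 ?exprn_gt0 // mulr_gt0 // ltr_wpDl.
  have H1 : \forall y \near x, sgn_dom y by apply: open_nbhs_nbhs; split=> //; exact: open_sgn_dom.
  have H2 ij : \forall y \near x, `|(hp y - hp x) ij.1 ij.2| <= (2 * d)%:C%C.
    have [c1 c2] := msc_hp 0 ij.1 ij.2.
    have /cvgrPdist_le/(_ _ d0) c1' := c1 x Ox.
    have /cvgrPdist_le/(_ _ d0) c2' := c2 x Ox.
    apply: filterS2 c1' c2' => y c1' c2'; rewrite mxBE; apply: normc_le_ReIm.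
      by rewrite raddfB distrC.
    by rewrite raddfB distrC.
  have H2' := filter_forall (nbhs_filter _) H2.
  apply: filterS2 H1 H2' => y /sgP sy Hy i j.
  have := HK _ _ _ sy (fun i j => Hy (i, j)) i j.
  rewrite KE -rmorphM /= => H.
  have n1 : `|(sg y - sg x) i j| \is Num.nneg by rewrite nnegrE.
  have n2 : e%:C%C \is @Num.nneg C by rewrite nnegrE lecR (ltW e0).
  rewrite -(ler_pXn2r (ltn0Sn 1) n1 n2); apply: le_trans H _; rewrite -rmorphXn lecR /d.
  have k1 : k + 1 != 0 by rewrite gt_eqF // ltr_wpDl.
  have -> : k * (2 * (e ^+ 2 / (2 * (k + 1)))) = e ^+ 2 * (k / (k + 1)) by field.
  rewrite ler_piMr ?exprn_ge0 ?(ltW e0) // ler_pdivrMr ?ltr_wpDl //.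
  by rewrite mul1r lerDl.
move=> i j; split=> x Ox.
  suff H : (fun y => complex.Re (sg y i j)) @ x --> complex.Re (sg x i j) by exact: H.
  apply: (iffRL (@cvgrPdist_le _ _ _ _ (nbhs_filter x) _ _)) => e e0; apply: filterS (cont x e Ox e0) => y H.
  rewrite distrC -raddfB -mxBE -lecR; exact: le_trans (normc_ge_Re _) (H i j).
suff H : (fun y => complex.Im (sg y i j)) @ x --> complex.Im (sg x i j) by exact: H.
apply: (iffRL (@cvgrPdist_le _ _ _ _ (nbhs_filter x) _ _)) => e e0; apply: filterS (cont x e Ox e0) => y H.
rewrite distrC -raddfB -mxBE -lecR; exact: le_trans (normc_ge_Im _) (H i j).
Qed.

Lemma sg_Ck_slope k : msc (Ck_class k open_sgn_dom) sg -> forall m,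
  msc (Ck_class k open_sgn_dom) (fun x => sg_slope m x x).
Proof.
move=> H m; apply: (msc_sg_slope _ (f := fun x => x) (g := fun x => x)) => //;
  exact: msc_hp.
Qed.

Lemma sg_slope_continuous m x : sgn_dom x ->
  msc (Ck_class 0 open_sgn_dom) (fun y => sg_slope m y x).
Proof.
move=> Ox; apply: (msc_sg_slope _ (f := fun y => y) (g := fun=> x)) => //.
- exact: sg_continuous.
- exact: msc_cst.
- exact: msc_hp.
- exact: msc_cst.
Qed.

(** A bootstrap: once [sg] is C^k, its partial derivatives are rational expressions in [sg] and
    [hp], hence C^k too. Real and imaginary parts are treated apart because [caratheodory] is about
    real functions. *)
Lemma sg_Ck k : msc (Ck_class k open_sgn_dom) sg.
Proof.
elim: k => [|k IH]; first exact: sg_continuous.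
have cR (c : R) (z : C) : complex.Re (c%:C%C * z) = complex.Re z * c.
  by case: z => a b; rewrite /= mul0r subr0 mulrC.
have cI (c : R) (z : C) : complex.Im (c%:C%C * z) = complex.Im z * c.
  by case: z => a b; rewrite /= mul0r addr0 mulrC.
have near_dom x : sgn_dom x -> \forall y \near x, sgn_dom y.
  by move=> Ox; apply: open_nbhs_nbhs; split=> //; exact: open_sgn_dom.
have cv v m : Ck k sgn_dom (fun=> v 0 m : R) by exact: Ck_cst.
have oD := open_sgn_dom.
move=> i j; split.
  have H x : sgn_dom x ->
      differentiable (fun y => complex.Re (sg y i j)) x /\ forall v,
      'D_v (fun y => complex.Re (sg y i j)) x =
      \sum_m complex.Re (sg_slope m x x i j) * v 0 m.
    move=> Ox; apply: (caratheodory (G := fun m y => complex.Re (sg_slope m y x i j))).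
      apply: filterS (near_dom x Ox) => y Oy.
      rewrite -raddfB -mxBE (sg_sub Ox Oy) summxE raddf_sum.
      by apply: eq_bigr => m _; rewrite mxE /= cR.
    by move=> m; have [/(_ x Ox) c _] := sg_slope_continuous m Ox i j.
  split=> [x /H [] //|v].
  apply: (Ck_eq (f := fun x => \sum_m complex.Re (sg_slope m x x i j) * v 0 m)) => //.
    by move=> x /H [_ ->].
  apply: Ck_sum => // m _; apply: CkM => //.
  by have [] := sg_Ck_slope IH m i j.
have H x : sgn_dom x ->
    differentiable (fun y => complex.Im (sg y i j)) x /\ forall v,
    'D_v (fun y => complex.Im (sg y i j)) x =
    \sum_m complex.Im (sg_slope m x x i j) * v 0 m.
  move=> Ox; apply: (caratheodory (G := fun m y => complex.Im (sg_slope m y x i j))).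
    apply: filterS (near_dom x Ox) => y Oy.
    rewrite -raddfB -mxBE (sg_sub Ox Oy) summxE raddf_sum.
    by apply: eq_bigr => m _; rewrite mxE /= cI.
  by move=> m; have [_ /(_ x Ox) c] := sg_slope_continuous m Ox i j.
split=> [x /H [] //|v].
apply: (Ck_eq (f := fun x => \sum_m complex.Im (sg_slope m x x i j) * v 0 m)) => //.
  by move=> x /H [_ ->].
apply: Ck_sum => // m _; apply: CkM => //.
by have [] := sg_Ck_slope IH m i j.
Qed.

Theorem smooth_sgn : smooth_on [set A : mx_space R n n | \det (hpart (A : M)) != 0]
  (fun A => sgn_mx (A : M) : mx_space R n n).
Proof.
move=> A dA; exists sgn_dom, (fun x => realify (fun ij : 'I_n * 'I_n => sg x ij.1 ij.2)).
split.
- exact: open_sgn_dom.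
- by rewrite /sgn_dom /= /hp mxu_realify.
- by move=> k; apply: (Ck_realify (oU := open_sgn_dom)) => ij; apply: sg_Ck.
- by move=> A' _ _; rewrite /sg /= mxu_realify.
Qed.

End SgnSmooth.

(** * The exterior algebra *)

Section Exterior.
Import mathcomp.boot.finset.
Variables (R : realType) (n : nat).
Local Notation C := R[i].
Local Notation ext := (ext R n).
Local Notation dj A B := (@fintype.disjoint _ (mem A) (mem B)).
Implicit Types (S T U : {set 'I_n}) (i j : 'I_n) (u v w : ext) (x y : 'cV[C]_n).

Definition eb S : ext := [ffun T : {set 'I_n} => (T == S)%:R : C^o].

Lemma ext_expand u : u = \sum_S u S *: eb S.
Proof.
apply/ffunP => T; rewrite sum_ffunE (bigD1 T) //= big1 => [|S nS].
  by rewrite !ffunE eqxx addr0 /GRing.scale /= mulr1.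
by rewrite !ffunE eq_sym (negbTE nS) /GRing.scale /= mulr0.
Qed.

Lemma lin_ext (W : lmodType C) (f g : ext -> W) : linear f -> linear g ->
  (forall S, f (eb S) = g (eb S)) -> f =1 g.
Proof.
move=> lf lg H u.
pose F : {linear ext -> W} := HB.pack f (GRing.isLinear.Build _ _ _ _ f lf).
pose G : {linear ext -> W} := HB.pack g (GRing.isLinear.Build _ _ _ _ g lg).
change (F u = G u); rewrite (ext_expand u) !linear_sum.
by apply: eq_bigr => S _; rewrite !linearZ /= H.
Qed.

(** As a double sum, the number of inversions is visibly additive over disjoint unions in either
    argument. *)
Lemma inversionsE S T : inversions S T = (\sum_(i in S) \sum_(j in T) (j < i)%N)%N.
Proof.
rewrite /inversions -sum1_card pair_big_dep /=.
rewrite (eq_bigl (fun p : 'I_n * 'I_n =>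
  ((p.1 \in S) && (p.2 \in T)) && (p.2 < p.1)%N)) => [|p].
  by rewrite big_mkcondr; apply: eq_bigr => p _; case: (p.2 < p.1)%N.
by rewrite inE /= andbA.
Qed.

Lemma inversionsUl S T U : (dj (S) (T)) ->
  inversions (S :|: T) U = (inversions S U + inversions T U)%N.
Proof.
move=> dST; rewrite !inversionsE -bigU //=.
by apply: eq_bigl => i; rewrite !inE.
Qed.

Lemma inversionsUr S T U : (dj (T) (U)) ->
  inversions S (T :|: U) = (inversions S T + inversions S U)%N.
Proof.
move=> dTU; rewrite !inversionsE -big_split /=; apply: eq_bigr => i _.
rewrite -bigU //=; by apply: eq_bigl => j; rewrite !inE.
Qed.

Lemma inversions0l T : inversions finset.set0 T = 0%N.
Proof. by rewrite inversionsE big_set0. Qed.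

Lemma inversions0r S : inversions S finset.set0 = 0%N.
Proof. by rewrite inversionsE big1 // => i _; rewrite big_set0. Qed.

Lemma inversions11 i j : inversions [set i]%SET [set j]%SET = (j < i)%N.
Proof. by rewrite inversionsE !big_set1. Qed.

Lemma inversions_lt S T : (forall i j, i \in S -> j \in T -> (i < j)%N) ->
  inversions S T = 0%N.
Proof.
move=> H; rewrite inversionsE big1 // => i iS; rewrite big1 // => j jT.
by rewrite ltnNge ltnW // H.
Qed.

Lemma wedge_linear_l v : linear (fun u => wedge u v).
Proof.
move=> a u u'; apply/ffunP => S; rewrite !ffunE scaler_sumr -big_split.
by apply: eq_bigr => T _; rewrite !ffunE /GRing.scale /=; ring.
Qed.

Lemma wedge_linear_r u : linear (wedge u).
Proof.
move=> a v v'; apply/ffunP => S; rewrite !ffunE scaler_sumr -big_split.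
by apply: eq_bigr => T _; rewrite !ffunE /GRing.scale /=; ring.
Qed.

Lemma linear_scale (W W' : lmodType C) (f : W -> W') a (x : W) : linear f -> f (a *: x) = a *: f x.
Proof.
move=> lf; pose F : {linear W -> W'} := HB.pack f (GRing.isLinear.Build _ _ _ _ f lf).
exact: (linearZ_LR F).
Qed.

Lemma wedgeZl a u v : wedge (a *: u) v = a *: wedge u v.
Proof. exact: linear_scale (wedge_linear_l v). Qed.

Lemma wedgeZr a u v : wedge u (a *: v) = a *: wedge u v.
Proof. exact: linear_scale (wedge_linear_r u). Qed.

Lemma wedge0r u : wedge u 0 = 0.
Proof. by have := wedgeZr 0 u 0; rewrite !scale0r. Qed.

Lemma wedge0l u : wedge 0 u = 0.
Proof. by have := wedgeZl 0 0 u; rewrite !scale0r. Qed.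

Lemma wedgeNl u v : wedge (- u) v = - wedge u v.
Proof. by rewrite -scaleN1r wedgeZl scaleN1r. Qed.

Lemma wedge_suml (I : Type) (r : seq I) (P : pred I) (F : I -> ext) v :
  wedge (\sum_(i <- r | P i) F i) v = \sum_(i <- r | P i) wedge (F i) v.
Proof.
apply: (big_morph (fun u => wedge u v)) => [u u'|]; last exact: wedge0l.
by have := wedge_linear_l v 1 u u'; rewrite !scale1r.
Qed.

Lemma wedge_sumr (I : Type) (r : seq I) (P : pred I) (F : I -> ext) u :
  wedge u (\sum_(i <- r | P i) F i) = \sum_(i <- r | P i) wedge u (F i).
Proof.
apply: (big_morph (wedge u)) => [v v'|]; last exact: wedge0r.
by have := wedge_linear_r u 1 v v'; rewrite !scale1r.
Qed.

Definition esign S T : C := if dj S T then (-1) ^+ inversions S T else 0.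

Lemma wedge_eb S T : wedge (eb S) (eb T) = esign S T *: eb (S :|: T).
Proof.
apply/ffunP => U; rewrite !ffunE.
have -> : esign S T *: ((U == S :|: T)%:R : C^o) =
    (if dj S T && (U == S :|: T) then (-1) ^+ inversions S T else 0 : C).
  rewrite /esign /GRing.scale /=; case: ifP => _ /=; last by rewrite mul0r.
  by case: ifP => _; rewrite ?mulr1 ?mulr0.
have [SU|nSU] := boolP (S \subset U); last first.
  rewrite big1 => [|T' T'U].
    case: ifP => // /andP[_ /eqP UE]; by rewrite UE subsetUl in nSU.
  rewrite !ffunE; case: eqP => [e|_]; first by rewrite -e T'U in nSU.
  by rewrite mul0r mulr0.
rewrite (bigD1 S) //= big1 => [|T' /andP[_ /negbTE nT']]; last first.
  by rewrite !ffunE nT' mul0r mulr0.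
rewrite addr0 !ffunE eqxx mul1r.
have -> : (U :\: S == T) = (dj (S) (T)) && (U == S :|: T).
  apply/eqP/andP => [<-|[dST /eqP ->]].
    split; last by rewrite setDE setUIr setUCr setIT (setUidPr SU).
    by rewrite -setI_eq0 setDE setICA setICr setI0.
  by rewrite setDUl setDv set0U; apply/setDidPl; rewrite disjoint_sym.
case: ifP => [/andP[dST /eqP ->]|_]; last by rewrite mulr0.
rewrite mulr1 setDUl setDv set0U; congr (_ ^+ inversions _ _).
by apply/setDidPl; rewrite disjoint_sym.
Qed.

Lemma ext1E : ext1 R n = eb finset.set0.
Proof. by apply/ffunP => S; rewrite !ffunE. Qed.

Lemma disjointUl S T U : (dj (S :|: T) (U)) = (dj (S) (U)) && (dj (T) (U)).
Proof.
rewrite -!setI_eq0 setIUl setU_eq0 //.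
Qed.

Lemma wedgeA : associative (@wedge R n).
Proof.
have base S T U : wedge (eb S) (wedge (eb T) (eb U)) = wedge (wedge (eb S) (eb T)) (eb U).
  (* The sign satisfies the cocycle identity, by additivity of inversions; if two of the three sets
     meet, both sides vanish. *)
  have e : esign T U * esign S (T :|: U) = esign S T * esign (S :|: T) U.
    rewrite /esign disjointUl (disjoint_sym (mem S) (mem (T :|: U))) disjointUl.
    rewrite (disjoint_sym (mem T) (mem S)) (disjoint_sym (mem U) (mem S)).
    case: (boolP (dj T U)) => dTU; last by rewrite andbF mul0r mulr0.
    case: (boolP (dj S T)) => dST; last by rewrite mul0r mulr0.
    case: (boolP (dj S U)) => dSU /=; last by rewrite !mulr0.
    by rewrite -!exprD inversionsUr // inversionsUl // addnC addnA.
  rewrite (wedge_eb T U) (wedge_eb S T) wedgeZr wedgeZl !wedge_eb.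
  by rewrite (scalerA (esign T U)) (scalerA (esign S T)) e setUA.
move=> u v w.
apply: (lin_ext (f := fun u => wedge u (wedge v w)) (g := fun u => wedge (wedge u v) w)).
- exact: wedge_linear_l.
- by move=> a u1 u2; rewrite !wedge_linear_l.
move=> S; apply: (lin_ext (f := fun v => wedge (eb S) (wedge v w))
   (g := fun v => wedge (wedge (eb S) v) w)).
- by move=> a u1 u2; rewrite !(wedge_linear_l, wedge_linear_r).
- by move=> a u1 u2; rewrite !(wedge_linear_r, wedge_linear_l).
move=> T; apply: (lin_ext (f := fun w => wedge (eb S) (wedge (eb T) w))
   (g := fun w => wedge (wedge (eb S) (eb T)) w)).
- by move=> a u1 u2; rewrite !wedge_linear_r.
- by move=> a u1 u2; rewrite !wedge_linear_r.
by move=> U; exact: base.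
Qed.

Lemma esign0l T : esign finset.set0 T = 1.
Proof. by rewrite /esign inversions0l -setI_eq0 set0I eqxx. Qed.

Lemma esign0r T : esign T finset.set0 = 1.
Proof. by rewrite /esign inversions0r -setI_eq0 setI0 eqxx. Qed.

Lemma wedge1l : left_id (ext1 R n) (@wedge R n).
Proof.
move=> u; rewrite ext1E; apply: (lin_ext (f := wedge (eb finset.set0)) (g := id)) => //.
  exact: wedge_linear_r.
by move=> S; rewrite wedge_eb esign0l scale1r set0U.
Qed.

Lemma wedge1r : right_id (ext1 R n) (@wedge R n).
Proof.
move=> u; rewrite ext1E; apply: (lin_ext (f := fun u => wedge u (eb finset.set0)) (g := id)) => //.
  exact: wedge_linear_l.
by move=> S; rewrite wedge_eb esign0r scale1r setU0.
Qed.

HB.instance Definition _ := Monoid.isLaw.Build ext (ext1 R n) (@wedge R n)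
  wedgeA wedge1l wedge1r.

End Exterior.

(** * Functoriality of the exterior algebra *)

Section Functor.
Import mathcomp.boot.finset.
Variables (R : realType) (n : nat).
Local Notation C := R[i].
Local Notation ext := (ext R n).
Local Notation si i := [set i]%SET.
Implicit Types (S T U : {set 'I_n}) (i j k : 'I_n) (u v w : ext) (x y : 'cV[C]_n).

(** Elements are added below all the others: since [enum] is increasing, an ordered wedge product
    then gains a first factor and no sign. *)
Lemma set_min_ind (P : {set 'I_n} -> Prop) : P finset.set0 ->
  (forall j T, (forall k, k \in T -> (j < k)%N) -> P T -> P (j |: T)) ->
  forall S, P S.
Proof.
move=> P0 PS S; have [m] := ubnP #|S|; elim: m S => // m IH S Sm.
have [->//|[x xS]] := set_0Vmem S.
case: (arg_minnP (fun i : 'I_n => i : nat) xS) => j jS' jmin; have jS : j \in S by exact: jS'.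
rewrite -(setD1K jS); apply: PS => [k|].
  rewrite !inE => /andP[kj kS]; rewrite ltn_neqAle jmin // andbT.
  by rewrite eq_sym; apply: contra kj => /eqP/val_inj ->.
by apply: IH; move: Sm; rewrite (cardsD1 j) jS ltnS.
Qed.

Lemma enum_min j T : (forall k, k \in T -> (j < k)%N) -> enum (j |: T) = j :: enum T.
Proof.
move=> H; have jT : j \notin T by apply/negP => /H; rewrite ltnn.
have so U : sorted (fun a b : 'I_n => (a < b)%N) (enum U).
  change (sorted (relpre val ltn) (enum U)).
  rewrite -sorted_map; apply: (subseq_sorted ltn_trans (s2 := map val (enum 'I_n))).
    by apply: map_subseq; rewrite {1}/enum_mem; apply: subseq_trans (filter_subseq _ _) _; rewrite enumT.
  by rewrite val_enum_ord iota_ltn_sorted.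
apply: (@irr_sorted_eq _ (fun a b : 'I_n => (a < b)%N)).
- by move=> a b c; apply: ltn_trans.
- by move=> a; rewrite ltnn.
- exact: so.
- rewrite /= path_min_sorted //; apply/allP => k; rewrite mem_enum; exact: H.
- by move=> k; rewrite inE !mem_enum !inE.
Qed.

(** The ordered product of the W i over T. It is e_T for W i = e_i, and the image of e_T under A
    when W i is the i-th column of A. *)
Definition Phi (W : 'I_n -> ext) T : ext := \big[@wedge R n/ext1 R n]_(i <- enum T) W i.

Lemma Phi0 W : Phi W finset.set0 = ext1 R n.
Proof. by rewrite /Phi enum_set0 big_nil. Qed.

Lemma Phi_min W j T : (forall k, k \in T -> (j < k)%N) ->
  Phi W (j |: T) = wedge (W j) (Phi W T).
Proof. by move=> H; rewrite /Phi enum_min // big_cons. Qed.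

Lemma inversions_cons i j T : j \notin T ->
  inversions (si i) (j |: T) = ((j < i)%N + inversions (si i) T)%N.
Proof.
move=> jT; rewrite inversionsUr ?inversions11 //.
by rewrite disjoints1.
Qed.

(** The sign in e_i /\ e_T, with value 0 when i belongs to T. *)
Definition csign i T : C := if i \in T then 0 else (-1) ^+ inversions (si i) T.

Lemma csign_lt i T : (forall k, k \in T -> (i < k)%N) -> csign i T = 1.
Proof.
move=> iT; rewrite /csign inversions_lt => [|a b /set1P ->]; last exact: iT.
by have /negbTE -> : i \notin T by apply/negP => /iT; rewrite ltnn.
Qed.

Lemma csign_gt i j T : (j < i)%N -> j \notin T -> csign i (j |: T) = - csign i T.
Proof.
move=> ji jT; rewrite /csign inversions_cons // ji !inE.
have -> : (i == j) = false by apply/negbTE; rewrite -val_eqE /= gtn_eqF.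
by rewrite orFb; case: ifP => _; rewrite ?oppr0 // exprS mulN1r.
Qed.

(** Only anticommutation of the W i is used, so the basis vectors and the columns of any matrix obey
    one and the same sign rule. The multiplicativity of [ext_map] rests on this. *)
Lemma wedge_Phi W : (forall i, wedge (W i) (W i) = 0) ->
  (forall i j, wedge (W i) (W j) = - wedge (W j) (W i)) -> forall i T,
  wedge (W i) (Phi W T) = csign i T *: Phi W (i |: T).
Proof.
move=> WW WA i T; elim/set_min_ind: T i => [|j T jT IH] i.
  by rewrite csign_lt ?scale1r ?Phi_min // => k; rewrite inE.
have jnT : j \notin T by apply/negP => /jT; rewrite ltnn.
case: (ltngtP i j) => [ij|ji|/val_inj ->].
- have iT k : k \in j |: T -> (i < k)%N.
    by rewrite !inE => /orP[/eqP ->//|/jT]; apply: ltn_trans.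
  by rewrite (csign_lt iT) scale1r (Phi_min _ iT).
- rewrite (Phi_min _ jT) wedgeA WA wedgeNl -wedgeA IH wedgeZr.
  rewrite (csign_gt ji jnT) scaleNr setUCA.
  rewrite (@Phi_min _ j (i |: T)) // => k; rewrite !inE => /orP[/eqP ->//|].
  exact: jT.
- by rewrite (Phi_min _ jT) wedgeA WW wedge0l /csign !inE eqxx scale0r.
Qed.

Lemma Phi_eb T : Phi (fun i => eb R (si i)) T = eb R T.
Proof.
elim/set_min_ind: T => [|j T jT IH]; first by rewrite Phi0 ext1E.
have jnT : j \notin T by apply/negP => /jT; rewrite ltnn.
rewrite (Phi_min _ jT) IH wedge_eb /esign disjoints1 jnT inversions_lt ?scale1r //.
by move=> a b /set1P ->; apply: jT.
Qed.

Lemma ext_vecE x : ext_vec x = \sum_i x i 0 *: eb R (si i).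
Proof.
apply/ffunP => S; rewrite !ffunE sum_ffunE [LHS]big_mkcond.
by apply: eq_bigr => i _; rewrite !ffunE /GRing.scale /=; case: eqP => _; rewrite ?mulr1 ?mulr0.
Qed.

Lemma eb_si_anti i j : wedge (eb R (si i)) (eb R (si j)) = - wedge (eb R (si j)) (eb R (si i)).
Proof.
rewrite !wedge_eb setUC /esign !disjoints1 !inE !inversions11.
case: (ltngtP i j) => [ij|ij|/val_inj ->]; last by rewrite eqxx /= scale0r oppr0.
  have -> : (i == j) = false by apply/negbTE; rewrite -val_eqE /= ltn_eqF.
  have -> : (j == i) = false by apply/negbTE; rewrite -val_eqE /= gtn_eqF.
  by rewrite /= expr1 expr0 scale1r scaleN1r opprK.
have -> : (i == j) = false by apply/negbTE; rewrite -val_eqE /= gtn_eqF.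
have -> : (j == i) = false by apply/negbTE; rewrite -val_eqE /= ltn_eqF.
by rewrite /= expr1 expr0 scale1r scaleN1r.
Qed.

Lemma eb_si_sq i : wedge (eb R (si i)) (eb R (si i)) = 0.
Proof. by rewrite wedge_eb /esign disjoints1 inE eqxx scale0r. Qed.

Lemma ext_vec_anti x y : wedge (ext_vec x) (ext_vec y) = - wedge (ext_vec y) (ext_vec x).
Proof.
rewrite !ext_vecE !wedge_suml -sumrN.
under eq_bigr do rewrite wedge_sumr.
under [RHS]eq_bigr do rewrite wedge_sumr -sumrN.
rewrite exchange_big /=; apply: eq_bigr => i _; apply: eq_bigr => j _.
by rewrite wedgeZl wedgeZr [in RHS]wedgeZl [in RHS]wedgeZr eb_si_anti !scalerN scalerA scalerA mulrC.
Qed.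

Lemma ext_vec_sq x : wedge (ext_vec x) (ext_vec x) = 0.
Proof.
apply/eqP; have /eqP := ext_vec_anti x x; rewrite -addr_eq0 -mulr2n -scaler_nat.
by rewrite scaler_eq0 pnatr_eq0.
Qed.

(** The algebra endomorphism of the exterior algebra induced by A, defined on basis vectors by
    wedges of columns. *)
Definition ext_map (A : 'M[C]_n) u : ext :=
  \sum_T u T *: Phi (fun i => ext_vec (col i A)) T.

Lemma ext_map_linear A : linear (ext_map A).
Proof.
move=> a u v; rewrite /ext_map scaler_sumr -big_split; apply: eq_bigr => T _.
by rewrite !ffunE scalerDl scalerA.
Qed.

Lemma ext_mapZ A a u : ext_map A (a *: u) = a *: ext_map A u.
Proof. exact: linear_scale (ext_map_linear A). Qed.

Lemma ext_map_eb A T : ext_map A (eb R T) = Phi (fun i => ext_vec (col i A)) T.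
Proof.
rewrite /ext_map (bigD1 T) //= big1 => [|S nS]; first by rewrite !ffunE eqxx scale1r addr0.
by rewrite !ffunE (negbTE nS) scale0r.
Qed.

Lemma ext_map_cons A i u :
  ext_map A (wedge (eb R (si i)) u) = wedge (ext_vec (col i A)) (ext_map A u).
Proof.
apply: (lin_ext (f := fun u => ext_map A (wedge (eb R (si i)) u))
  (g := fun u => wedge (ext_vec (col i A)) (ext_map A u))).
- by move=> a v w; rewrite wedge_linear_r ext_map_linear.
- by move=> a v w; rewrite ext_map_linear wedge_linear_r.
move=> T; rewrite -{1}(Phi_eb T).
rewrite (wedge_Phi (W := fun i => eb R (si i)) eb_si_sq eb_si_anti).
rewrite (ext_map_eb A T).
rewrite (wedge_Phi (W := fun i => ext_vec (col i A))); last 2 first.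
- by move=> j; apply: ext_vec_sq.
- by move=> j k; apply: ext_vec_anti.
by rewrite ext_mapZ Phi_eb ext_map_eb.
Qed.

Lemma ext_map1 A : ext_map A (ext1 R n) = ext1 R n.
Proof. by rewrite ext1E ext_map_eb Phi0 ext1E. Qed.

Lemma ext_mapM A u v : ext_map A (wedge u v) = wedge (ext_map A u) (ext_map A v).
Proof.
apply: (lin_ext (f := fun u => ext_map A (wedge u v))
  (g := fun u => wedge (ext_map A u) (ext_map A v))).
- by move=> a u1 u2; rewrite wedge_linear_l ext_map_linear.
- by move=> a u1 u2; rewrite ext_map_linear wedge_linear_l.
move=> S; elim/set_min_ind: S => [|j T jT IH].
  by rewrite -ext1E wedge1l ext_map1 wedge1l.
by rewrite -(Phi_eb (j |: T)) (Phi_min _ jT) Phi_eb -wedgeA !ext_map_cons IH wedgeA.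
Qed.

Lemma ext_map_vec A x : ext_map A (ext_vec x) = ext_vec (A *m x).
Proof.
have e i : ext_map A (eb R (si i)) = ext_vec (col i A).
  by have := ext_map_cons A i (ext1 R n); rewrite ext_map1 !wedge1r.
pose F : {linear ext -> ext} := HB.pack (ext_map A) (GRing.isLinear.Build _ _ _ _ _ (ext_map_linear A)).
have -> : ext_map A (ext_vec x) = F (ext_vec x) by [].
rewrite [ext_vec x]ext_vecE linear_sum.
have E i : F (x i 0 *: eb R (si i)) = x i 0 *: ext_vec (col i A).
  by rewrite -e; exact: ext_mapZ.
under eq_bigr do rewrite E.
apply/ffunP => S; rewrite sum_ffunE !ffunE.
under eq_bigr do rewrite !ffunE scaler_sumr.
rewrite exchange_big /=; apply: eq_bigr => i _; rewrite mxE.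
by apply: eq_bigr => j _; rewrite mxE /GRing.scale /= mulrC.
Qed.

Definition wedges (s : seq 'cV[C]_n) : ext := \big[@wedge R n/ext1 R n]_(x <- s) ext_vec x.

Lemma ext_map_wedges A s : ext_map A (wedges s) = wedges [seq A *m x | x <- s].
Proof.
rewrite /wedges big_map; elim: s => [|x s IH]; first by rewrite !big_nil ext_map1.
by rewrite !big_cons ext_mapM IH ext_map_vec.
Qed.

Lemma ext_map_ebE A T : ext_map A (eb R T) = wedges [seq col i A | i <- enum T].
Proof. by rewrite ext_map_eb /Phi /wedges big_map. Qed.

Lemma ext_map_comp A B u : ext_map A (ext_map B u) = ext_map (A *m B) u.
Proof.
apply: (lin_ext (f := fun u => ext_map A (ext_map B u)) (g := ext_map (A *m B))).
- by move=> a u1 u2; rewrite !ext_map_linear.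
- exact: ext_map_linear.
move=> T; rewrite !ext_map_ebE ext_map_wedges -map_comp.
by congr wedges; apply: eq_map => i /=; rewrite colE colE mulmxA.
Qed.

Lemma ext_vec_delta i : ext_vec (delta_mx i 0 : 'cV[C]_n) = eb R (si i).
Proof.
rewrite ext_vecE (bigD1 i) //= big1 => [|j ji]; first by rewrite mxE !eqxx scale1r addr0.
by rewrite mxE (negbTE ji) scale0r.
Qed.

Lemma ext_map_id u : ext_map 1%:M u = u.
Proof.
apply: (lin_ext (f := ext_map 1%:M) (g := id)) => //; first exact: ext_map_linear.
move=> T; rewrite ext_map_eb -[RHS]Phi_eb; apply: eq_bigr => i _.
by rewrite colE mul1mx ext_vec_delta.
Qed.

End Functor.

(** * The inner product and the lines of top exterior powers *)

Section ExtNorm.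
Import mathcomp.boot.finset.
Variables (R : realType) (n : nat).
Local Notation C := R[i].
Local Notation ext := (ext R n).
Local Notation si i := [set i]%SET.
Implicit Types (S T U : {set 'I_n}) (i j k : 'I_n) (u v w : ext) (x y : 'cV[C]_n).

Lemma ext_dotC u v : ext_dot v u = (ext_dot u v)^*.
Proof.
rewrite /ext_dot rmorph_sum; apply: eq_bigr => S _.
by rewrite rmorphM /= conjCK mulrC.
Qed.

Lemma ext_dotZl a u v : ext_dot (a *: u) v = a * ext_dot u v.
Proof. by rewrite /ext_dot mulr_sumr; apply: eq_bigr => S _; rewrite !ffunE mulrA. Qed.

Lemma ext_dotZr a u v : ext_dot u (a *: v) = a^* * ext_dot u v.
Proof. by rewrite ext_dotC ext_dotZl rmorphM /= -ext_dotC. Qed.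

Lemma ext_dotDl u u' v : ext_dot (u + u') v = ext_dot u v + ext_dot u' v.
Proof. by rewrite /ext_dot -big_split; apply: eq_bigr => S _; rewrite !ffunE mulrDl. Qed.

Lemma ext_dotDr u v v' : ext_dot u (v + v') = ext_dot u v + ext_dot u v'.
Proof. by rewrite ext_dotC ext_dotDl rmorphD /= -!ext_dotC. Qed.

Lemma ext_dot0l v : ext_dot (0 : ext) v = 0.
Proof. by rewrite /ext_dot big1 // => S _; rewrite ffunE mul0r. Qed.

Lemma ext_dot0r v : ext_dot v (0 : ext) = 0.
Proof. by rewrite ext_dotC ext_dot0l conjC0. Qed.

Lemma ext_dot_suml (I : Type) (r : seq I) (P : pred I) (F : I -> ext) v :
  ext_dot (\sum_(i <- r | P i) F i) v = \sum_(i <- r | P i) ext_dot (F i) v.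
Proof.
apply: (big_morph (fun u => ext_dot u v)) => [u u'|]; [exact: ext_dotDl | exact: ext_dot0l].
Qed.

Lemma ext_dot_sumr (I : Type) (r : seq I) (P : pred I) (F : I -> ext) v :
  ext_dot v (\sum_(i <- r | P i) F i) = \sum_(i <- r | P i) ext_dot v (F i).
Proof.
apply: (big_morph (fun u => ext_dot v u)) => [u u'|]; [exact: ext_dotDr | exact: ext_dot0r].
Qed.

Lemma ext_dot_eq0 u : ext_dot u u = 0 -> u = 0.
Proof.
move=> /eqP; rewrite psumr_eq0 => [/allP H|S _]; last by rewrite mul_conjC_ge0.
apply/ffunP => S; have := H S (mem_index_enum _); rewrite mul_conjC_eq0 => /eqP ->.
by rewrite ffunE.
Qed.

Lemma wedge_siE i u S : wedge (eb R (si i)) u S =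
  if i \in S then csign R i (S :\ i) * u (S :\ i) else 0.
Proof.
rewrite ffunE; case: ifP => iS.
  rewrite (bigD1 (si i)) ?sub1set //= big1 => [|T /andP[_ /negbTE nT]].
    by rewrite !ffunE eqxx mul1r addr0 /csign !inE eqxx.
  by rewrite !ffunE nT mul0r mulr0.
rewrite big1 // => T TS; rewrite !ffunE; case: eqP => [e|_]; last by rewrite mul0r mulr0.
by move: TS; rewrite e sub1set iS.
Qed.

(* Contraction with the i-th coordinate, the adjoint of e_i /\ _. *)
Definition an i v : ext := [ffun S : {set 'I_n} => csign R i S * v (i |: S) : C^o].

Lemma csign_sq i S : i \notin S -> csign R i S * csign R i S = 1.
Proof. by move=> iS; rewrite /csign (negbTE iS) -expr2 sqrr_sign. Qed.

Lemma csign_conj i S : (csign R i S)^* = csign R i S.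
Proof. by rewrite /csign; case: ifP => _; rewrite ?rmorph_sign ?conjC0. Qed.

Lemma an_linear i : linear (an i).
Proof. by move=> a u v; apply/ffunP => S; rewrite !ffunE mulrDr /GRing.scale /= mulrCA. Qed.

Lemma ext_dot_an i u v : ext_dot (wedge (eb R (si i)) u) v = ext_dot u (an i v).
Proof.
rewrite /ext_dot (bigID (fun S => i \in S)) /= [X in _ + X]big1 => [|S /negbTE iS]; last first.
  by rewrite wedge_siE iS mul0r.
rewrite addr0 [RHS](bigID (fun S => i \in S)) /= [X in _ = X + _]big1 ?add0r => [|S iS]; last first.
  by rewrite ffunE /csign iS mul0r conjC0 mulr0.
rewrite (reindex_onto (fun S => i |: S) (fun S => S :\ i)) /= => [|S iS]; last exact: setD1K.
apply: eq_big => [S|S /andP[_ /eqP e]].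
  rewrite setU11 /=; apply/eqP/idP => [<-|iS]; first by rewrite !inE eqxx.
  exact: setU1K.
rewrite wedge_siE setU11 e ffunE rmorphM /= csign_conj mulrA.
by congr (_ * _); rewrite mulrC.
Qed.

Lemma csign_ne i j S : i != j -> j \notin S ->
  csign R i (j |: S) * csign R j (i |: S) = - (csign R j S * csign R i S).
Proof.
move=> ij jS; rewrite /csign !inE (negbTE ij) (negbTE jS) eq_sym (negbTE ij) /=.
case: (boolP (i \in S)) => iS; first by rewrite mul0r mulr0 oppr0.
rewrite !inversions_cons // [X in _ = - X]mulrC.
case: (ltngtP i j) => [l|l|/val_inj e]; last by rewrite e eqxx in ij.
  by rewrite add0n add1n exprS mulN1r mulrN.
by rewrite add0n add1n exprS mulN1r mulNr.
Qed.

(** The canonical anticommutation relation between contraction with e_i and wedging with e_j. *)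
Lemma anticomm i j u : an i (wedge (eb R (si j)) u) =
  (i == j)%:R *: u - wedge (eb R (si j)) (an i u).
Proof.
apply/ffunP => S; rewrite ffunE wedge_siE [RHS]ffunE ffunE [(- _ : ext) S]ffunE wedge_siE.
rewrite /GRing.scale /=; case: (eqVneq i j) => [<-|ij].
  rewrite setU11 mul1r; case: (boolP (i \in S)) => iS.
    have c0 : csign R i S = 0 by rewrite /csign iS.
    by rewrite c0 mul0r ffunE setD1K // mulrA csign_sq ?mul1r ?subrr // !inE eqxx.
  by rewrite setU1K // mulrA csign_sq // mul1r subr0.
rewrite mul0r sub0r !inE eq_sym (negbTE ij) /=; case: (boolP (j \in S)) => jS; last first.
  by rewrite mulr0 oppr0.
rewrite ffunE mulrA mulrA -mulNr -csign_ne ?inE ?eqxx //.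
have -> : j |: S :\ j = S by rewrite setD1K.
have -> : (i |: S) :\ j = i |: S :\ j.
  by apply/setP => k; rewrite !inE; case: (eqVneq k i) => [->|]; rewrite ?(eqxx, ij) //=.
by [].
Qed.

(** The adjoint of x /\ _, conjugate-linear in x. *)
Definition anv x v : ext := \sum_i (x i 0)^* *: an i v.

Definition cdot x y : C := \sum_i x i 0 * (y i 0)^*.

Lemma ext_dot_anv x u v : ext_dot (wedge (ext_vec x) u) v = ext_dot u (anv x v).
Proof.
rewrite ext_vecE wedge_suml ext_dot_suml ext_dot_sumr; apply: eq_bigr => i _.
by rewrite wedgeZl ext_dotZl ext_dotZr conjCK ext_dot_an.
Qed.

Lemma anv_wedge x y u : anv x (wedge (ext_vec y) u) =
  cdot y x *: u - wedge (ext_vec y) (anv x u).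
Proof.
have an_sum i : an i (wedge (ext_vec y) u) = y i 0 *: u - wedge (ext_vec y) (an i u).
  pose F : {linear ext -> ext} := HB.pack (an i) (GRing.isLinear.Build _ _ _ _ _ (an_linear i)).
  have -> : an i (wedge (ext_vec y) u) = F (wedge (ext_vec y) u) by [].
  rewrite ext_vecE !wedge_suml linear_sum.
  have E j : F (wedge (y j 0 *: eb R (si j)) u) =
      y j 0 *: ((i == j)%:R *: u) - wedge (y j 0 *: eb R (si j)) (an i u).
    rewrite !wedgeZl -scalerBr -anticomm; exact: linear_scale (an_linear i).
  under eq_bigr do rewrite E.
  rewrite sumrB (bigD1 i) //= big1 => [|j ji]; first by rewrite eqxx scale1r addr0.
  by rewrite eq_sym (negbTE ji) scale0r scaler0.
have E i : (x i 0)^* *: an i (wedge (ext_vec y) u) =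
    (y i 0 * (x i 0)^*) *: u - wedge (ext_vec y) ((x i 0)^* *: an i u).
  by rewrite an_sum scalerBr wedgeZr (scalerA ((x i 0)^*)) mulrC.
rewrite /anv; transitivity (\sum_i ((y i 0 * (x i 0)^*) *: u - wedge (ext_vec y) ((x i 0)^* *: an i u))).
  by apply: eq_bigr => i _; exact: E.
rewrite big_split.
rewrite sumrN.
rewrite -wedge_sumr.
by rewrite /cdot scaler_suml.
Qed.

Lemma anv_ext1 x : anv x (ext1 R n) = 0.
Proof.
rewrite /anv big1 // => i _; apply/ffunP => S; rewrite !ffunE.
have -> : (i |: S == finset.set0) = false.
  by apply/negbTE/set0Pn; exists i; rewrite setU11.
by rewrite mulr0 /GRing.scale /= mulr0.
Qed.

Lemma anv_wedges x s : (forall y, y \in s -> cdot y x = 0) -> anv x (wedges s) = 0.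
Proof.
rewrite /wedges; elim: s => [|y s IH] H; first by rewrite big_nil anv_ext1.
rewrite big_cons anv_wedge H ?mem_head // IH => [|z zs]; last by rewrite H // inE zs orbT.
by rewrite wedge0r scale0r subr0.
Qed.

(** By adjointness <x /\ w, x /\ w> is <w, [anv x] (x /\ w)>, and contraction with x removes the
    factor x because x is orthogonal to the factors of w. No Gram determinant is needed. *)
Lemma wedges_norm s : (forall y, y \in s -> cdot y y = 1) ->
  pairwise (fun x y => cdot y x == 0) s -> ext_dot (wedges s) (wedges s) = 1.
Proof.
rewrite /wedges; elim: s => [|x s IH] H1 H0.
  rewrite big_nil /ext_dot (bigD1 finset.set0) //= big1 => [|S /negbTE nS].
    by rewrite !ffunE eqxx conjC1 mulr1 addr0.
  by rewrite !ffunE nS mul0r.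
move: H0; rewrite pairwise_cons => /andP[/allP xs ps].
have E : anv x (wedges s) = 0 by apply: anv_wedges => y /xs /eqP.
rewrite big_cons ext_dot_anv anv_wedge [anv x _]E wedge0r subr0 H1 ?mem_head // scale1r.
by apply: IH => // y ys; rewrite H1 // inE ys orbT.
Qed.

Lemma cdot_col (h : 'M[C]_n) i j : h \is unitarymx -> cdot (col i h) (col j h) = (i == j)%:R.
Proof.
move=> uh; have := unitary_Vmul uh => /matrixP/(_ j i); rewrite !mxE eq_sym => <-.
by apply: eq_bigr => k _; rewrite !mxE mulrC.
Qed.

Lemma ext_map_norm (h : 'M[C]_n) S : h \is unitarymx ->
  ext_dot (ext_map h (eb R S)) (ext_map h (eb R S)) = 1.
Proof.
move=> uh; rewrite ext_map_ebE; apply: wedges_norm.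
  by move=> y /mapP[i _ ->]; rewrite cdot_col // eqxx.
have := enum_uniq (mem S); elim: (enum S) => //= i s IH /andP[iS us].
rewrite IH // andbT; apply/allP => y /mapP[j js ->]; rewrite cdot_col //.
have -> : (j == i) = false by apply/negbTE; apply: contraNneq iS => <-.
by rewrite eqxx.
Qed.

Lemma wedges_supp S s : (forall x, x \in s -> forall i, i \notin S -> x i 0 = 0) ->
  forall T, wedges s T != 0 -> (T \subset S) && (#|T| == size s).
Proof.
rewrite /wedges; elim: s => [|x s IH] H T.
  rewrite big_nil !ffunE; case: (eqVneq T finset.set0) => [-> _|_]; last by rewrite eqxx.
  by rewrite sub0set cards0.
rewrite big_cons ext_vecE wedge_suml sum_ffunE.
have [/existsP[i /andP[iT /andP[xi Hi]]] _|/existsPn ni] :=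
    boolP [exists i, [&& i \in T, x i 0 != 0 & wedges s (T :\ i) != 0]].
  have iS : i \in S by apply: contraNT xi => /(H x (mem_head _ _)) ->.
  have /IH/(_ _ Hi)/andP[TS /eqP cT] : forall x, x \in s -> forall i, i \notin S -> x i 0 = 0.
    by move=> z zs; apply: H; rewrite inE zs orbT.
  rewrite (cardsD1 i) iT cT add1n eqxx andbT.
  by rewrite -(setD1K iT) subUset sub1set iS.
rewrite big1 ?eqxx // => i _; rewrite wedgeZl ffunE wedge_siE; case: ifP => iT; last by rewrite scaler0.
have := ni i; rewrite /= iT /= negb_and !negbK => /orP[/eqP ->|/eqP e].
  by rewrite scale0r.
by rewrite [X in _ * X]e mulr0 scaler0.
Qed.

(** In the coordinates of h the factors are supported in S and there are |S| of them, so e_S is the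
    only basis vector that can occur in their product. *)
Lemma wedges_line (h : 'M[C]_n) S s : h \is unitarymx -> size s = #|S| ->
  (forall x, x \in s -> forall i, i \notin S -> (h^t* *m x) i 0 = 0) ->
  wedges s \in <[ext_map h (eb R S)]>%VS.
Proof.
move=> uh sz H; apply/vlineP.
have -> : wedges s = ext_map h (wedges [seq h^t* *m x | x <- s]).
  rewrite ext_map_wedges -map_comp -[in LHS](map_id s); congr wedges.
  by apply: eq_map => x /=; rewrite mulmxA (unitary_mulV uh) mul1mx.
set t := map _ s.
have Ht x : x \in t -> forall i, i \notin S -> x i 0 = 0.
  by move=> /mapP[y ys ->] i; apply: H.
exists (wedges t S); rewrite -ext_mapZ; congr ext_map.
apply/ffunP => T; rewrite !ffunE; case: (eqVneq T S) => [->|TS].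
  by rewrite /GRing.scale /= mulr1.
rewrite /GRing.scale /= mulr0; apply/eqP; apply: contraNT TS => /(wedges_supp Ht).
by rewrite size_map sz => /andP[sTS /eqP cT]; rewrite eqEcard sTS /= cT.
Qed.

(** W is the span of the columns of h with index in S, described through coordinates: membership of
    eigenvectors is checked in this form. *)
Definition hspan (h : 'M[C]_n) S (W : {vspace 'cV[C]_n}) :=
  forall x, x \in W <-> forall i, i \notin S -> (h^t* *m x) i 0 = 0.

Lemma mul_cols (h : 'M[C]_n) S (c : 'I_n -> C) :
  \sum_(i in S) c i *: col i h = h *m (\col_i (if i \in S then c i else 0)).
Proof.
apply/matrixP => a b; rewrite summxE mxE big_mkcond; apply: eq_bigr => i _.
by rewrite !mxE; case: ifP => _; rewrite ?mulr0 // mulrC.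
Qed.

Definition cols (h : 'M[C]_n) S := [seq col i h | i <- enum S].

Lemma sum_cols_span (h : 'M[C]_n) S (c : 'I_n -> C) :
  \sum_(i in S) c i *: col i h \in <<cols h S>>%VS.
Proof.
apply: memv_suml => i iS; apply: memvZ; apply: memv_span; apply: map_f.
by rewrite mem_enum.
Qed.

Lemma hspan_span (h : 'M[C]_n) S W : h \is unitarymx -> hspan h S W -> W = <<cols h S>>%VS.
Proof.
move=> uh HW; apply/eqP; rewrite eqEsubv; apply/andP; split.
  apply/subvP => x /HW Hx.
  have -> : x = \sum_(i in S) (h^t* *m x) i 0 *: col i h.
    have E : \col_i (if i \in S then (h^t* *m x) i 0 else 0) = h^t* *m x.
      by apply/colP => i; rewrite mxE; case: ifP => // /negbT /Hx.
    by rewrite mul_cols E mulmxA (unitary_mulV uh) mul1mx.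
  exact: sum_cols_span.
apply/span_subvP => x /mapP[i iS ->]; apply/HW => j jS.
rewrite colE mulmxA (unitary_Vmul uh) mul1mx mxE.
by rewrite mem_enum in iS; case: (eqVneq j i) => // e; rewrite e iS in jS.
Qed.

Lemma dim_cols_le (h : 'M[C]_n) S : (\dim <<cols h S>>%VS <= #|S|)%N.
Proof. by rewrite (leq_trans (dim_span _)) // size_map -cardE. Qed.

(** The spans attached to S and to its complement have dimensions at most |S| and n - |S|, and
    together they fill a space of dimension n. *)
Lemma hspan_dim (h : 'M[C]_n) S W : h \is unitarymx -> hspan h S W -> \dim W = #|S|.
Proof.
move=> uh /(hspan_span uh) ->; apply/eqP; rewrite eqn_leq dim_cols_le /=.
have full : (fullv <= <<cols h S>> + <<cols h (~: S)>>)%VS.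
  apply/subvP => x _.
  have -> : x = \sum_(i in [set: 'I_n]%SET) (h^t* *m x) i 0 *: col i h.
    have E : \col_i (if i \in [set: 'I_n]%SET then (h^t* *m x) i 0 else 0) = h^t* *m x.
      by apply/colP => i; rewrite mxE in_setT.
    by rewrite mul_cols E mulmxA (unitary_mulV uh) mul1mx.
  rewrite (bigID (fun i => i \in S)) /=; apply: memv_add.
    rewrite (eq_bigl (fun i => i \in S)); first exact: sum_cols_span.
    by move=> i; rewrite in_setT.
  rewrite (eq_bigl (fun i => i \in (~: S)%SET)); first exact: sum_cols_span.
  by move=> i; rewrite in_setT in_setC.
have := leq_trans (dimvS full) (dimv_add_leqif _ _).1.
rewrite dimvf dim_matrix mulr1 => H.
have := leq_trans H (leq_add (leqnn _) (dim_cols_le h (~: S))).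
by rewrite -[X in (X <= _)%N](card_ord n) -(cardsC S) leq_add2r.
Qed.

Lemma mx_of_fun (f : {linear 'cV[C]_n -> 'cV[C]_n}) :
  exists M : 'M[C]_n, forall x, M *m x = f x.
Proof.
exists (\matrix_(a, b) f (delta_mx b 0) a 0) => x.
rewrite [x in RHS]matrix_sum_delta linear_sum; apply/colP => a.
rewrite summxE mxE; apply: eq_bigr => b _.
by rewrite big_ord1 linearZ !mxE mulrC.
Qed.

(** Both sides are lines, so it is enough that the wedge of the chosen basis lies on the line of e_S
    and is nonzero. *)
Lemma ext_top_hspan (h : 'M[C]_n) S W : h \is unitarymx -> hspan h S W ->
  ext_top W = <[ext_map h (eb R S)]>%VS.
Proof.
move=> uh HW; have dW := hspan_dim uh HW.
have sz : size (vbasis W) = #|S| by rewrite size_tuple dW.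
have inl : wedges (vbasis W) \in <[ext_map h (eb R S)]>%VS.
  by apply: wedges_line => // x /vbasis_mem /HW.
have nz : wedges (vbasis W) != 0.
  (* Nonvanishing: a linear map carrying the basis of W to the e_i with i in S carries the wedge to
     e_S. *)
  pose c (x : 'cV[C]_n) : 'cV[C]_n :=
    \sum_(j < \dim W) coord (vbasis W) j x *: nth 0 (cols 1%:M S) j.
  have lc : linear c.
    move=> a x y; rewrite /c scaler_sumr -big_split; apply: eq_bigr => j _.
    by rewrite linearP scalerDl scalerA.
  have [M HM] := mx_of_fun (HB.pack c (GRing.isLinear.Build _ _ _ _ c lc) : {linear 'cV[C]_n -> 'cV[C]_n}).
  have e : ext_map M (wedges (vbasis W)) = eb R S.
    rewrite ext_map_wedges -[RHS]ext_map_id ext_map_ebE; congr wedges.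
    apply: (@eq_from_nth _ 0); first by rewrite !size_map sz -cardE.
    move=> j; rewrite size_map sz => jS; rewrite (nth_map 0) ?sz // HM /= /c.
    have jd : (j < \dim W)%N by rewrite dW.
    rewrite (bigD1 (Ordinal jd)) //= big1 => [|k kj].
      by rewrite (coord_free (Ordinal jd)) ?(basis_free (vbasisP W)) // eqxx scale1r addr0.
    rewrite (@coord_free _ _ _ (vbasis W) (Ordinal jd) k) ?(basis_free (vbasisP W)) //.
    by rewrite eq_sym (negbTE kj) scale0r.
  apply/eqP => e0; move: e; rewrite e0.
  have -> : ext_map M 0 = 0 by have := ext_mapZ M 0 0; rewrite !scale0r.
  move=> /ffunP/(_ S); rewrite !ffunE eqxx => /eqP; by rewrite eq_sym oner_eq0.
rewrite /ext_top -/(wedges (vbasis W)).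
move: inl nz => /vlineP[a ->] nz; apply/eqP; rewrite eqEsubv; apply/andP; split.
  by rewrite -memvE memvZ // memv_line.
have a0 : a != 0 by apply: contraNneq nz => ->; rewrite scale0r.
rewrite -memvE; apply/vlineP; exists a^-1.
by rewrite (scalerA a^-1) mulVf // scale1r.
Qed.

End ExtNorm.

(** * The ordered circle and the sorted spectrum *)

Section Circle.
Variable R : realType.
Local Notation C := R[i].
Implicit Types (z w x : C) (p q : R).

Definition inZ z := `|z| = 1 /\ z <> 1.

Lemma tau_inj z w : inZ z -> inZ w -> tau z = tau w -> z = w.
Proof. by move=> [z1 zn] [w1 wn] e; rewrite -(tauK z1 zn) e tauK. Qed.

Lemma expi_norm p : `|expi p| = 1.
Proof. by apply/normc1P; rewrite /= cos2Dsin2. Qed.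

(** By the half-angle formulas [tau (expi p)] is the cotangent of p / 2, which decreases on the
    whole range of angles. *)
Lemma expi_half p : 0 < p -> p < 2 * pi ->
  0 < sin (p / 2) /\ tau (expi p) = cos (p / 2) / sin (p / 2).
Proof.
move=> p0 p2; have s0 : 0 < sin (p / 2).
  by apply: sin_gt0_pi; rewrite ?divr_gt0 // ltr_pdivrMr // mulrC.
split=> //; rewrite /tau /=; set a := p / 2 in s0 *.
have -> : p = a + a by rewrite /a; field.
rewrite sinD cosD; have := cos2Dsin2 a; set c := cos a; set s := sin a in s0 *.
move=> cs; have -> : 1 - (c * c - s * s) = 2 * s ^+ 2 by move: cs; rewrite !expr2; lra.
by field; rewrite gt_eqF.
Qed.

Lemma expi_inZ p : 0 < p -> p < 2 * pi -> inZ (expi p).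
Proof.
move=> p0 p2; split; first exact: expi_norm.
have [s0 _] := expi_half p0 p2; set a := p / 2 in s0.
have pE : p = a + a by rewrite /a; field.
move=> [+ _]; rewrite pE cosD => c1.
have := cos2Dsin2 a; move: c1 s0; set c := cos a; set s := sin a => c1 s0 cs.
by have : s ^+ 2 = 0 by [nra]; move/eqP; rewrite sqrf_eq0 gt_eqF.
Qed.

Lemma expi_mono p q : 0 < p -> p < q -> q < 2 * pi -> tau (expi q) < tau (expi p).
Proof.
move=> p0 pq q2; have [sp ->] := expi_half p0 (lt_trans pq q2).
have [sq ->] := expi_half (lt_trans p0 pq) q2.
rewrite ltr_pdivrMr // mulrAC ltr_pdivlMr // -subr_gt0.
have -> : cos (p / 2) * sin (q / 2) - cos (q / 2) * sin (p / 2) = sin (q / 2 - p / 2).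
  by rewrite sinB; ring.
by apply: sin_gt0_pi; move: p0 pq q2; set a := pi; lra.
Qed.

Lemma expi_surj z : inZ z -> exists p, [/\ 0 < p, p < 2 * pi & z = expi p].
Proof.
(* a is the inverse cotangent of [tau z], that is, half the angle of z. *)
move=> zZ; pose a := pi / 2 - atan (tau z).
have := atan_gtNpi2 (tau z); have := atan_ltpi2 (tau z) => a1 a2.
have pi0 := pi_gt0 R.
have a0 : 0 < a by rewrite /a subr_gt0.
have api : a < pi by rewrite /a; move: a2; lra.
have p2 : 2 * a < 2 * pi by rewrite ltr_pM2l.
have p0 : 0 < 2 * a by rewrite mulr_gt0.
exists (2 * a); split=> //; apply: (tau_inj zZ (expi_inZ p0 p2)).
have [_ ->] := expi_half p0 p2.
have -> : 2 * a / 2 = a by field.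
rewrite /a cosB sinB cos_pihalf sin_pihalf mul0r add0r !mul1r mul0r subr0.
by rewrite -{1}(atanK (tau z)) /tan.
Qed.

(** Turns the order by angles into an inequality between real numbers, reversed because the
    cotangent decreases. *)
Lemma Zlt_tau z w : Zlt z w <-> [/\ inZ z, inZ w & tau w < tau z].
Proof.
split=> [[p [q [p0 pq q2 -> ->]]]|[zZ wZ zw]].
  split; [apply: expi_inZ => //; exact: lt_trans q2| |exact: expi_mono].
  by apply: expi_inZ => //; exact: lt_trans pq.
have [p [p0 p2 ez]] := expi_surj zZ; have [q [q0 q2 ew]] := expi_surj wZ.
exists p, q; split=> //; move: zw; rewrite ez ew.
case: (ltgtP p q) => // [qp|->]; last by rewrite ltxx.
by move=> /lt_trans /(_ (expi_mono q0 qp p2)); rewrite ltxx.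
Qed.

Lemma Zlt_total z w : inZ z -> inZ w -> [\/ z = w, Zlt z w | Zlt w z].
Proof.
move=> zZ wZ; case: (ltgtP (tau z) (tau w)) => [l|l|/(tau_inj zZ wZ)].
- by apply: Or33; apply/Zlt_tau.
- by apply: Or32; apply/Zlt_tau.
- by move=> ?; apply: Or31.
Qed.

Lemma Zlt_irr z : ~ Zlt z z.
Proof. by move=> /Zlt_tau[_ _]; rewrite ltxx. Qed.

Lemma Zlt_trans z w x : Zlt z w -> Zlt w x -> Zlt z x.
Proof.
move=> /Zlt_tau[zZ wZ l1] /Zlt_tau[_ xZ l2]; apply/Zlt_tau; split=> //.
exact: lt_trans l1.
Qed.

Lemma Zlt_asym z w : Zlt z w -> ~ Zlt w z.
Proof. by move=> a /(Zlt_trans a)/Zlt_irr. Qed.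

(* Twice the oriented area of the triangle with vertices z, x, w: as a function
   of x it is affine and vanishes on the chord from z to w. *)
Definition farc z w x : R := complex.Im ((w - z) * (x - z)^*).

(** In the Cayley chart the area splits into linear factors over positive denominators, so its sign
    and its zeros can be read off. *)
Lemma farc_zof (s t u : R) : farc (zof s) (zof t) (zof u) =
  4 * (s - t) * (s - u) * (u - t) / ((s ^+ 2 + 1) * (t ^+ 2 + 1) * (u ^+ 2 + 1)).
Proof.
have := sqrD1_neq0 s; have := sqrD1_neq0 t; have := sqrD1_neq0 u => u0 t0 s0.
by rewrite /farc /=; field; rewrite u0 t0 s0.
Qed.

(** 1 is the point at infinity of the chart: this is the limit of the previous formula as u tends to
    infinity. *)
Lemma farc_zof1 (s t : R) : farc (zof s) (zof t) 1 =
  - (4 * (s - t) / ((s ^+ 2 + 1) * (t ^+ 2 + 1))).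
Proof.
have := sqrD1_neq0 s; have := sqrD1_neq0 t => t0 s0.
by rewrite /farc /=; field; rewrite t0 s0.
Qed.

Lemma sqrD1_gt0 (t : R) : 0 < t ^+ 2 + 1.
Proof. by rewrite ltr_wpDl ?sqr_ge0. Qed.

Lemma farc1_lt0 z w : Zlt z w -> farc z w 1 < 0.
Proof.
move=> /Zlt_tau[[z1 zn] [w1 wn] l]; rewrite -(tauK z1 zn) -(tauK w1 wn) farc_zof1.
by rewrite oppr_lt0 divr_gt0 ?mulr_gt0 ?sqrD1_gt0 // subr_gt0.
Qed.

Lemma farc_gt0 z w x : Zlt z w -> inZ x -> (0 < farc z w x <-> Zlt z x /\ Zlt x w).
Proof.
move=> zw xZ; have [zZ wZ l] := (Zlt_tau _ _).1 zw.
have -> : farc z w x = 4 * (tau z - tau w) * (tau z - tau x) * (tau x - tau w) /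
    ((tau z ^+ 2 + 1) * (tau w ^+ 2 + 1) * (tau x ^+ 2 + 1)).
  by rewrite -farc_zof !tauK //; [case: xZ|case: xZ|case: wZ|case: wZ|case: zZ|case: zZ].
have D0 : 0 < ((tau z ^+ 2 + 1) * (tau w ^+ 2 + 1) * (tau x ^+ 2 + 1))^-1.
  by rewrite invr_gt0 !mulr_gt0 ?sqrD1_gt0.
have E0 : 0 < 4 * (tau z - tau w) by rewrite mulr_gt0 ?subr_gt0.
rewrite (pmulr_lgt0 _ D0) -mulrA (pmulr_rgt0 _ E0).
split=> [H|[/Zlt_tau[_ _ a] /Zlt_tau[_ _ b]]]; last by rewrite mulr_gt0 ?subr_gt0.
have : tau x < tau z /\ tau w < tau x by split; nra.
by move=> [a b]; split; apply/Zlt_tau.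
Qed.

Lemma farc_eq0 z w x : Zlt z w -> `|x| = 1 -> farc z w x = 0 -> x = z \/ x = w.
Proof.
move=> zw x1; case: (eqVneq x 1) => [->|/eqP xn].
  by have := farc1_lt0 zw => /lt_eqF/negbT/eqP.
have [zZ wZ l] := (Zlt_tau _ _).1 zw; have xZ : inZ x by [].
have -> : farc z w x = 4 * (tau z - tau w) * (tau z - tau x) * (tau x - tau w) /
    ((tau z ^+ 2 + 1) * (tau w ^+ 2 + 1) * (tau x ^+ 2 + 1)).
  by rewrite -farc_zof !tauK //; [case: wZ|case: wZ|case: zZ|case: zZ].
move=> /eqP; rewrite !mulf_eq0 invr_eq0 !mulf_eq0 !(negbTE (sqrD1_neq0 _)) !orbF.
rewrite pnatr_eq0 /= !subr_eq0 (gt_eqF l) /= => /orP[/eqP/(tau_inj zZ xZ)|/eqP/(tau_inj xZ wZ)].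
  by move=> ->; left.
by move=> ->; right.
Qed.

Local Notation E := (fun z : C => emb (z : complex_space R)).

Lemma emb_expi_continuous : continuous (fun p : R => E (expi p)).
Proof.
move=> p; apply: continuous_mx_coord => i j; rewrite -(splitK j).
case: (fintype.split j) => l /=.
  have -> : (fun y : R => E (expi y) i (lshift _ l)) = (fun y => cos y).
    by apply/funext => y; rewrite row_mxEl mxE.
  exact: continuous_cos.
have -> : (fun y : R => E (expi y) i (rshift _ l)) = (fun y => sin y).
  by apply/funext => y; rewrite row_mxEr mxE.
exact: continuous_sin.
Qed.

Lemma arc_connected (z w : complex_space R) (a b : R) : a <= b ->
  (forall p, a <= p <= b -> expi p <> z /\ expi p <> w) ->
  forall p q, a <= p <= b -> a <= q <= b ->
  connected_component [set emb x | x in @circle R `&` ~` [set z; w]] (E (expi p)) (E (expi q)).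
Proof.
move=> ab H p q Hp Hq.
have cB : connected ((fun p : R => E (expi p)) @` `[a, b]).
  apply: connected_continuous_connected; first exact: segment_connected.
  by apply: continuous_subspaceT => x; apply: emb_expi_continuous.
exists ((fun p : R => E (expi p)) @` `[a, b]) => //; last by exists q => //=; rewrite in_itv.
split=> //; first by exists p => //=; rewrite in_itv.
move=> y [r /=]; rewrite in_itv /= => Hr <-; exists (expi r) => //.
split; first exact: expi_norm.
by move=> [] /=; have [] := H r Hr.
Qed.

Lemma farc_continuous z w :
  continuous (fun v : 'rV[R]_(#|{: unit}| + #|{: unit}|) => farc z w (unreal v tt)).
Proof.
have [_ c] : csc (Ck_class 0 (@openT 'rV[R]_(#|{: unit}| + #|{: unit}|)))
    (fun v => (w - z) * (unreal v tt - z)^*).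
  apply: cscM; first exact: csc_cst.
  apply: csc_conj; apply: cscD; last exact: csc_cst.
  exact: csc_unreal.
by move=> v; apply: c.
Qed.

(** If z and w both precede x, or both follow it, the arc from x to 1 on the free side avoids them,
    so x is in the component of 1. Otherwise [farc] has opposite signs at 1 and x; a connected set
    containing both contains a zero of it, and on the circle the only zeros are z and w. *)
Lemma betweenP (z w x : C) : inZ z -> inZ w ->
  between z w x <-> inZ x /\ (Zlt z x /\ Zlt x w \/ Zlt w x /\ Zlt x z).
Proof.
move=> zZ wZ.
have one_expi : (1 : C) = expi 0 by rewrite /expi cos0 sin0.
have one_expi2 : (1 : C) = expi (2 * pi).
  rewrite /expi (_ : 2 * pi = pi + pi); last by ring.
  rewrite cosD sinD cospi sinpi.
  by apply/eqP; rewrite eq_complex /=; apply/andP; split; apply/eqP; ring.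
split.
  move=> [[x1 /not_orP[xz xw]] Hc].
  have xn : x <> 1.
    move=> xe; apply: Hc; rewrite xe one_expi.
    apply: (@arc_connected z w 0 0 (lexx 0)); rewrite ?lexx // => p /le_anti <-.
    by rewrite -one_expi; split=> e; [case: zZ | case: wZ] => _; rewrite -e.
  have xZ : inZ x by [].
  split=> //; apply: contrapT => /not_orP[H1 H2].
  have [p [p0 p2 xE]] := expi_surj xZ.
  have out y : inZ y -> x <> y -> Zlt x y -> forall r, 0 <= r <= p -> expi r <> y.
    move=> yZ xy /Zlt_tau[_ _ l] r /andP[r0 rp] e.
    have r0' : 0 < r.
      rewrite lt_neqAle r0 andbT; apply/eqP => re; move: yZ.2.
      by rewrite -e -re -one_expi.
    have [rp'|pr] := ltP r p.
      by have := expi_mono r0' rp' p2; rewrite e -xE => /(lt_trans l); rewrite ltxx.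
    by apply: xy; rewrite xE -e; congr expi; apply: le_anti; rewrite pr rp.
  have out2 y : inZ y -> x <> y -> Zlt y x -> forall r, p <= r <= 2 * pi -> expi r <> y.
    move=> yZ xy /Zlt_tau[_ _ l] r /andP[pr r2] e.
    have r2' : r < 2 * pi.
      rewrite lt_neqAle r2 andbT; apply/eqP => re; move: yZ.2.
      by rewrite -e re -one_expi2.
    have [rp'|rp] := ltP p r.
      by have := expi_mono p0 rp' r2'; rewrite e -xE => /(lt_trans l); rewrite ltxx.
    by apply: xy; rewrite xE -e; congr expi; apply: le_anti; rewrite pr rp.
  have in0 : (0 : R) <= 0 <= p by apply/andP; split; [exact: lexx|exact: ltW].
  have inp : 0 <= p <= p by apply/andP; split; [exact: ltW|exact: lexx].
  have inp2 : p <= p <= 2 * pi by apply/andP; split; [exact: lexx|exact: ltW].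
  have in2 : (p <= 2 * pi) && (2 * pi <= 2 * (pi : R)) by apply/andP; split; [exact: ltW|exact: lexx].
  have [//|zx|xz'] := Zlt_total zZ xZ; first by move=> e; apply: xz.
    have [//|wx|xw'] := Zlt_total wZ xZ; first by move=> e; apply: xw.
      apply: Hc; rewrite xE one_expi2; apply: (@arc_connected z w p (2 * pi)) => //.
        exact: ltW.
      by move=> r Hr; split; [apply: out2 zx _ Hr|apply: out2 wx _ Hr].
    by apply: H1.
  have [//|wx|xw'] := Zlt_total wZ xZ; first by move=> e; apply: xw.
    by apply: H2.
  apply: Hc; rewrite xE one_expi; apply: (@arc_connected z w 0 p) => //.
    exact: ltW.
  by move=> r Hr; split; [apply: out xz' _ Hr|apply: out xw' _ Hr].
(* The intermediate value theorem for [farc] on a connected set. *)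
have key z' w' x' : Zlt z' x' -> Zlt x' w' ->
    forall B : set 'rV[R]_(#|{: unit}| + #|{: unit}|), connected B -> B (E 1) -> B (E x') ->
    exists v, [/\ B v & farc z' w' (unreal v tt) = 0].
  move=> zx xw B cB B1 Bx.
  have zw := Zlt_trans zx xw.
  have c : connected ((fun v => farc z' w' (unreal v tt)) @` B).
    apply: connected_continuous_connected => //.
    by apply: continuous_subspaceT => v; apply: farc_continuous.
  have /connected_intervalP itv := c.
  have f1 : farc z' w' 1 < 0 by apply: farc1_lt0.
  have fx : 0 < farc z' w' x' by apply/farc_gt0 => //; case/Zlt_tau: xw.
  have : ((fun v => farc z' w' (unreal v tt)) @` B) 0.
    apply: (itv (farc z' w' 1) (farc z' w' x')).
    - by exists (E 1) => //; rewrite realifyK.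
    - by exists (E x') => //; rewrite realifyK.
    - by rewrite (ltW f1) (ltW fx).
  by move=> [v Bv e]; exists v.
move=> [xZ H]; split.
  split; first by case: xZ.
  by case: H => -[l1 l2] [] /= e; subst; [case: (Zlt_irr l1)|case: (Zlt_irr l2)|case: (Zlt_irr l2)|case: (Zlt_irr l1)].
move=> [B [B1 sB cB] Bx].
suff [v [Bv [z' [w' [zw' fv Hzw]]]]] : exists v, B v /\ exists z' w', [/\ Zlt z' w',
    farc z' w' (unreal v tt) = 0 & (z' = z /\ w' = w) \/ (z' = w /\ w' = z)].
  have [y [y1 /not_orP[yz yw]] ye] := sB v Bv.
  move: fv; rewrite -ye realifyK => fv.
  by have := farc_eq0 zw' y1 fv; case: Hzw => -[-> ->] [].
case: H => -[l1 l2]; have [v [Bv e]] := key _ _ _ l1 l2 B cB B1 Bx; exists v; split=> //.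
  by exists z, w; split=> //; [exact: Zlt_trans l2 | left].
by exists w, z; split=> //; [exact: Zlt_trans l2 | right].
Qed.

End Circle.

(** * Diagonalisation with sorted eigenvalues *)

Section SortedSpectrum.
Import mathcomp.boot.finset.
Variables (R : realType) (n : nat).
Local Notation C := R[i].
Local Notation M := 'M[C]_n.
Implicit Types (h : M) (d : 'rV[C]_n) (z x : C).

(** The eigenvalue 1 lies outside Z, and [tau] has the meaningless value 0 there; it is placed first
    by a separate test. *)
Definition leZ x y := (x == 1) || ((y != 1) && (tau y <= tau x)).
Definition ltZ x z := (x == 1) || (tau z < tau x).

Lemma leZ_total : total leZ.
Proof.
move=> x y; rewrite /leZ; case: eqP => //= _; case: eqP => //= _.
by case: (leP (tau y) (tau x)) => // /ltW ->.
Qed.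

Lemma leZ_trans : transitive leZ.
Proof.
move=> y x z; rewrite /leZ; case: eqP => //= _; case: eqP => //= _ l1.
case: eqP => //= _ l2; exact: le_trans l1.
Qed.

Lemma leZ_ltZ x y z : leZ x y -> ltZ y z -> ltZ x z.
Proof.
rewrite /leZ /ltZ; case: eqP => //= _ /andP[/negbTE -> l1] /= l2; exact: lt_le_trans l1.
Qed.

Lemma udiagE h d a b : udiag h d a b = \sum_i d 0 i * (h a i * (h b i)^*).
Proof.
rewrite /udiag mul_mx_diag mxE; apply: eq_bigr => i _.
by rewrite !mxE mulrAC mulrC.
Qed.

(* The eigenvalues are sorted along the circle starting with 1, so those between z1 and z2
   occupy the positions in [NZ z1, NZ z2[, with NZ defined below. *)
Definition sdiag (A : M) h d := [/\ h \is unitarymx, A = udiag h d,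
  forall i, `|d 0 i| = 1 & forall i j : 'I_n, (i <= j)%N -> leZ (d 0 i) (d 0 j)].

Lemma udiag_unitary h d : h \is unitarymx -> udiag h d \is unitarymx ->
  forall i, `|d 0 i| = 1.
Proof.
move=> uh /unitary_mulV; rewrite udiag_trC (udiag_mul _ _ uh) -(udiag1 uh).
move=> /(udiag_inj uh)/rowP H i; have := H i; rewrite !mxE -normCK => /eqP.
by rewrite sqrf_eq1 => /orP[/eqP //|/eqP e]; have := normr_ge0 (d 0 i); rewrite e oppr_ge0 ler10.
Qed.

Lemma sdiag_exists (A : M) : A \is unitarymx -> exists h d, sdiag A h d.
Proof.
move=> uA; have [h [d [uh E]]] : exists h d, h \is unitarymx /\ A = udiag h d.
  by apply: normal_udiag; apply/normalmxP; rewrite (unitary_mulV uA) (unitary_Vmul uA).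
(* Sorting the eigenvalues defines a permutation p; permuting the columns of h by p leaves the
   matrix unchanged. *)
pose t := [tuple d 0 i | i < n]; pose s := sort leZ t.
have sz : size s == n by rewrite size_sort size_tuple.
have /tuple_permP[p sE] : perm_eq (Tuple sz) t by rewrite /= perm_sort.
pose h' : M := \matrix_(a, i) h a (p i); pose d' : 'rV[C]_n := \row_i d 0 (p i).
have reE (e : 'rV[C]_n) : udiag h' (\row_i e 0 (p i)) = udiag h e.
  apply/matrixP => a b; rewrite !udiagE [RHS](reindex_inj (@perm_inj _ p)).
  by apply: eq_bigr => i _; rewrite !mxE.
have uh' : h' \is unitarymx.
  apply/unitarymxP; have := reE (const_mx 1); rewrite (udiag1 uh) => <-.
  have -> : (\row_i (const_mx 1 : 'rV[C]_n) 0 (p i)) = const_mx 1 :> 'rV[C]_n.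
    by apply/rowP => i; rewrite !mxE.
  by rewrite /udiag diag_const_mx mulmx1.
have ss : sorted leZ s by apply: sort_sorted; exact: leZ_total.
have d'E i : d' 0 i = nth 0 s i.
  have := congr1 (fun s : seq C => nth 0 s i) sE.
  by rewrite [val _]/= => ->; rewrite nth_mktuple tnth_mktuple mxE.
exists h', d'; split=> //; first by rewrite E /d' reE.
  by apply: (udiag_unitary uh'); rewrite /d' reE -E.
move=> i j ij; rewrite !d'E.
have r : reflexive leZ by move=> x; have := leZ_total x x; rewrite orbb.
by apply: (sorted_leq_nth leZ_trans r 0 ss) => //; rewrite inE (eqP sz).
Qed.

Lemma card_ord_lt k : (k <= n)%N -> #|[pred j : 'I_n | (j < k)%N]| = k.
Proof.
move=> kn; rewrite -sum1_card (eq_bigl (fun j : 'I_n => (j < k)%N)) //.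
by rewrite (big_ord_narrow kn) sum1_card card_ord.
Qed.

Lemma card_initial (P : pred 'I_n) : (forall i j : 'I_n, (i <= j)%N -> P j -> P i) ->
  forall i : 'I_n, (i < #|P|)%N = P i.
Proof.
move=> H i; case: (boolP (P i)) => Pi.
  rewrite -{1}(card_ord_lt (ltn_ord i)).
  by apply: subset_leq_card; apply/fintype.subsetP => j; rewrite !inE ltnS => /H; apply.
apply/negbTE; rewrite -leqNgt -[X in (_ <= X)%N](card_ord_lt (ltnW (ltn_ord i))).
apply: subset_leq_card; apply/fintype.subsetP => j; rewrite !inE => Pj.
by rewrite ltnNge; apply: contra Pi => /H; apply.
Qed.

(** For sorted d the counted indices form an initial segment, so this count is also the position
    where the list is cut. *)
Definition NZ d z := #|[pred i | ltZ (d 0 i) z]|.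

Lemma NZP A h d z (i : 'I_n) : sdiag A h d -> (i < NZ d z)%N = ltZ (d 0 i) z.
Proof.
move=> [_ _ _ sd]; apply: (card_initial (P := [pred i | ltZ (d 0 i) z])) => a b ab /=.
exact: leZ_ltZ (sd _ _ ab).
Qed.

Lemma ltZP x z : inZ z -> `|x| = 1 -> ltZ x z <-> x = 1 \/ Zlt x z.
Proof.
move=> zZ x1; rewrite /ltZ; case: eqVneq => [->|/eqP xn] /=; first by split=> // _; left.
split=> [l|[//|/Zlt_tau[]//]]; by right; apply/Zlt_tau.
Qed.

Lemma eigval_udiag h d z : h \is unitarymx -> eigval (udiag h d) z <-> exists i, z = d 0 i.
Proof.
move=> uh; rewrite eigvalP.
have -> : udiag h d - z%:M = udiag h (\row_i (d 0 i - z)).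
  have -> : z%:M = udiag h (const_mx z).
    have -> : const_mx z = z *: (const_mx 1 : 'rV[C]_n).
      by apply/rowP => i; rewrite !mxE mulr1.
    by rewrite -udiagZ (udiag1 uh) scalemx1.
  rewrite -scaleN1r udiagZ udiagD; congr udiag.
  by apply/rowP => i; rewrite !mxE mulN1r.
rewrite udiag_det //; split.
  move=> /eqP/prodf_eq0[i _]; rewrite mxE subr_eq0 => /eqP e; by exists i.
move=> [i ->]; apply/eqP/prodf_eq0; exists i => //; by rewrite mxE subrr.
Qed.

Lemma mem_eigvals (A : M) z : z \in eigvals A <-> eigval A z.
Proof.
rewrite eigval_root /eigvals; case: closed_field_poly_normal => r /= E.
rewrite [X in root X _]E rootZ ?root_prod_XsubC //.
by rewrite lead_coef_eq0 monic_neq0 // char_poly_monic.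
Qed.

Lemma mem_eigsp (A : M) x (v : 'cV[C]_n) : v \in eigsp A x <-> A *m v = x *: v.
Proof.
have l : linear (fun v : 'cV[C]_n => A *m v - x *: v).
  by move=> a u w; rewrite mulmxDr -scalemxAr; apply/matrixP => i j; rewrite !mxE; ring.
pose f : {linear 'cV[C]_n -> 'cV[C]_n} := HB.pack
  (fun v : 'cV[C]_n => A *m v - x *: v)
  (GRing.isLinear.Build _ _ _ _ _ l).
rewrite /eigsp memv_ker.
have -> : linfun (fun v : 'cV[C]_n => A *m v - x *: v) v = A *m v - x *: v by exact: (lfunE f v).
by rewrite subr_eq0; split=> /eqP.
Qed.

Lemma sumv_seq_sub (I : eqType) (r : seq I) (P : pred I) (F : I -> {vspace 'cV[C]_n}) W :
  (forall i, i \in r -> P i -> (F i <= W)%VS) -> (\sum_(i <- r | P i) F i <= W)%VS.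
Proof.
elim: r => [|i r IH] H; first by rewrite big_nil sub0v.
have Hr : (\sum_(i <- r | P i) F i <= W)%VS.
  by apply: IH => j jr; apply: H; rewrite inE jr orbT.
rewrite big_cons; case: ifP => // Pi; rewrite subv_add Hr H ?mem_head //.
Qed.

Lemma sumv_seq_sup (I : eqType) (r : seq I) (P : pred I) (F : I -> {vspace 'cV[C]_n}) i :
  i \in r -> P i -> (F i <= \sum_(i <- r | P i) F i)%VS.
Proof.
elim: r => [//|j r IH]; rewrite inE big_cons => /predU1P[<-|ir] Pi.
  by rewrite Pi addvSl.
by case: ifP => _; [apply: subv_trans (addvSr _ _)|]; apply: IH.
Qed.

Lemma hspan_cols h (S : {set 'I_n}) : h \is unitarymx -> hspan h S <<cols h S>>%VS.
Proof.
move=> uh x; split=> [/coord_span ->|Hx]; last first.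
  have -> : x = \sum_(i in S) (h^t* *m x) i 0 *: col i h.
    have E : \col_i (if i \in S then (h^t* *m x) i 0 else 0) = h^t* *m x.
      by apply/colP => i; rewrite mxE; case: ifP => // /negbT /Hx.
    by rewrite mul_cols E mulmxA (unitary_mulV uh) mul1mx.
  exact: sum_cols_span.
move=> i iS; rewrite mulmx_sumr summxE big1 // => j _.
rewrite -scalemxAr mxE; set b := _`_j; have : b \in cols h S.
  by apply: mem_nth; rewrite size_map -cardE; exact: ltn_ord.
move=> /mapP[k kS ->]; rewrite colE mulmxA (unitary_Vmul uh) mul1mx mxE.
rewrite mem_enum in kS; case: (eqVneq i k) => [e|_]; last by rewrite mulr0.
by rewrite e kS in iS.
Qed.

Definition itv (a b : nat) : {set 'I_n} := [set i : 'I_n | (a <= i < b)%N]%SET.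

(** An index belongs to the interval exactly when its eigenvalue lies strictly between z1 and z2.
    That z1 is not an eigenvalue turns the negation of preceding z1 into strictly following it. *)
Lemma Esum_hspan (g : Un R n) h d z1 z2 : sdiag (mx_of g) h d -> inZ z1 -> inZ z2 ->
  ~ eigval (mx_of g) z1 ->
  hspan h (itv (NZ d z1) (NZ d z2)) (Esum z1 z2 g).
Proof.
move=> sd z1Z z2Z n1; have [uh E d1 _] := sd.
have dP i : i \in itv (NZ d z1) (NZ d z2) <-> Zlt z1 (d 0 i) /\ Zlt (d 0 i) z2.
  rewrite inE (NZP _ _ sd) leqNgt (NZP _ _ sd).
  have nz1 : d 0 i <> z1 by move=> e; apply: n1; rewrite E eigval_udiag //; exists i.
  split=> [/andP[/negP H1 /(ltZP z2Z (d1 i)) H2]|[H1 H2]].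
    have dn1 : d 0 i <> 1 by move=> e; apply: H1; apply/(ltZP z1Z (d1 i)); left.
    have dZ : inZ (d 0 i) by [].
    split; last by case: H2.
    have [e|//|l] := Zlt_total z1Z dZ; first by case: nz1.
    by case: H1; apply/(ltZP z1Z (d1 i)); right.
  apply/andP; split; last by apply/(ltZP z2Z (d1 i)); right.
  apply/negP => /(ltZP z1Z (d1 i))[e|/(Zlt_asym H1)//].
  by case/Zlt_tau: H1 => _ [_ /(_ e)].
suff -> : Esum z1 z2 g = <<cols h (itv (NZ d z1) (NZ d z2))>>%VS by exact: hspan_cols.
apply/eqP; rewrite eqEsubv; apply/andP; split.
  apply: sumv_seq_sub => x _ /asboolP[l1 l2]; apply/subvP => v /mem_eigsp Hv.
  apply/(hspan_cols _ uh) => i iS; apply/eqP; apply: contraNT iS => ci.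
  (* An eigenvector for x has a zero coordinate at every index whose eigenvalue is not x. *)
  have e : (d 0 i - x) * (h^t* *m v) i 0 = 0.
    have := congr1 (fun w : 'cV[C]_n => (h^t* *m w) i 0) Hv.
    rewrite E /udiag !mulmxA (unitary_Vmul uh) mul1mx -!mulmxA mul_diag_mx.
    by rewrite -scalemxAr mxE [RHS]mxE mulrBl => ->; rewrite subrr.
  move/eqP: e; rewrite mulf_eq0 (negbTE ci) orbF subr_eq0 => /eqP e.
  by apply/dP; rewrite e.
apply/span_subvP => v /mapP[i iS ->].
rewrite mem_enum in iS; have [l1 l2] := (dP i).1 iS.
apply: (subvP (sumv_seq_sup (P := fun x => `[< Zlt z1 x /\ Zlt x z2 >]) (i := d 0 i) _ _ _)).
- by apply/mem_eigvals; rewrite E eigval_udiag //; exists i.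
- exact/asboolP.
- apply/mem_eigsp; rewrite E /udiag colE -!mulmxA (mulmxA (h^t*)) (unitary_Vmul uh) mul1mx.
  have -> : diag_mx d *m delta_mx i 0 = d 0 i *: delta_mx i 0 :> 'cV[C]_n.
    apply/colP => j; rewrite mul_diag_mx !mxE; case: eqVneq => [->|_] //.
    by rewrite !mulr0.
  by rewrite scalemxAr.
Qed.

Lemma ext_top_Esum (g : Un R n) h d z1 z2 : sdiag (mx_of g) h d -> inZ z1 -> inZ z2 ->
  ~ eigval (mx_of g) z1 ->
  ext_top (Esum z1 z2 g) = <[ext_map h (eb R (itv (NZ d z1) (NZ d z2)))]>%VS.
Proof.
by move=> sd z1Z z2Z n1; case: (sd) => uh _ _ _; apply: ext_top_hspan uh (Esum_hspan sd z1Z z2Z n1).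
Qed.

Lemma NZ_le A h d z1 z2 : sdiag A h d -> Zlt z1 z2 -> (NZ d z1 <= NZ d z2)%N.
Proof.
move=> sd l; apply: subset_leq_card; apply/fintype.subsetP => i; rewrite !inE /ltZ.
case: eqP => //= _ l'; case/Zlt_tau: l => _ _ l''; exact: lt_trans l'.
Qed.

Lemma NZ_lt A h d z1 z2 : sdiag A h d -> inZ z1 -> inZ z2 -> ~ eigval A z1 ->
  (NZ d z1 < NZ d z2)%N <-> exists x, [/\ eigval A x, Zlt z1 x & Zlt x z2].
Proof.
move=> sd z1Z z2Z n1; have [uh E d1 _] := sd.
have nz1 i : d 0 i <> z1 by move=> e; apply: n1; rewrite E eigval_udiag //; exists i.
split=> [l|[x [/=]]].
  have kn : (NZ d z1 < n)%N.
    by apply: leq_trans l _; rewrite -[X in (_ <= X)%N](card_ord n); apply: max_card.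
  (* Counting starts at 0, so position [NZ d z1] holds the first eigenvalue that does not precede
     z1. *)
  pose i := Ordinal kn; have H2 : ltZ (d 0 i) z2 by rewrite -(NZP _ _ sd).
  have /negP H1 : ~~ ltZ (d 0 i) z1 by rewrite -(NZP _ _ sd) ltnn.
  have dn1 : d 0 i <> 1 by move=> e; apply: H1; apply/(ltZP z1Z (d1 i)); left.
  exists (d 0 i); split.
  - by rewrite E eigval_udiag //; exists i.
  - have dZ : inZ (d 0 i) by [].
    have [e|//|l'] := Zlt_total z1Z dZ; first by case: (nz1 i).
    by case: H1; apply/(ltZP z1Z (d1 i)); right.
  - by have /(ltZP z2Z (d1 i)) [] := H2.
rewrite E => /(eigval_udiag _ _ uh) [i ->] l1 l2.
have H2 : (i < NZ d z2)%N by rewrite (NZP _ _ sd); apply/(ltZP z2Z (d1 i)); right.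
apply: leq_trans H2; rewrite ltnS leqNgt (NZP _ _ sd).
apply/negP => /(ltZP z1Z (d1 i))[e|/(Zlt_asym l1)//].
by case/Zlt_tau: l1 => _ [_ /(_ e)].
Qed.

Section PointOfY2.
Variable y : Y2 R n.
Local Notation z1 := (z1_of y).
Local Notation z2 := (z2_of y).

Lemma z1Z : inZ z1. Proof. by case: (svalP (sval (sval y).1).1). Qed.
Lemma z2Z : inZ z2. Proof. by case: (svalP (sval (sval y).2).1). Qed.

Lemma z1_neig : ~ eigval (mx_of (g_of y)) z1.
Proof. exact: (svalP (sval y).1). Qed.

Lemma z2_neig : ~ eigval (mx_of (g_of y)) z2.
Proof. rewrite /g_of (svalP y); exact: (svalP (sval y).2). Qed.

Variables (h : M) (d : 'rV[C]_n).
Hypothesis sd : sdiag (mx_of (g_of y)) h d.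
Local Notation N1 := (NZ d z1).
Local Notation N2 := (NZ d z2).

Lemma eig_betweenP : eig_between y <->
  (Zlt z1 z2 /\ (N1 < N2)%N) \/ (Zlt z2 z1 /\ (N2 < N1)%N).
Proof.
have P12 := NZ_lt sd z1Z z2Z z1_neig; have P21 := NZ_lt sd z2Z z1Z z2_neig.
split.
  move=> [x ex /(betweenP _ z1Z z2Z)[_ [[l1 l2]|[l1 l2]]]].
    by left; split; [exact: Zlt_trans l2 | apply/P12; exists x].
  by right; split; [exact: Zlt_trans l2 | apply/P21; exists x].
move=> [[l /P12[x [ex l1 l2]]]|[l /P21[x [ex l1 l2]]]]; exists x => //;
  apply/(betweenP _ z1Z z2Z); split; try by case/Zlt_tau: l1.
  by left.
by right.
Qed.

Lemma sign_ofE : sign_of y = if (N1 < N2)%N then Pos else if (N2 < N1)%N then Neg else Nul.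
Proof.
rewrite /sign_of; case: ifPn => [/asboolP[l /eig_betweenP[[_ ->]//|[/(Zlt_asym l)//]]]|/asboolPn H].
have le l : Zlt z1 z2 -> (N1 < N2)%N = false.
  by move=> l'; apply/negP => l2; apply: H; split=> //; apply/eig_betweenP; left.
case: ifPn => [/asboolP[l /eig_betweenP[[/(Zlt_asym l)//]|[_ l2]]]|/asboolPn H'].
  by rewrite l2 ltnNge ltnW.
have lt1 : (N1 < N2)%N = false.
  apply/negP => l; have [e|l'|l'] := Zlt_total z1Z z2Z; first by rewrite e ltnn in l.
    by apply: H; split=> //; apply/eig_betweenP; left.
  by have := NZ_le sd l'; rewrite leqNgt l.
have lt2 : (N2 < N1)%N = false.
  apply/negP => l; have [e|l'|l'] := Zlt_total z1Z z2Z; first by rewrite e ltnn in l.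
    by have := NZ_le sd l'; rewrite leqNgt l.
  by apply: H'; split=> //; apply/eig_betweenP; right.
by rewrite lt1 lt2.
Qed.

Lemma det_lineE : det_line y =
  <[ext_map h (eb R (itv (minn N1 N2) (maxn N1 N2)))]>%VS.
Proof.
rewrite /det_line; case: ifPn => [/asboolP l|/asboolPn l].
  have le := NZ_le sd l.
  by rewrite (ext_top_Esum sd z1Z z2Z z1_neig) (minn_idPl le) (maxn_idPr le).
have le : (N2 <= N1)%N.
  by have [->|//|l'] := Zlt_total z1Z z2Z; last exact: NZ_le sd l'.
by rewrite (ext_top_Esum sd z2Z z1Z z2_neig) (minn_idPr le) (maxn_idPl le).
Qed.

End PointOfY2.

End SortedSpectrum.

(** * Coordinates on the fibres *)

Section Fibre.
Import mathcomp.boot.finset.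
Variables (R : realType) (n : nat).
Local Notation C := R[i].
Local Notation ext := (ext R n).
Implicit Types (s : sign) (l : {vspace ext}) (e u : ext).

(** On Y^[2]_0 the fibre is C and not the line l, and [as_vec] and [as_fun] identify it through
    [ext1]; so there e has to be [ext1] itself and not merely proportional to it. *)
Definition frame_of s l e :=
  [/\ l = <[e]>%VS, ext_dot e e = 1 & s = Nul -> e = ext1 R n].

Definition kap s l e : fibre s l -> C :=
  match s return fibre s l -> C with
  | Pos => fun p => ext_dot (vsval p) e
  | Neg => fun p => p (vsproj l e)
  | Nul => fun p => p
  end.

Definition kinv s l e (a : C) : fibre s l :=
  match s return fibre s l with
  | Pos => vsproj l (a *: e)
  | Neg => linfun (fun u : subvs_of l => a * ext_dot (vsval u) e : C^o)
  | Nul => a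
  end.

Lemma unit_neq0 e : ext_dot e e = 1 -> e != 0.
Proof.
by move=> e1; apply/eqP => e0; move/eqP: e1; rewrite e0 ext_dot0l eq_sym oner_eq0.
Qed.

Lemma ext1_0 : ext1 R n finset.set0 = 1.
Proof. by rewrite ffunE eqxx. Qed.

Section Framed.
Variables (s : sign) (l : {vspace ext}) (e : ext).
Hypothesis fr : frame_of s l e.

Lemma frame_mem : e \in l.
Proof. by case: fr => -> _ _; apply: memv_line. Qed.

Lemma frame_line u : u \in l -> u = ext_dot u e *: e.
Proof.
by case: fr => -> e1 _ /vlineP[a ->]; rewrite ext_dotZl e1 mulr1.
Qed.

Lemma kap_linear : linear (@kap s l e).
Proof.
case: s fr => fr' a p q /=.
- by rewrite ext_dotDl ext_dotZl.
- by rewrite add_lfunE scale_lfunE.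
- by [].
Qed.

Lemma kinvK a : kap e (kinv s l e a) = a.
Proof.
have em := frame_mem; case: fr => _ e1 _; case: s => /=.
- by rewrite vsprojK ?memvZ // ext_dotZl e1 mulr1.
- have lf : linear (fun u : subvs_of l => a * ext_dot (vsval u) e : C^o).
    by move=> b u v; rewrite linearP ext_dotDl ext_dotZl mulrDr mulrCA.
  pose f : {linear subvs_of l -> C^o} := HB.pack
    (fun u : subvs_of l => a * ext_dot (vsval u) e : C^o)
    (GRing.isLinear.Build _ _ _ _ _ lf).
  rewrite (lfunE f) /= vsprojK // e1 mulr1 //.
- by [].
Qed.

Lemma kap_inj (p q : fibre s l) : kap e p = kap e q -> p = q.
Proof.
have em := frame_mem; have el := frame_line; case: fr => _ e1 _.
case: s p q => /= p q.
- move=> H; apply: subvs_inj; rewrite (el _ (subvsP p)) (el _ (subvsP q)).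
  by rewrite [ext_dot _ _]H.
- move=> H; apply/lfunP => u.
  have -> : u = ext_dot (vsval u) e *: vsproj l e.
    by apply: subvs_inj; rewrite linearZ /= vsprojK // -el // subvsP.
  by rewrite !linearZ /= H.
- by [].
Qed.

Lemma kap_as_vec (p : fibre s l) : s <> Neg -> as_vec p = kap e p *: e.
Proof.
have el := frame_line; case: fr => _ e1 E; case: s E p => //= [_ p _|E p _].
  exact: el (subvsP p).
by rewrite E.
Qed.

Lemma kap_as_fun (p : fibre s l) a : s <> Pos -> as_fun p (a *: e) = a * kap e p.
Proof.
have em := frame_mem; case: fr => _ e1 E; case: s E p => //= [_ p _|E p _].
  have -> : vsproj l (a *: e) = a *: vsproj l e.
    by apply: subvs_inj; rewrite linearZ.
  by rewrite linearZ.
by rewrite E // ffunE ext1_0 /GRing.scale /= mulr1 mulrC.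
Qed.

Lemma kap_of_vec a : s <> Neg -> kap e (of_vec s l (a *: e)) = a.
Proof.
have em := frame_mem; case: fr => _ e1 E; case: s E => //= [_ _|E _].
  by rewrite vsprojK ?memvZ // ext_dotZl e1 mulr1.
by rewrite E // ffunE ext1_0 /GRing.scale /= mulr1.
Qed.

Lemma kap_of_fun (f : ext -> C) : s <> Pos -> (forall a, f (a *: e) = a * f e) ->
  kap e (of_fun s l f) = f e.
Proof.
have em := frame_mem; have el := frame_line; case: fr => _ e1 E.
case: s E => //= [_ _ H|E _ H]; last by rewrite E.
have lf : linear (fun u : subvs_of l => f (vsval u) : C^o).
  move=> b u v; have -> : vsval (b *: u + v) = b *: vsval u + vsval v by [].
  rewrite (el _ (subvsP u)) (el _ (subvsP v)).
  rewrite (scalerA b) -scalerDl H H H mulrDl -mulrA //.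
pose F : {linear subvs_of l -> C^o} := HB.pack
  (fun u : subvs_of l => f (vsval u) : C^o)
  (GRing.isLinear.Build _ _ _ _ _ lf).
by rewrite (lfunE F) /= vsprojK.
Qed.

Lemma vpick_line : exists2 a, a != 0 & vpick l = a *: e.
Proof.
have [le e1 _] := fr; have := memv_pick l; rewrite {2}le => /vlineP[a E].
exists a => //; apply/eqP => a0.
have : vpick l == 0 by rewrite E a0 scale0r.
rewrite vpick0 => /eqP l0; have := frame_mem; rewrite l0 memv0.
by rewrite (negbTE (unit_neq0 e1)).
Qed.

(** The dual metric uses a picked vector a e; the factor a a^* appears in the numerator and in the
    denominator. *)
Lemma fibre_dot_kap (p q : fibre s l) : fibre_dot p q = kap e p * (kap e q)^*.
Proof.
have [a a0 va] := vpick_line; have em := frame_mem; have el := frame_line.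
case: fr => _ e1 E; case: s E p q => //= [_|_] p q.
  by rewrite {1}(el _ (subvsP p)) {1}(el _ (subvsP q)) ext_dotZl ext_dotZr e1 mulr1.
rewrite va; have -> : vsproj l (a *: e) = a *: vsproj l e.
  by apply: subvs_inj; rewrite linearZ.
rewrite !linearZ /= ext_dotZl ext_dotZr e1 mulr1 /GRing.scale /= rmorphM /=.
have ac : a^* != 0 by rewrite conjC_eq0.
set u := p _; set v := (q _)^*; field; rewrite a0 andbT.
exact: ac.
Qed.

Lemma fibre_dim : \dim {: fibre s l} = 1%N.
Proof.
have k0 : kinv s l e 1 != 0.
  apply/eqP => k0; have := kinvK 1; rewrite k0.
  have -> : kap e (0 : fibre s l) = 0.
    have := linear_scale 0 (0 : fibre s l) kap_linear; rewrite scale0r => ->.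
    exact: scale0r.
  by move=> /eqP; rewrite eq_sym oner_eq0.
have -> : fullv = <[kinv s l e 1]>%VS.
  apply/eqP; rewrite eqEsubv subvf andbT; apply/subvP => p _.
  apply/vlineP; exists (kap e p); apply: kap_inj.
  have := linear_scale (kap e p) (kinv s l e 1) kap_linear => ->.
  by rewrite kinvK /GRing.scale /= mulr1.
by rewrite dim_vline k0.
Qed.

End Framed.

Lemma quot_line e (a b : C) : e != 0 -> b != 0 -> quot (a *: e) (b *: e) = a / b.
Proof.
move=> e0 b0; have be0 : b *: e != 0 by rewrite scaler_eq0 negb_or b0.
have fr : free [tuple b *: e] by rewrite seq1_free.
rewrite /quot; have -> : a *: e = (a / b) *: (b *: e).
  by rewrite (scalerA (a / b)) mulfVK.
rewrite linearZ /=; have := coord_free ord0 ord0 fr; rewrite /= => ->.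
by rewrite mulr1.
Qed.

End Fibre.

(** * The coordinate of a fibre element and the gerbe product *)

Section Kappa.
Import mathcomp.boot.finset.
Variables (R : realType) (n : nat).
Local Notation C := R[i].
Local Notation M := 'M[C]_n.
Local Notation ext := (ext R n).
Implicit Types (h : M) (d : 'rV[C]_n) (y a b c : Y2 R n).

Definition veps h (p q : nat) : ext := ext_map h (eb R (itv n p q)).

Lemma itv_nil p : itv n p p = finset.set0.
Proof. by apply/setP => i; rewrite !inE ltnNge; case: leqP. Qed.

Lemma veps_nil h p : veps h p p = ext1 R n.
Proof. by rewrite /veps itv_nil -ext1E ext_map1. Qed.

(** Consecutive index intervals are disjoint and have no inversions, so the sign is 1. *)
Lemma veps_wedge h p q r : (p <= q)%N -> (q <= r)%N ->
  wedge (veps h p q) (veps h q r) = veps h p r.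
Proof.
move=> pq qr; rewrite /veps -ext_mapM wedge_eb /esign -setI_eq0.
have -> : (itv n p q :&: itv n q r)%SET = finset.set0.
  by apply/setP => i; rewrite !inE; case: (leqP q i) => qi; rewrite ?andbF ?andFb.
rewrite eqxx inversions_lt => [|i j]; last first.
  by rewrite !inE => /andP[_ iq] /andP[qj _]; apply: leq_trans iq qj.
rewrite expr0 scale1r; congr (ext_map h (eb R _)); apply/setP => i; rewrite !inE.
case: (leqP q i) => qi; first by rewrite andbF (leq_trans pq qi).
by rewrite andbT orbF (leq_trans qi qr) andbT.
Qed.

Lemma veps_norm h p q : h \is unitarymx -> ext_dot (veps h p q) (veps h p q) = 1.
Proof. exact: ext_map_norm. Qed.

Lemma veps_neq0 h p q : h \is unitarymx -> veps h p q != 0.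
Proof. by move=> uh; apply: unit_neq0; apply: veps_norm. Qed.

Definition Nmin d y := minn (NZ d (z1_of y)) (NZ d (z2_of y)).
Definition Nmax d y := maxn (NZ d (z1_of y)) (NZ d (z2_of y)).

(* The coordinate of p in the basis of the fibre over y given by the eigenbasis h of g
   (the dual basis on Y^[2]_-). It turns the product and the action into
   multiplication of scalars and identity. *)
Definition kappa h d y (p : Lfib y) : C := kap (veps h (Nmin d y) (Nmax d y)) p.

Section Framed.
Variables (y : Y2 R n) (h : M) (d : 'rV[C]_n).
Hypothesis sd : sdiag (mx_of (g_of y)) h d.
Local Notation N1 := (NZ d (z1_of y)).
Local Notation N2 := (NZ d (z2_of y)).

Lemma frame_ofP : frame_of (sign_of y) (det_line y) (veps h (Nmin d y) (Nmax d y)).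
Proof.
have [uh _ _ _] := sd.
split; [exact: det_lineE | exact: veps_norm |].
rewrite (sign_ofE sd) /Nmin /Nmax; case: (ltngtP N1 N2) => // e _.
by rewrite ?e ?minnn ?maxnn veps_nil.
Qed.

Lemma veps_le : (N1 <= N2)%N -> veps h N1 N2 = veps h (Nmin d y) (Nmax d y).
Proof. by move=> le; rewrite /Nmin /Nmax (minn_idPl le) (maxn_idPr le). Qed.

Lemma veps_ge : (N2 <= N1)%N -> veps h N2 N1 = veps h (Nmin d y) (Nmax d y).
Proof. by move=> le; rewrite /Nmin /Nmax (minn_idPr le) (maxn_idPl le). Qed.

Lemma sign_le : (N1 <= N2)%N -> sign_of y <> Neg.
Proof. by move=> le; rewrite (sign_ofE sd); move: le; case: (ltngtP N1 N2). Qed.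

Lemma sign_ge : (N2 <= N1)%N -> sign_of y <> Pos.
Proof. by move=> le; rewrite (sign_ofE sd); move: le; case: (ltngtP N1 N2). Qed.

Lemma kappa_as_vec (p : Lfib y) : (N1 <= N2)%N -> as_vec p = kappa h d p *: veps h N1 N2.
Proof. by move=> le; rewrite (veps_le le); exact: kap_as_vec frame_ofP p (sign_le le). Qed.

Lemma kappa_as_fun (p : Lfib y) x : (N2 <= N1)%N ->
  as_fun p (x *: veps h N2 N1) = x * kappa h d p.
Proof. by move=> le; rewrite (veps_ge le); exact: kap_as_fun frame_ofP p x (sign_ge le). Qed.

Lemma kappa_of_vec x : (N1 <= N2)%N ->
  kappa h d (of_vec (sign_of y) (det_line y) (x *: veps h N1 N2) : Lfib y) = x.
Proof. by move=> le; rewrite (veps_le le); exact: kap_of_vec frame_ofP x (sign_le le). Qed.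

Lemma kappa_of_fun (f : ext -> C) : (N2 <= N1)%N ->
  (forall x, f (x *: veps h N2 N1) = x * f (veps h N2 N1)) ->
  kappa h d (of_fun (sign_of y) (det_line y) f : Lfib y) = f (veps h N2 N1).
Proof.
by move=> le; rewrite (veps_ge le) => H; exact: (kap_of_fun frame_ofP (sign_ge le) H).
Qed.

Lemma vpick_le : (N1 <= N2)%N -> exists2 a, a != 0 & vpick (det_line y) = a *: veps h N1 N2.
Proof. by move=> le; rewrite (veps_le le); exact: vpick_line frame_ofP. Qed.

Lemma vpick_ge : (N2 <= N1)%N -> exists2 a, a != 0 & vpick (det_line y) = a *: veps h N2 N1.
Proof. by move=> le; rewrite (veps_ge le); exact: vpick_line frame_ofP. Qed.

Lemma kappa_linear : linear (@kappa h d y).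
Proof. exact: kap_linear frame_ofP. Qed.

Lemma kappa_inj (p q : Lfib y) : kappa h d p = kappa h d q -> p = q.
Proof. exact: (kap_inj frame_ofP). Qed.

Lemma hdot_kappa (p q : Lfib y) :
  hdot (l := L R n) p q = kappa h d p * (kappa h d q)^*.
Proof. exact: (fibre_dot_kap frame_ofP). Qed.

End Framed.

Lemma composable_z a b c : composable a b c ->
  [/\ g_of b = g_of a, g_of c = g_of a & [/\ z2_of a = z1_of b, z1_of c = z1_of a & z2_of c = z2_of b]].
Proof.
move=> [e1 e2 e3]; rewrite /g_of /z1_of /z2_of e2 e3 -e1; split=> //.
exact: esym (svalP a).
Qed.

Lemma Zle_NZ A h d (z w : C) : sdiag A h d -> Zle z w -> (NZ d z <= NZ d w)%N.
Proof. by move=> sd [->//|]; exact: NZ_le sd. Qed.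

Lemma Zle_total (z w : C) : inZ z -> inZ w -> Zle z w \/ Zle w z.
Proof.
by move=> zZ wZ; have [->|l|l] := Zlt_total zZ wZ; [left; left|left; right|right; right].
Qed.

(* Abstracting the vectors chosen by [vpick] keeps unification from unfolding them. *)
Definition Lprod_with a b (p : Lfib a) (q : Lfib b) c (l12 l23 l13 : ext) : Lfib c :=
  let z1 := z1_of a in let z2 := z2_of a in let z3 := z2_of b in
  if `[< Zle z1 z2 /\ Zle z2 z3 >] then
    of_vec (sign_of c) (det_line c) (wedge (as_vec p) (as_vec q))
  else if `[< Zle z1 z3 /\ Zle z3 z2 >] then
    of_vec (sign_of c) (det_line c)
      ((quot (as_vec p) (wedge l13 l23) * as_fun q l23) *: l13)
  else if `[< Zle z2 z1 /\ Zle z1 z3 >] then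
    of_vec (sign_of c) (det_line c)
      ((quot (as_vec q) (wedge l12 l13) * as_fun p l12) *: l13)
  else if `[< Zle z2 z3 /\ Zle z3 z1 >] then
    of_fun (sign_of c) (det_line c) (fun y : ext => as_fun p (wedge (as_vec q) y))
  else if `[< Zle z3 z1 /\ Zle z1 z2 >] then
    of_fun (sign_of c) (det_line c) (fun x => as_fun q (wedge x (as_vec p)))
  else
    of_fun (sign_of c) (det_line c)
      (fun w => quot w (wedge l23 l12) * (as_fun q l23 * as_fun p l12)).

(** In each of the six orderings the defining duality reduces to [veps_wedge], and the scalars by
    which the auxiliary vectors differ from the [veps] cancel. Each such vector is described only
    for the ordering of its endpoints in which it is used, hence the conditional hypotheses. *)
Lemma kappa_Lprod_with a b c h d (p : Lfib a) (q : Lfib b) (l12 l23 l13 : ext) :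
  composable a b c -> sdiag (mx_of (g_of a)) h d ->
  let spans l N N' := exists2 x, x != 0 & l = x *: veps h N N' in
  ((NZ d (z2_of a) <= NZ d (z1_of a))%N -> spans l12 (NZ d (z2_of a)) (NZ d (z1_of a))) ->
  ((NZ d (z2_of b) <= NZ d (z1_of b))%N -> spans l23 (NZ d (z2_of b)) (NZ d (z1_of b))) ->
  ((NZ d (z1_of c) <= NZ d (z2_of c))%N -> spans l13 (NZ d (z1_of c)) (NZ d (z2_of c))) ->
  kappa h d (Lprod_with p q c l12 l23 l13) = kappa h d p * kappa h d q.
Proof.
move=> abc sa spans V21 V32 V13; have [gb gc [z2 z1' z3]] := composable_z abc.
have sb : sdiag (mx_of (g_of b)) h d by rewrite gb.
have sc : sdiag (mx_of (g_of c)) h d by rewrite gc.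
have [uh _ _ _] := sa.
have nz p' q' := veps_neq0 p' q' uh.
have NL (z w : C) : Zle z w -> (NZ d z <= NZ d w)%N := Zle_NZ sa.
rewrite /Lprod_with; case: ifPn => [/asboolP[/NL l1 /NL l2]|/asboolPn H1].
  have l2' : (NZ d (z1_of b) <= NZ d (z2_of b))%N by rewrite -z2.
  have l3 : (NZ d (z1_of c) <= NZ d (z2_of c))%N by rewrite z1' z3 (leq_trans l1).
  rewrite (kappa_as_vec sa p l1) (kappa_as_vec sb q l2') wedgeZl wedgeZr -z2 veps_wedge //.
  by rewrite (scalerA (kappa h d p)) -z1' -z3 kappa_of_vec.
case: ifPn => [/asboolP[/NL l1 /NL l2]|/asboolPn H2].
  have l2' : (NZ d (z2_of b) <= NZ d (z1_of b))%N by rewrite -z2.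
  have l3 : (NZ d (z1_of c) <= NZ d (z2_of c))%N by rewrite z1' z3.
  have k12 := leq_trans l1 l2.
  have [g g0 ->] := V13 l3; have [e e0 ->] := V32 l2'.
  rewrite (kappa_as_vec sa p k12) (kappa_as_fun sb q _ l2') wedgeZl wedgeZr.
  rewrite {1}z1' {1}z3 -{1}z2 veps_wedge // (scalerA g) quot_line // ?mulf_neq0 //.
  rewrite (scalerA _ g) kappa_of_vec //; by field; rewrite g0 e0.
case: ifPn => [/asboolP[/NL l1 /NL l2]|/asboolPn H3].
  have k23 := leq_trans l1 l2.
  have k23' : (NZ d (z1_of b) <= NZ d (z2_of b))%N by rewrite -z2.
  have l3 : (NZ d (z1_of c) <= NZ d (z2_of c))%N by rewrite z1' z3.
  have [g g0 ->] := V13 l3; have [e e0 ->] := V21 l1.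
  rewrite (kappa_as_vec sb q k23') (kappa_as_fun sa p _ l1) wedgeZl wedgeZr.
  rewrite {1}z1' {1}z3 -{1}z2 veps_wedge // (scalerA e) quot_line // ?mulf_neq0 //.
  rewrite (scalerA _ g) kappa_of_vec //; by field; rewrite g0 e0.
case: ifPn => [/asboolP[/NL l1 /NL l2]|/asboolPn H4].
  have l21 := leq_trans l1 l2.
  have k23' : (NZ d (z1_of b) <= NZ d (z2_of b))%N by rewrite -z2.
  have l3 : (NZ d (z2_of c) <= NZ d (z1_of c))%N by rewrite z1' z3.
  have E x : as_fun p (wedge (as_vec q) (x *: veps h (NZ d (z2_of c)) (NZ d (z1_of c)))) =
      x * (kappa h d p * kappa h d q).
    rewrite (kappa_as_vec sb q k23') wedgeZl wedgeZr z3 z1' -z2 veps_wedge //.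
    by rewrite (scalerA (kappa h d q)) (kappa_as_fun sa p _ l21); ring.
  have E1 := E 1; rewrite scale1r mul1r in E1.
  by rewrite (kappa_of_fun sc) // => x; rewrite E E1.
case: ifPn => [/asboolP[/NL l1 /NL l2]|/asboolPn H5].
  have l32 := leq_trans l1 l2.
  have l32' : (NZ d (z2_of b) <= NZ d (z1_of b))%N by rewrite -z2.
  have l3 : (NZ d (z2_of c) <= NZ d (z1_of c))%N by rewrite z1' z3.
  have E x : as_fun q (wedge (x *: veps h (NZ d (z2_of c)) (NZ d (z1_of c))) (as_vec p)) =
      x * (kappa h d p * kappa h d q).
    rewrite (kappa_as_vec sa p l2) wedgeZl wedgeZr z3 z1' veps_wedge // {1}z2.
    by rewrite (scalerA x) (kappa_as_fun sb q _ l32'); ring.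
  have E1 := E 1; rewrite scale1r mul1r in E1.
  by rewrite (kappa_of_fun sc) // => x; rewrite E E1.
(* By totality of the order, failure of the five tests leaves z3 <= z2 <= z1. *)
have [l1 l2] : Zle (z2_of b) (z2_of a) /\ Zle (z2_of a) (z1_of a).
  have z3Z := z2Z b; have z2Z' := z2Z a; have z1Z' := z1Z a.
  have [t12|t21] := Zle_total z1Z' z2Z'.
    have [t23|t32] := Zle_total z2Z' z3Z; first by case: H1.
    have [t13|t31] := Zle_total z1Z' z3Z; first by case: H2.
    by case: H5.
  have [t13|t31] := Zle_total z1Z' z3Z; first by case: H3.
  have [t23|t32] := Zle_total z2Z' z3Z; first by case: H4.
  by [].
move/NL: l1 => l1; move/NL: l2 => l2.
have l1' : (NZ d (z2_of b) <= NZ d (z1_of b))%N by rewrite -z2.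
have l3 : (NZ d (z2_of c) <= NZ d (z1_of c))%N by rewrite z1' z3 (leq_trans l1).
have [g g0 ->] := V32 l1'; have [e e0 ->] := V21 l2.
have E x : quot (x *: veps h (NZ d (z2_of c)) (NZ d (z1_of c)))
    (wedge (g *: veps h (NZ d (z2_of b)) (NZ d (z1_of b)))
           (e *: veps h (NZ d (z2_of a)) (NZ d (z1_of a)))) *
    (as_fun q (g *: veps h (NZ d (z2_of b)) (NZ d (z1_of b))) *
     as_fun p (e *: veps h (NZ d (z2_of a)) (NZ d (z1_of a)))) =
    x * (kappa h d p * kappa h d q).
  rewrite (kappa_as_fun sa p _ l2) (kappa_as_fun sb q _ l1') wedgeZl wedgeZr -{1}z2 veps_wedge //.
  rewrite z3 z1' (scalerA g) quot_line // ?mulf_neq0 //.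
  by field; rewrite g0 e0.
have E1 := E 1; rewrite scale1r mul1r in E1.
by rewrite (kappa_of_fun sc) // => x; rewrite E E1.
Qed.

Lemma kappa_Lprod a b c h d (p : Lfib a) (q : Lfib b) :
  composable a b c -> sdiag (mx_of (g_of a)) h d ->
  kappa h d (Lprod c p q) = kappa h d p * kappa h d q.
Proof.
move=> abc sa; have [gb gc _] := composable_z abc.
have sb : sdiag (mx_of (g_of b)) h d by rewrite gb.
have sc : sdiag (mx_of (g_of c)) h d by rewrite gc.
change (kappa h d (Lprod_with p q c (vpick (det_line a)) (vpick (det_line b)) (vpick (det_line c))) =
  kappa h d p * kappa h d q).
by apply: kappa_Lprod_with => //; [exact: vpick_ge sa|exact: vpick_ge sb|exact: vpick_le sc].
Qed.

End Kappa.

(** * The fibrewise axioms and the push-forward on fibres *)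

Section BundleAlgebra.
Variables (R : realType) (n : nat).
Local Notation C := R[i].
Local Notation M := 'M[C]_n.
Local Notation ext := (ext R n).
Local Notation L := (L R n).
Implicit Types (h : M) (d : 'rV[C]_n) (y a b c : Y2 R n) (k : Un R n).

Lemma Un_sdiag (g : Un R n) : exists h d, sdiag (mx_of g) h d.
Proof. exact: sdiag_exists (mx_of_unitary g). Qed.

Lemma L_dim y : \dim {: L y} = 1%N.
Proof. by have [h [d sd]] := Un_sdiag (g_of y); exact: fibre_dim (frame_ofP sd). Qed.

Lemma kappa0 y h d : sdiag (mx_of (g_of y)) h d -> kappa h d (0 : Lfib y) = 0.
Proof.
move=> sd; have := linear_scale 0 (0 : Lfib y) (kappa_linear sd); rewrite scale0r => ->.
exact: scale0r.
Qed.

Lemma L_hdot y :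
  [/\ forall v : L y, linear (fun u : L y => hdot u v : C^o),
      forall u v : L y, hdot v u = (hdot u v)^* &
      forall u : L y, u != 0 -> 0 < hdot u u].
Proof.
have [h [d sd]] := Un_sdiag (g_of y); have kl := kappa_linear sd.
split=> [v x u u'|u v|u u0]; rewrite !(hdot_kappa sd).
- by rewrite kl mulrDl /GRing.scale /= mulrA.
- by rewrite rmorphM /= conjCK mulrC.
- rewrite mul_conjC_gt0; apply: contraNneq u0 => k0.
  by apply/eqP; apply: (kappa_inj sd); rewrite k0 (kappa0 sd).
Qed.

Lemma Lprod_bilinear a b c : composable a b c ->
  [/\ forall p : L a, linear (fun q : L b => Lprod c p q),
      forall q : L b, linear (fun p : L a => Lprod c p q) &
      forall (p : L a) (q : L b),
        hdot (Lprod c p q : L c) (Lprod c p q : L c) = hdot p p * hdot q q].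
Proof.
move=> abc; have [h [d sa]] := Un_sdiag (g_of a).
have [gb gc _] := composable_z abc.
have sb : sdiag (mx_of (g_of b)) h d by rewrite gb.
have sc : sdiag (mx_of (g_of c)) h d by rewrite gc.
have K p q := kappa_Lprod p q abc sa.
split=> [p x q q'|q x p p'|p q].
- apply: (kappa_inj sc); rewrite (kappa_linear sc) !K (kappa_linear sb).
  by rewrite mulrDr /GRing.scale /= mulrCA.
- apply: (kappa_inj sc); rewrite (kappa_linear sc) !K (kappa_linear sa).
  by rewrite mulrDl /GRing.scale /= mulrA.
- rewrite (hdot_kappa sa) (hdot_kappa sb) (hdot_kappa sc) K rmorphM /=; ring.
Qed.

Lemma Lprod_assoc y12 y23 y34 y13 y24 y14 :
  composable y12 y23 y13 -> composable y23 y34 y24 ->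
  composable y13 y34 y14 -> composable y12 y24 y14 ->
  forall (p : Lfib y12) (q : Lfib y23) (r : Lfib y34),
    Lprod y14 (Lprod y13 p q) r = Lprod y14 p (Lprod y24 q r).
Proof.
move=> c1 c2 c3 c4 p q r; have [h [d s12]] := Un_sdiag (g_of y12).
have [g23 g13 _] := composable_z c1; have [_ g14 _] := composable_z c4.
have s23 : sdiag (mx_of (g_of y23)) h d by rewrite g23.
have s13 : sdiag (mx_of (g_of y13)) h d by rewrite g13.
have s14 : sdiag (mx_of (g_of y14)) h d by rewrite g14.
have e1 := kappa_Lprod (Lprod y13 p q) r c3 s13.
have e2 := kappa_Lprod p (Lprod y24 q r) c4 s12.
rewrite (kappa_Lprod p q c1 s12) in e1; rewrite (kappa_Lprod q r c2 s23) in e2.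
by apply: (kappa_inj s14); apply: (etrans e1); apply: etrans (esym e2); rewrite mulrA.
Qed.

(* A is applied to vectors; functionals are composed with B = A^-1. *)
Definition push_fibre s l s' l' (A B : M) (p : fibre s l) : @fibre R n s' l' :=
  match s with
  | Neg => of_fun s' l' (fun u : ext => as_fun p (ext_map B u))
  | _ => of_vec s' l' (ext_map A (as_vec p))
  end.

Lemma push_vec s l s' l' A B (p : fibre s l) : s <> Neg ->
  push_fibre s' l' A B p = of_vec s' l' (ext_map A (as_vec p)).
Proof. by case: s p. Qed.

Lemma push_fun s l s' l' A B (p : fibre s l) : s = Neg ->
  push_fibre s' l' A B p = of_fun s' l' (fun u : ext => as_fun p (ext_map B u)).
Proof. by case: s p. Qed.

Definition Lact y k y' (p : Lfib y) : Lfib y' :=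
  push_fibre (sign_of y') (det_line y') ((mx_of k)^t*) (mx_of k) p.

Local Notation moved := (@moved R (Un R n) (Un R n) (basic_gerbe R n) (@adjY R n)).

Lemma moved_z y k y' : moved y k y' ->
  [/\ z1_of y' = z1_of y, z2_of y' = z2_of y & g_of y' = adj (g_of y) k].
Proof. by move=> [e1 e2]; rewrite /z1_of /z2_of /g_of e1 e2. Qed.

Lemma moved_sdiag y k y' h d : moved y k y' -> sdiag (mx_of (g_of y)) h d ->
  sdiag (mx_of (g_of y')) ((mx_of k)^t* *m h) d.
Proof.
move=> /moved_z[_ _ ->] [uh E d1 sd]; split=> //.
  by apply: (mul_unitarymx _ uh); rewrite trmxC_unitary mx_of_unitary.
by rewrite mx_of_adj E /udiag trC_mul (trCK (mx_of k)) !mulmxA.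
Qed.

Lemma kappa_Lact y k y' h d (p : Lfib y) : moved y k y' ->
  sdiag (mx_of (g_of y)) h d ->
  kappa ((mx_of k)^t* *m h) d (Lact k y' p) = kappa h d p.
Proof.
move=> mv sd; have sd' := moved_sdiag mv sd; have [z1 z2 _] := moved_z mv.
have uk := mx_of_unitary k.
have veq N N' : veps ((mx_of k)^t* *m h) N N' = ext_map ((mx_of k)^t*) (veps h N N').
  by rewrite /veps ext_map_comp.
case: (leqP (NZ d (z1_of y)) (NZ d (z2_of y))) => [le|/ltnW le].
  have -> : Lact k y' p = of_vec (sign_of y') (det_line y') (ext_map ((mx_of k)^t*) (as_vec p)).
    exact: push_vec (sign_le sd le).
  have le' : (NZ d (z1_of y') <= NZ d (z2_of y'))%N by rewrite z1 z2.
  rewrite (kappa_as_vec sd p le) ext_mapZ -veq -[in X in veps _ X _]z1 -[in X in veps _ _ X]z2.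
  exact: kappa_of_vec sd' _ le'.
have le' : (NZ d (z2_of y') <= NZ d (z1_of y'))%N by rewrite z1 z2.
have H x : as_fun p (ext_map (mx_of k) (x *: veps ((mx_of k)^t* *m h) (NZ d (z2_of y')) (NZ d (z1_of y')))) = x * kappa h d p.
  rewrite z1 z2 veq ext_mapZ ext_map_comp (unitary_mulV uk) ext_map_id.
  exact: kappa_as_fun sd p x le.
have H1 := H 1; rewrite scale1r mul1r in H1.
have E : kappa ((mx_of k)^t* *m h) d (of_fun (sign_of y') (det_line y')
    (fun u : ext => as_fun p (ext_map (mx_of k) u)) : Lfib y') = kappa h d p.
  by rewrite (kappa_of_fun sd' le') // => x; rewrite H H1.
(* [ltnW] has weakened the inequality. Under equality the fibre is C and [push_fibre] acts through
   vectors; the computation E applies to functionals. *)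
case: (eqVneq (NZ d (z1_of y)) (NZ d (z2_of y))) => [e|ne].
  have le2 : (NZ d (z1_of y) <= NZ d (z2_of y))%N by rewrite e.
  have -> : Lact k y' p = of_vec (sign_of y') (det_line y') (ext_map ((mx_of k)^t*) (as_vec p)).
    exact: push_vec (sign_le sd le2).
  have le2' : (NZ d (z1_of y') <= NZ d (z2_of y'))%N by rewrite z1 z2.
  rewrite (kappa_as_vec sd p le2) ext_mapZ -veq -[in X in veps _ X _]z1 -[in X in veps _ _ X]z2.
  exact: kappa_of_vec sd' _ le2'.
have sN : sign_of y = Neg.
  by rewrite (sign_ofE sd) [(_ < _)%N]ltnNge le /= ltn_neqAle eq_sym ne le.
by rewrite -E /Lact push_fun.
Qed.

End BundleAlgebra.

(** * Spectral projectors and local sections *)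

Section Projector.
Variables (R : realType) (n : nat).
Local Notation C := R[i].
Local Notation M := 'M[C]_n.
Implicit Types (h : M) (d : 'rV[C]_n).

(** Expresses z < w as an inequality on a polynomial in the real coordinates, which makes the domain
    [dom3] open. *)
Lemma Zlt_farc (z w : C) : inZ z -> inZ w -> Zlt z w <-> farc z w 1 < 0.
Proof.
move=> zZ wZ; split; first exact: farc1_lt0.
have [z1 zn] := zZ; have [w1 wn] := wZ.
rewrite -{1}(tauK z1 zn) -{1}(tauK w1 wn) farc_zof1 oppr_lt0 => H; apply/Zlt_tau; split=> //.
have D0 : 0 < ((tau z ^+ 2 + 1) * (tau w ^+ 2 + 1))^-1 by rewrite invr_gt0 mulr_gt0 ?sqrD1_gt0.
by move: H; rewrite (pmulr_lgt0 _ D0) pmulr_rgt0 // subr_gt0.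
Qed.

(** z, w and g are independent parameters, so that one projector serves the pairs (z1, z2) and (z2,
    z1) as well as pairs with an auxiliary point of Z. *)
Definition T3 : space R := prod_space (prod_space (Zspace R) (Zspace R)) (Un R n).
Implicit Types p : T3.
Definition t3z p : C := sval p.1.1.
Definition t3w p : C := sval p.1.2.
Definition t3g p : M := mx_of p.2.

Lemma smooth_t3g : smooth (t3g : T3 -> mx_space R n n).
Proof.
by apply: (@smooth_on_comp _ T3 (Un R n) (mx_space R n n) _ setT (fun p => p.2) sval) => //;
  [exact: smooth_on_snd | exact: smooth_on_val].
Qed.

Lemma csm_t3z : csm setT t3z.
Proof.
apply: (@smooth_on_comp _ T3 (Zspace R) (complex_space R) _ setT (fun p => p.1.1) sval) => //.
  by apply: (@smooth_on_comp _ T3 (prod_space (Zspace R) (Zspace R)) (Zspace R) _ setT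
    (fun p => p.1) (fun q => q.1)) => //; exact: smooth_on_fst.
exact: smooth_on_val.
Qed.

Lemma csm_t3w : csm setT t3w.
Proof.
apply: (@smooth_on_comp _ T3 (Zspace R) (complex_space R) _ setT (fun p => p.1.2) sval) => //.
  apply: (@smooth_on_comp _ T3 (prod_space (Zspace R) (Zspace R)) (Zspace R) _ setT
    (fun p => p.1) (fun q => q.2)) => //; [exact: smooth_on_fst | exact: smooth_on_snd].
exact: smooth_on_val.
Qed.

Lemma t3zZ p : inZ (t3z p). Proof. by case: (svalP p.1.1). Qed.
Lemma t3wZ p : inZ (t3w p). Proof. by case: (svalP p.1.2). Qed.

Definition dom3 : set T3 :=
  [set p | [/\ Zlt (t3z p) (t3w p), ~ eigval (t3g p) (t3z p) & ~ eigval (t3g p) (t3w p)]].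

Lemma msc_scalar (T : Type) (N : set T) (S : @smooth_class R T N) (f : T -> C) :
  csc S f -> msc S (fun x => (f x)%:M : M).
Proof.
move=> sf i j; apply: csc_ext (cscM sf (csc_cst S ((i == j)%:R))) => x.
by rewrite mxE mulr_natr.
Qed.

Lemma ReNiM (c : C) : complex.Re (- (- 'i%C * c)) = - complex.Im c.
Proof. by case: c => a b /=; ring. Qed.

Lemma opn_dom3 : opn dom3.
Proof.
(* Its real part is - farc z w 1: the factor -i moves the imaginary part to the real one, which is
   what [opn_csm_pos] tests. *)
pose f1 p : C := - (- 'i%C * ((t3w p - t3z p) * (1 - t3z p)^*)).
pose f2 p : C := \det (t3g p - (t3z p)%:M).
pose f3 p : C := \det (t3g p - (t3w p)%:M).
have sz p Tp := (csmP _ _).1 csm_t3z p Tp; have sw p Tp := (csmP _ _).1 csm_t3w p Tp.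
have sg p Tp := (smooth_on_mxP _ _).1 smooth_t3g p Tp.
have s1 : csm setT f1.
  apply/csmP => p Tp; apply: cscN; apply: cscM; first exact: csc_cst.
  apply: cscM; first by apply: cscD => //; apply: cscN.
  by apply: csc_conj; apply: cscD; [exact: csc_cst | apply: cscN].
have s2 : csm setT f2.
  by apply/csmP => p Tp; apply: csc_det; apply: mscB => //; apply: msc_scalar.
have s3 : csm setT f3.
  by apply/csmP => p Tp; apply: csc_det; apply: mscB => //; apply: msc_scalar.
have o1 := opn_csm_pos (@opnT _ _) s1.
have := opnI o1 (opnI (opn_csm (@opnT _ _) s2) (opn_csm (@opnT _ _) s3)).
congr opn; apply/seteqP; split=> p /=.
  rewrite /f1 /f2 /f3 => -[[_ H1] [[_ /eqP H2] [_ /eqP H3]]]; split.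
  - apply/Zlt_farc; [exact: t3zZ | exact: t3wZ|].
    by move: H1; rewrite ReNiM oppr_gt0.
  - by rewrite eigvalP.
  - by rewrite eigvalP.
move=> [l /eigvalP/eqP n1 /eigvalP/eqP n2]; split; last by [].
by split=> //; rewrite /f1 ReNiM oppr_gt0; exact: farc1_lt0.
Qed.

(* Its Hermitian part is the function [farc z w] of g, which is positive on the eigenvalues
   between z and w and negative on the others; so Pm p is the projector onto
   the sum of the eigenspaces between z and w. *)
Definition arc_mx p : M := (- 'i%C * (t3w p - t3z p)) *: (t3g p - (t3z p)%:M)^t*.

Definition Pm p : M := half_mx R n *m (1%:M + sgn_mx (arc_mx p)).

Lemma dom3_eig p h d i : dom3 p -> sdiag (t3g p) h d -> d 0 i <> t3z p /\ d 0 i <> t3w p.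
Proof.
move=> [_ n1 n2] [uh E _ _].
by split=> e; [apply: n1|apply: n2]; rewrite E eigval_udiag //; exists i.
Qed.

Lemma hpart_arc_mx p h d : sdiag (t3g p) h d ->
  hpart (arc_mx p) = udiag h (\row_i (farc (t3z p) (t3w p) (d 0 i))%:C%C).
Proof.
move=> [uh E _ _].
have E1 : t3g p - (t3z p)%:M = udiag h (\row_i (d 0 i - t3z p)).
  have -> : (t3z p)%:M = udiag h (const_mx (t3z p)).
    have -> : const_mx (t3z p) = t3z p *: (const_mx 1 : 'rV[C]_n).
      by apply/rowP => i; rewrite !mxE mulr1.
    by rewrite -udiagZ (udiag1 uh) scalemx1.
  rewrite E -scaleN1r udiagZ udiagD; congr udiag.
  by apply/rowP => i; rewrite !mxE mulN1r.
rewrite /hpart /arc_mx E1 udiag_trC udiagZ udiag_trC udiagD /half_mx mul_scalar_mx udiagZ.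
congr udiag; apply/rowP => i; rewrite !mxE /farc.
set c := t3w p - t3z p; set e := (d 0 i - t3z p)^*.
case: c => a b; case: e => a' b'; simpc.
by rewrite /=; congr (_ +i* _)%C; field.
Qed.

Lemma arc_mx_det p : dom3 p -> \det (hpart (arc_mx p)) != 0.
Proof.
move=> Dp; have [h [d sd]] := Un_sdiag p.2; have sd' : sdiag (t3g p) h d := sd.
have [uh E d1 _] := sd'.
rewrite (hpart_arc_mx sd') udiag_det //; apply/prodf_neq0 => i _; rewrite mxE.
have [n1 n2] := dom3_eig i Dp sd'; have [l _ _] := Dp.
apply/eqP => e; have {e} : farc (t3z p) (t3w p) (d 0 i) = 0 by case: e.
by move=> /(farc_eq0 l (d1 i)) [].
Qed.

Lemma Pm_udiag p h d : dom3 p -> sdiag (t3g p) h d ->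
  Pm p = udiag h (\row_i (i \in itv n (NZ d (t3z p)) (NZ d (t3w p)))%:R).
Proof.
move=> Dp sd; have [uh E d1 _] := sd; have [l nz nw] := Dp.
have f0 i : farc (t3z p) (t3w p) (d 0 i) != 0.
  by have [n1 n2] := dom3_eig i Dp sd; apply/eqP => /(farc_eq0 l (d1 i)) [].
have Es : sgn_mx (arc_mx p) = udiag h (\row_i ((farc (t3z p) (t3w p) (d 0 i))%:C%C /
    `|(farc (t3z p) (t3w p) (d 0 i))%:C%C|)).
  have sq : is_sgn (hpart (arc_mx p)) (udiag h (\row_i ((farc (t3z p) (t3w p) (d 0 i))%:C%C /
      `|(farc (t3z p) (t3w p) (d 0 i))%:C%C|))).
    rewrite (hpart_arc_mx sd).
    have := @is_sgn_udiag _ _ h (\row_i (farc (t3z p) (t3w p) (d 0 i))%:C%C) uh.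
    have -> : (\row_i ((\row_i (farc (t3z p) (t3w p) (d 0 i))%:C%C) 0 i /
        `|(\row_i (farc (t3z p) (t3w p) (d 0 i))%:C%C) 0 i|)) =
      (\row_i ((farc (t3z p) (t3w p) (d 0 i))%:C%C / `|(farc (t3z p) (t3w p) (d 0 i))%:C%C|)) :> 'rV[C]_n.
      by apply/rowP => i; rewrite !mxE.
    apply=> i; rewrite mxE; first by rewrite complex_real eqxx.
    by apply/eqP => -[/eqP]; rewrite (negbTE (f0 i)).
  exact: sgn_unique (sgn_mxP (arc_mx_det Dp)) sq.
rewrite /Pm Es -(udiag1 uh) udiagD /half_mx mul_scalar_mx udiagZ; congr udiag.
apply/rowP => i; rewrite !mxE.
have -> : (i \in itv n (NZ d (t3z p)) (NZ d (t3w p))) = (0 < farc (t3z p) (t3w p) (d 0 i)).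
  rewrite inE (NZP _ _ sd) leqNgt (NZP _ _ sd).
  have dP := ltZP (t3zZ p) (d1 i); have dP2 := ltZP (t3wZ p) (d1 i).
  have [n1 n2] := dom3_eig i Dp sd.
  apply/andP/idP => [[/negP H1 /dP2 H2]|H].
    have dn1 : d 0 i <> 1 by move=> e; apply: H1; apply/dP; left.
    have dZ : inZ (d 0 i) by [].
    apply/(farc_gt0 l dZ); split; last by case: H2.
    have [e|//|l'] := Zlt_total (t3zZ p) dZ; first by case: n1.
    by case: H1; apply/dP; right.
  have dn1 : d 0 i <> 1.
    by move=> e; move: H; rewrite e ltNge (ltW (farc1_lt0 l)).
  have [l1 l2] := (farc_gt0 l (conj (d1 i) dn1)).1 H.
  split; last by apply/dP2; right.
  by apply/negP => /dP[//|/(Zlt_asym l1)].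
have := f0 i; set f := farc _ _ _ => fi.
have nf : `|f%:C%C| = `|f|%:C%C by rewrite normc_def /= expr0n addr0 sqrtr_sqr.
have fc : f%:C%C != 0 :> C by apply/eqP => -[/eqP]; rewrite (negbTE fi).
rewrite nf; case: (ltgtP 0 f) => [fp|fn|e]; last by rewrite -e eqxx in fi.
  by rewrite gtr0_norm // divff //= mulrDr mulr1; field.
rewrite ltr0_norm // rmorphN /= invrN mulrN divff //.
by rewrite subrr mulr0.
Qed.

Lemma smooth_Pm : smooth_on dom3 (Pm : T3 -> mx_space R n n).
Proof.
have sA : smooth_on dom3 (arc_mx : T3 -> mx_space R n n).
  apply/smooth_on_mxP => p Dp.
  have sz : csc (rsm_class Dp) t3z by exact: (csmP _ _).1 (smooth_on_sub (U := setT) (fun _ _ => I) csm_t3z) p Dp.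
  have sw : csc (rsm_class Dp) t3w by exact: (csmP _ _).1 (smooth_on_sub (U := setT) (fun _ _ => I) csm_t3w) p Dp.
  have sg : msc (rsm_class Dp) t3g by exact: (smooth_on_mxP _ _).1 (smooth_on_sub (U := setT) (fun _ _ => I) smooth_t3g) p Dp.
  apply: mscZ; first by apply: cscM; [exact: csc_cst | apply: cscD => //; apply: cscN].
  by apply: msc_trC; apply: mscB => //; apply: msc_scalar.
have := smooth_on_comp (f := arc_mx : T3 -> mx_space R n n) arc_mx_det sA (@smooth_sgn R n).
move=> /smooth_on_mxP sQ; apply/smooth_on_mxP => p Dp.
apply: msc_mul; first exact: msc_cst.
by apply: mscD; [exact: msc_cst | exact: sQ].
Qed.

Lemma card_itv_sum a b : (b <= n)%N -> (\sum_(i < n) (i \in itv n a b))%N = (b - a)%N.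
Proof.
move=> bn; have E k : (k <= n)%N -> (\sum_(i < n) ((i < k)%N : nat))%N = k.
  by move=> kn; rewrite -[RHS](card_ord_lt kn) -sum1_card [RHS]big_mkcond.
have [ba|/ltnW ab] := leqP b a.
  rewrite (eqP (_ : (b - a == 0)%N)) ?subn_eq0 // big1 // => i _.
  by rewrite inE; case: (leqP a i) => //= ai; rewrite ltnNge (leq_trans ba ai).
rewrite -{2}(E b bn) -{2}(E a (leq_trans ab bn)) -sumnB => [|i _].
  by apply: eq_bigr => i _; rewrite inE; case: (leqP a i) => ai; case: (leqP b i) => bi.
by case: (ltnP i a) => // ia; rewrite (leq_trans ia ab).
Qed.

Lemma tr_Pm p h d : dom3 p -> sdiag (t3g p) h d ->
  \tr (Pm p) = (NZ d (t3w p) - NZ d (t3z p))%:R.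
Proof.
move=> Dp sd; have [uh _ _ _] := sd; rewrite (Pm_udiag Dp sd) udiag_tr //.
have -> : \sum_i (\row_i (i \in itv n (NZ d (t3z p)) (NZ d (t3w p)))%:R : 'rV[C]_n) 0 i =
    (\sum_(i < n) (i \in itv n (NZ d (t3z p)) (NZ d (t3w p))))%:R.
  by rewrite natr_sum; apply: eq_bigr => i _; rewrite mxE.
by congr (_%:R); apply: card_itv_sum; apply: leq_trans (max_card _) _; rewrite card_ord.
Qed.

(** Natural numbers at distance less than 1 are equal. The hypothesis is written as positivity of a
    real part, an open condition. *)
Lemma natC_close (a b : nat) :
  0 < complex.Re (1 - (a%:R - b%:R : C) * (a%:R - b%:R)^*) -> a = b.
Proof.
have E c : (c%:R : C) = (c%:R)%:C%C by rewrite rmorph_nat.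
rewrite !E; set u : R := a%:R; set v : R := b%:R.
have -> : complex.Re (1 - (u%:C%C - v%:C%C : C) * (u%:C%C - v%:C%C)^*) = 1 - (u - v) ^+ 2.
  by rewrite /=; ring.
move=> H; have [//|ab] := eqVneq a b; exfalso.
wlog lt : a b @u @v H ab / (b < a)%N.
  move=> W; case: (ltngtP a b) (ab) => // l _; last by apply: (W a b) => //.
  by apply: (W b a) => //; [rewrite -sqrrN opprB | rewrite eq_sym].
have : 1 <= u - v by rewrite /u /v -natrB ?(ltnW lt) // -[1]/(1%:R) ler_nat subn_gt0.
by nra.
Qed.

(** The trace counts the eigenvalues between z and w. It is smooth with natural values, so it is
    constant where it differs from its value at p0 by less than 1. *)
Lemma tr_Pm_locally_cst p0 : dom3 p0 -> exists V, [/\ opn V, V p0 &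
  forall p, V p -> dom3 p /\ \tr (Pm p) = \tr (Pm p0)].
Proof.
move=> D0; pose F (s t : C) : C := 1 - (s - t) * (s - t)^*; pose f p : C := F (\tr (Pm p)) (\tr (Pm p0)).
have sf : csm dom3 f.
  apply/csmP => p Dp; have st : csc (rsm_class Dp) (fun p => \tr (Pm p) - \tr (Pm p0)).
    apply: cscD; last exact: csc_cst.
    by apply: csc_tr; exact: (smooth_on_mxP _ _).1 smooth_Pm p Dp.
  by apply: cscD; [exact: csc_cst | apply: cscN; apply: cscM => //; apply: csc_conj].
exists [set p | dom3 p /\ 0 < complex.Re (f p)]; split.
- exact: opn_csm_pos opn_dom3 sf.
- by split; [exact: D0 | rewrite /f /F subrr mul0r subr0 ltr01].
move=> p [Dp fp]; split; first exact: Dp.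
have [h [d sd]] := Un_sdiag p.2; have [h0 [d0 sd0]] := Un_sdiag p0.2.
have t1 := tr_Pm Dp sd; have t2 := tr_Pm D0 sd0.
have {}fp := eq_ind _ (fun c : C => 0 < complex.Re c) fp _ (congr2 F t1 t2).
apply: (etrans t1); apply: etrans (esym t2); move: fp; rewrite /F {F f sf}.
by move=> /natC_close ->.
Qed.

End Projector.

(** * Smooth maps into the exterior algebra *)

Section ExteriorSmooth.
Import mathcomp.boot.finset.
Variables (R : realType) (n : nat) (T : Type) (N : set T) (S : @smooth_class R T N).
Local Notation C := R[i].
Local Notation ext := (ext R n).
Implicit Types (u v : T -> ext) (A : T -> 'M[C]_n).

Definition esc u := forall I : {set 'I_n}, csc S (fun x => u x I).

Lemma esc_cst (u : ext) : esc (fun=> u).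
Proof. by move=> I; exact: csc_cst. Qed.

Lemma esc_wedge u v : esc u -> esc v -> esc (fun x => wedge (u x) (v x)).
Proof.
move=> su sv I.
apply: csc_ext (csc_sum (index_enum _) (P := fun J : {set 'I_n} => J \subset I)
  (F := fun J x => (-1) ^+ inversions J (I :\: J) * (u x J * v x (I :\: J))) _) => [x|J _].
  by rewrite ffunE.
by apply: cscM; [exact: csc_cst | apply: cscM].
Qed.

Lemma csc_ext_dot u v : esc u -> esc v -> csc S (fun x => ext_dot (u x) (v x)).
Proof. by move=> su sv; apply: csc_sum => I _; apply: cscM => //; apply: csc_conj. Qed.

Lemma esc_vec (v : T -> 'cV[C]_n) : msc S v -> esc (fun x => ext_vec (v x)).
Proof.
move=> sv I; apply: csc_ext (csc_sum (index_enum _) (P := fun i => I == [set i]%SET)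
  (F := fun i x => v x i 0) _) => [x|i _]; last exact: sv.
by rewrite ffunE.
Qed.

Lemma esc_map A u : msc S A -> esc u -> esc (fun x => ext_map (A x) (u x)).
Proof.
move=> sA su I.
have sP J : esc (fun x => Phi (fun i => ext_vec (col i (A x))) J).
  rewrite /Phi; elim: (enum J) => [|i s IH] K.
    by apply: csc_ext (csc_cst S (ext1 R n K)) => x; rewrite big_nil.
  have : csc S (fun x => wedge (ext_vec (col i (A x)))
      (\big[@wedge R n/ext1 R n]_(j <- s) ext_vec (col j (A x))) K).
    apply: esc_wedge => //; apply: esc_vec => a b.
    by apply: csc_ext (sA a i) => x; rewrite mxE.
  by apply: csc_ext => x; rewrite big_cons.
apply: csc_ext (csc_sum (index_enum _) (P := predT)
  (F := fun J x => u x J * Phi (fun i => ext_vec (col i (A x))) J I) _) => [x|J _].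
  by rewrite /ext_map sum_ffunE; apply: eq_bigr => J _; rewrite !ffunE.
by apply: cscM => //; apply: sP.
Qed.

End ExteriorSmooth.

(** * Smooth local sections of the determinant lines *)

Section LocalSections.
Import mathcomp.boot.finset.
Variables (R : realType) (n : nat).
Local Notation C := R[i].
Local Notation M := 'M[C]_n.
Local Notation ext := (ext R n).
Local Notation extS := (ffun_space R {set 'I_n}).
Implicit Types (h : M) (d : 'rV[C]_n) (y : Y2 R n).

Lemma smooth_on_extP (X : space R) (U : set X) (u : X -> extS) :
  smooth_on U u <-> forall x (Ux : U x), esc (rsm_class Ux) (u : X -> ext).
Proof.
split=> [/smooth_on_ffunP su x Ux I|su]; first exact: (csmP _ _).1 (su I) x Ux.
by apply/smooth_on_ffunP => I; apply/csmP => x Ux; apply: su.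
Qed.

Lemma card_itv a b : (b <= n)%N -> #|itv n a b| = (b - a)%N.
Proof. by move=> bn; rewrite -(card_itv_sum a bn) -sum1_card [LHS]big_mkcond. Qed.

Lemma NZ_n d z : (NZ d z <= n)%N.
Proof. by apply: leq_trans (max_card _) _; rewrite card_ord. Qed.

(** The section is the push-forward by the projector [Pm p] of the fixed vector belonging to p0. The
    equality of ranks is recorded because it controls the type of the fibre near p0. *)
Lemma spectral_section (p0 : T3 R n) h0 d0 : dom3 p0 -> sdiag (t3g p0) h0 d0 ->
  exists V (u : T3 R n -> extS), [/\ opn V, V p0, smooth_on V u &
    forall p h d, V p -> sdiag (t3g p) h d ->
      [/\ (u p : ext) != 0, (u p : ext) \in <[veps h (NZ d (t3z p)) (NZ d (t3w p))]>%VS &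
          (NZ d (t3w p) - NZ d (t3z p) = NZ d0 (t3w p0) - NZ d0 (t3z p0))%N]].
Proof.
move=> D0 sd0; have [uh0 E0 _ _] := sd0.
set a := NZ d0 (t3z p0); set b := NZ d0 (t3w p0).
have [V [oV V0 HV]] := tr_Pm_locally_cst D0.
pose u (p : T3 R n) : extS := ext_map (Pm p) (veps h0 a b).
have su : smooth_on V u.
  apply/smooth_on_extP => p Vp; apply: esc_map; last exact: esc_cst.
  exact: (smooth_on_mxP _ _).1 (smooth_on_sub (fun p Vp => (HV p Vp).1) (@smooth_Pm R n)) p Vp.
exists (V `&` [set p | V p /\ ext_dot (u p : ext) (u p) != 0]), u; split.
- apply: opnI => //; apply: opn_csm => //; apply/csmP => p Vp.
  by apply: csc_ext_dot; exact: (smooth_on_extP _ _).1 su p Vp.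
- split; first exact: V0.
  split; first exact: V0.
  rewrite /u (Pm_udiag D0 sd0) -/a -/b.
  (* At p0 the projector fixes the columns involved, so u takes a unit value there and is nonzero on
     a neighbourhood. *)
  have -> : ext_map (udiag h0 (\row_i (i \in itv n a b)%:R)) (veps h0 a b) = veps h0 a b.
    rewrite /veps ext_map_comp !ext_map_ebE; congr wedges; apply/eq_in_map => i.
    rewrite mem_enum => iS; apply/colP => j.
    rewrite /udiag -!mulmxA (unitary_Vmul uh0) mulmx1 mul_mx_diag !mxE iS.
    exact: mulr1.
  by rewrite (veps_norm a b uh0) oner_neq0.
- by apply: smooth_on_sub su => p [].
move=> p h d [Vp [_ up]] sd; have [Dp trE] := HV p Vp; have [uh _ _ _] := sd.
have cE : (NZ d (t3w p) - NZ d (t3z p) = b - a)%N.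
  have /eqP := etrans (esym (tr_Pm Dp sd)) (etrans trE (tr_Pm D0 sd0)).
  by rewrite eqr_nat => /eqP.
split; [|clear trE up| exact: cE].
  by apply/eqP => u0; move/eqP: up; apply; rewrite u0; exact: ext_dot0l.
(* u p is the wedge of b - a vectors lying in the image of the projector, whose dimension is also b
   - a; hence it is in the top power. *)
rewrite /u /veps ext_map_comp ext_map_ebE; apply: (wedges_line uh).
  by rewrite size_map -cardE !card_itv ?NZ_n // -cE.
move=> x /mapP[i _ ->] j jS.
rewrite colE (Pm_udiag Dp sd) /udiag -!mulmxA (mulmxA (h^t*)) (unitary_Vmul uh) mul1mx.
by rewrite mul_diag_mx !mxE (negbTE jS) mul0r.
Qed.

Lemma smooth_Y2_1 : smooth (fun y : Y2 R n => (sval y).1 : Yspace R n).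
Proof.
exact: (@smooth_on_comp _ (Y2 R n) (prod_space (Yspace R n) (Yspace R n)) (Yspace R n)
  classical_sets.setT classical_sets.setT (fun y => sval y) (fun q => q.1) (fun _ _ => I)
  (@smooth_on_val _ _ _ _) (@smooth_on_fst _ _ _ _)).
Qed.

Lemma smooth_Y2_2 : smooth (fun y : Y2 R n => (sval y).2 : Yspace R n).
Proof.
exact: (@smooth_on_comp _ (Y2 R n) (prod_space (Yspace R n) (Yspace R n)) (Yspace R n)
  classical_sets.setT classical_sets.setT (fun y => sval y) (fun q => q.2) (fun _ _ => I)
  (@smooth_on_val _ _ _ _) (@smooth_on_snd _ _ _ _)).
Qed.

Lemma smooth_on_Z (X : space R) (U : set X) (f : X -> Yspace R n) :
  smooth_on U f -> smooth_on U (fun x => (sval (f x)).1 : Zspace R).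
Proof.
move=> sf; have sv : smooth_on U (fun x => sval (f x) : prod_space (Zspace R) (Un R n)).
  exact: (@smooth_on_comp _ X (Yspace R n) (prod_space (Zspace R) (Un R n))
    U classical_sets.setT f (fun q => sval q) (fun _ _ => I) sf (@smooth_on_val _ _ _ _)).
exact: (@smooth_on_comp _ X (prod_space (Zspace R) (Un R n)) (Zspace R)
  U classical_sets.setT (fun x => sval (f x)) (fun q => q.1) (fun _ _ => I) sv (@smooth_on_fst _ _ _ _)).
Qed.

Lemma smooth_Y2z1 : smooth (fun y : Y2 R n => (sval (sval y).1).1 : Zspace R).
Proof. exact: smooth_on_Z smooth_Y2_1. Qed.

Lemma smooth_Y2z2 : smooth (fun y : Y2 R n => (sval (sval y).2).1 : Zspace R).
Proof. exact: smooth_on_Z smooth_Y2_2. Qed.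

Lemma smooth_Y2g : smooth (fun y : Y2 R n => g_of y : Un R n).
Proof.
exact: (@smooth_on_comp _ (Y2 R n) (Yspace R n) (Un R n) classical_sets.setT classical_sets.setT
  (fun y => (sval y).1) (@Ypi R n) (fun _ _ => I) smooth_Y2_1 (@smooth_Ypi R n)).
Qed.

Definition to3 (f1 f2 : Y2 R n -> Zspace R) y : T3 R n := ((f1 y, f2 y), g_of y).

Lemma smooth_to3 f1 f2 : smooth f1 -> smooth f2 -> smooth (to3 f1 f2).
Proof.
move=> s1 s2; apply: smooth_on_pair; last exact: smooth_Y2g.
exact: smooth_on_pair.
Qed.

(** Provides the point of comparison for z1 = z2; the linear factor in p excludes z. *)
Lemma third_point (g : Un R n) (z : C) : exists w : Zspace R,
  ~ eigval (mx_of g) (sval w) /\ sval w <> z.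
Proof.
pose p := char_poly (mx_of g) * ('X - z%:P).
have p0 : p != 0 by rewrite mulf_neq0 ?polyXsubC_eq0 // monic_neq0 // char_poly_monic.
have [t /negP ht] : exists t : R, ~ root p (zof t).
  apply: contrapT => /forallNP H.
  pose s := [seq zof (i%:R : R) | i <- iota 0 (size p)].
  have rs : all (root p) s by apply/allP => x /mapP[i _ ->]; exact: contrapT (H _).
  have us : uniq s.
    by rewrite map_inj_uniq ?iota_uniq // => i j /zof_inj /eqP; rewrite eqr_nat => /eqP.
  by have := max_poly_roots p0 rs us; rewrite size_map size_iota ltnn.
exists (Zpt t); split; first by move=> /eigval_root H; apply/negP: ht; rewrite /p rootM H.
by move=> /= e; case/negP: ht; rewrite /p rootM e root_XsubC eqxx orbT.
Qed.

(** For z1 != z2 the section comes from [spectral_section], which also covers the case of no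
    eigenvalue in between. The fibre type is constant because the eigenvalue count is. *)
Lemma local_section y0 : exists V (u : Y2 R n -> extS), [/\ opn V, V y0, smooth_on V u &
  forall y, V y -> [/\ (u y : ext) != 0, (u y : ext) \in det_line y & sign_of y = sign_of y0]].
Proof.
have [h0 [d0 sd0]] := Un_sdiag (g_of y0).
pose f1 y : Zspace R := (sval (sval y).1).1; pose f2 y : Zspace R := (sval (sval y).2).1.
have [e|l|l] := Zlt_total (z1Z y0) (z2Z y0); last 1 first.
- have D0 : dom3 (to3 f2 f1 y0) by split; [exact: l | exact: z2_neig | exact: z1_neig].
  have [V [u [oV V0 su Hu]]] := spectral_section D0 sd0.
  have sq := smooth_to3 smooth_Y2z2 smooth_Y2z1.
  have oD := opn_preimage sq (@opn_dom3 R n).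
  exists ([set y | V (to3 f2 f1 y)] `&` [set y | dom3 (to3 f2 f1 y)]), (fun y => u (to3 f2 f1 y)); split.
  + exact: opnI (opn_preimage sq oV) oD.
  + by [].
  + by apply: smooth_on_comp su => [y []//|]; exact: smooth_on_sub sq.
  move=> y [Vy [l' _ _]]; have [h [d sd]] := Un_sdiag (g_of y).
  have [u0 ul c] := Hu _ h d Vy sd.
  have le := NZ_le sd l'; have le0 := NZ_le sd0 l.
  split=> //; first by rewrite (det_lineE sd) (minn_idPr le) (maxn_idPl le).
  rewrite (sign_ofE sd) (sign_ofE sd0) !(ltnNge (NZ _ (z1_of _))) le le0 /=.
  by rewrite -subn_gt0 -[in RHS]subn_gt0; move: c; rewrite /= => ->.
(* Here z1 = z2, so [dom3] contains neither ordering. For a fixed w, the numbers of eigenvalues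
   between z1 and w and between z2 and w are locally constant and agree at y0. Hence no eigenvalue
   separates z1 from z2 nearby, and [ext1] is a section. *)
- have wP := third_point (g_of y0) (z1_of y0); have [w [nw wz]] := wP.
  have wZ : inZ (sval w) by case: (svalP w).
  pose k (y : Y2 R n) := w; have sk : smooth k by exact: smooth_on_cst.
  (* q1 and q2 join w to z1 and to z2; the argument is shared by the cases z1 < w and w < z1, which
     differ only in how the counts yield H. *)
  have key q1 q2 : dom3 (q1 y0) -> dom3 (q2 y0) -> smooth q1 -> smooth q2 ->
    (forall y, t3g (q1 y) = mx_of (g_of y)) -> (forall y, t3g (q2 y) = mx_of (g_of y)) ->
    (forall y h d, dom3 (q1 y) -> dom3 (q2 y) -> sdiag (mx_of (g_of y)) h d ->
      (NZ d (t3w (q1 y)) - NZ d (t3z (q1 y)) = NZ d0 (t3w (q1 y0)) - NZ d0 (t3z (q1 y0)))%N ->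
      (NZ d (t3w (q2 y)) - NZ d (t3z (q2 y)) = NZ d0 (t3w (q2 y0)) - NZ d0 (t3z (q2 y0)))%N ->
      NZ d (z1_of y) = NZ d (z2_of y)) ->
    exists V (u : Y2 R n -> extS), [/\ opn V, V y0, smooth_on V u &
      forall y, V y -> [/\ (u y : ext) != 0, (u y : ext) \in det_line y & sign_of y = sign_of y0]].
    move=> D1 D2 s1 s2 g1 g2 H.
    have sd1 : sdiag (t3g (q1 y0)) h0 d0 by rewrite g1.
    have sd2 : sdiag (t3g (q2 y0)) h0 d0 by rewrite g2.
    have [V1 [u1 [oV1 V10 _ Hu1]]] := spectral_section D1 sd1.
    have [V2 [u2 [oV2 V20 _ Hu2]]] := spectral_section D2 sd2.
    have oD1 := opn_preimage s1 (@opn_dom3 R n); have oD2 := opn_preimage s2 (@opn_dom3 R n).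
    exists (([set y | V1 (q1 y)] `&` [set y | V2 (q2 y)]) `&`
      ([set y | dom3 (q1 y)] `&` [set y | dom3 (q2 y)])), (fun y => ext1 R n); split.
    + exact: opnI (opnI (opn_preimage s1 oV1) (opn_preimage s2 oV2)) (opnI oD1 oD2).
    + by [].
    + exact: smooth_on_cst.
    move=> y [[V1y V2y] [D1y D2y]]; have [h [d sd]] := Un_sdiag (g_of y).
    have s1' : sdiag (t3g (q1 y)) h d by rewrite g1.
    have s2' : sdiag (t3g (q2 y)) h d by rewrite g2.
    have [_ _ c1] := Hu1 _ h d V1y s1'; have [_ _ c2] := Hu2 _ h d V2y s2'.
    have NE := H y h d D1y D2y sd c1 c2.
    have [uh _ _ _] := sd; split.
    + by rewrite -(veps_nil h 0); exact: veps_neq0.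
    + by rewrite (det_lineE sd) NE minnn maxnn -(veps_nil h (NZ d (z2_of y))) memv_line.
    + by rewrite (sign_ofE sd) (sign_ofE sd0) NE e !ltnn.
  have [ew|zw|wz'] := Zlt_total (z1Z y0) wZ; first by case: wz.
  + apply: (key (to3 f1 k) (to3 f2 k)) => //.
    * by split; [exact: zw | exact: z1_neig | exact: nw].
    * by split; [by rewrite -[t3z _]e | exact: z2_neig | exact: nw].
    * exact: smooth_to3 smooth_Y2z1 sk.
    * exact: smooth_to3 smooth_Y2z2 sk.
    move=> y h d [l1 _ _] [l2 _ _] sd; have := NZ_le sd l1; have := NZ_le sd l2.
    rewrite -[t3z (to3 f1 k y)]/(z1_of y) -[t3z (to3 f2 k y)]/(z2_of y).
    rewrite -[t3z (to3 f1 k y0)]/(z1_of y0) -[t3z (to3 f2 k y0)]/(z2_of y0) e.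
    rewrite -[t3w (to3 f1 k y)]/(sval w) -[t3w (to3 f2 k y)]/(sval w).
    move=> a b c1 c2; apply/eqP.
    by rewrite -(eqn_add2l (NZ d (sval w) - NZ d (z2_of y))) subnK // c2 -c1 subnK.
  + apply: (key (to3 k f1) (to3 k f2)) => //.
    * by split; [exact: wz' | exact: nw | exact: z1_neig].
    * by split; [by rewrite -[t3w _]e | exact: nw | exact: z2_neig].
    * exact: smooth_to3 sk smooth_Y2z1.
    * exact: smooth_to3 sk smooth_Y2z2.
    move=> y h d [l1 _ _] [l2 _ _] sd; have := NZ_le sd l1; have := NZ_le sd l2.
    rewrite -[t3w (to3 k f1 y)]/(z1_of y) -[t3w (to3 k f2 y)]/(z2_of y).
    rewrite -[t3w (to3 k f1 y0)]/(z1_of y0) -[t3w (to3 k f2 y0)]/(z2_of y0) e.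
    rewrite -[t3z (to3 k f1 y)]/(sval w) -[t3z (to3 k f2 y)]/(sval w).
    by move=> a b c1 c2; rewrite -(subnK b) c1 -c2 subnK.
- have D0 : dom3 (to3 f1 f2 y0) by split; [exact: l | exact: z1_neig | exact: z2_neig].
  have [V [u [oV V0 su Hu]]] := spectral_section D0 sd0.
  have sq := smooth_to3 smooth_Y2z1 smooth_Y2z2.
  have oD := opn_preimage sq (@opn_dom3 R n).
  exists ([set y | V (to3 f1 f2 y)] `&` [set y | dom3 (to3 f1 f2 y)]), (fun y => u (to3 f1 f2 y)); split.
  + exact: opnI (opn_preimage sq oV) oD.
  + by [].
  + by apply: smooth_on_comp su => [y []//|]; exact: smooth_on_sub sq.
  move=> y [Vy [l' _ _]]; have [h [d sd]] := Un_sdiag (g_of y).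
  have [u0 ul c] := Hu _ h d Vy sd.
  have le := NZ_le sd l'; have le0 := NZ_le sd0 l.
  split=> //; first by rewrite (det_lineE sd) (minn_idPl le) (maxn_idPr le).
  rewrite (sign_ofE sd) (sign_ofE sd0) !(ltnNge (NZ _ (z2_of _))) le le0 /=.
  by rewrite -subn_gt0 -[in RHS]subn_gt0; move: c; rewrite /= => ->.
Qed.

End LocalSections.

(** * The bundle gerbe *)

Section Frames.
Import mathcomp.boot.finset.
Variables (R : realType) (n : nat).
Local Notation C := R[i].
Local Notation M := 'M[C]_n.
Local Notation ext := (ext R n).
Local Notation extS := (ffun_space R {set 'I_n}).
Local Notation L := (L R n).
Implicit Types (h : M) (d : 'rV[C]_n) (y : Y2 R n) (k : Un R n).

(** The scalar a / b for a on the line of b. Unlike [quot], it is an explicit expression, smooth in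
    both arguments. *)
Definition ratio (a b : ext) : C := ext_dot a b / ext_dot b b.

Lemma ratio_line (e : ext) (a b : C) : ext_dot e e = 1 -> b != 0 ->
  ratio (a *: e) (b *: e) = a / b.
Proof.
move=> e1 b0; rewrite /ratio !ext_dotZl !ext_dotZr e1 !mulr1.
by rewrite -mulf_div divff ?mulr1 // conjC_eq0.
Qed.

Lemma csm_ratio (X : space R) (U : set X) (a b : X -> extS) :
  smooth_on U a -> smooth_on U b -> (forall x, U x -> (b x : ext) != 0) ->
  csm U (fun x => ratio (a x) (b x)).
Proof.
move=> sa sb b0; apply/csmP => x Ux.
have ea := (smooth_on_extP _ _).1 sa x Ux; have eb := (smooth_on_extP _ _).1 sb x Ux.
apply: cscM; first exact: csc_ext_dot.
apply: cscV; last exact: csc_ext_dot.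
by move=> _ ->; apply/eqP => /ext_dot_eq0/eqP; rewrite (negbTE (b0 x Ux)).
Qed.

Lemma smooth_on_wedge (X : space R) (U : set X) (a b : X -> extS) :
  smooth_on U a -> smooth_on U b -> smooth_on U (fun x => wedge (a x) (b x) : extS).
Proof.
move=> sa sb; apply/smooth_on_extP => x Ux; apply: esc_wedge.
  exact: (smooth_on_extP _ _).1 sa x Ux.
exact: (smooth_on_extP _ _).1 sb x Ux.
Qed.

Definition Eps h d y : ext := veps h (Nmin d y) (Nmax d y).

(* v is the smooth section of det E behind the frame s: s itself as a vector, or the vector
   dual to s over Y^[2]_- (where b holds). *)
Definition frame_rep (b : bool) (U : set (Y2 R n)) (s : forall y, Lfib y)
    (v : Y2 R n -> extS) :=
  smooth_on U v /\ forall y, U y -> forall h d, sdiag (mx_of (g_of y)) h d ->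
    [/\ (NZ d (z2_of y) < NZ d (z1_of y))%N = b, kappa h d (s y) != 0 &
        (v y : ext) = (if b then (kappa h d (s y))^-1 else kappa h d (s y)) *: Eps h d y].

Lemma frame_rep_neq0 b U s v y : frame_rep b U s v -> U y -> (v y : ext) != 0.
Proof.
move=> [_ H] Uy; have [h [d sd]] := Un_sdiag (g_of y); have [uh _ _ _] := sd.
have [_ k0 ->] := H y Uy h d sd; rewrite scaler_eq0 negb_or (veps_neq0 _ _ uh) andbT.
by case: (b); rewrite ?invr_eq0.
Qed.

Lemma kappa_neq0 y h d (p : Lfib y) : sdiag (mx_of (g_of y)) h d -> p != 0 ->
  kappa h d p != 0.
Proof.
move=> sd; apply: contraNneq => k0; apply/eqP; apply: (kappa_inj sd).
by apply: (etrans k0); exact: esym (kappa0 sd).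
Qed.

Lemma sign_Neg y h d : sdiag (mx_of (g_of y)) h d ->
  (NZ d (z2_of y) < NZ d (z1_of y))%N -> sign_of y = Neg.
Proof. by move=> sd l; rewrite (sign_ofE sd) l ltnNge (ltnW l). Qed.

Lemma sign_nNeg y h d : sdiag (mx_of (g_of y)) h d -> sign_of y <> Neg ->
  (NZ d (z1_of y) <= NZ d (z2_of y))%N.
Proof. by move=> sd H; rewrite leqNgt; apply/negP => /(sign_Neg sd). Qed.

Lemma Neg_lt y h d : sdiag (mx_of (g_of y)) h d -> sign_of y = Neg ->
  (NZ d (z2_of y) < NZ d (z1_of y))%N.
Proof. by move=> sd; rewrite (sign_ofE sd); case: ifP => // _; case: ifP. Qed.

(** Frames over Y^[2]_+ and Y^[2]_0 are both vectors, so two kinds are left, told apart by b; b is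
    the same at all points of U. *)
Lemma Lframe_rep U s : @Lframe R n U s -> exists b v, frame_rep b U s v.
Proof.
move=> [_ H].
have P : (forall y, U y -> sign_of y <> Neg) -> (forall y, U y -> s y != 0) ->
    smooth_on U (fun y => as_vec (s y) : extS) -> exists b v, frame_rep b U s v.
  move=> sU s0 ss; exists false, (fun y => as_vec (s y)); split=> // y Uy h d sd.
  have le := sign_nNeg sd (sU y Uy); split.
  - by rewrite ltnNge le.
  - exact: kappa_neq0 sd (s0 y Uy).
  - by apply: (etrans (kappa_as_vec sd (s y) le)); rewrite (veps_le h le).
case: H => [[sU s0 ss]|[sU [u su Hu]]|[sU s0 ss]].
- by apply: P => // y Uy; rewrite sU.
- exists true, u; split=> // y Uy h d sd; have l := Neg_lt sd (sU y Uy).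
  have [ul us] := Hu y Uy; have [dl _ _] := frame_ofP sd.
  move: ul; rewrite dl => /vlineP[x ux].
  have xk : x * kappa h d (s y) = 1.
    have := kappa_as_fun sd (s y) x (ltnW l); rewrite (veps_ge h (ltnW l)) => <-.
    by rewrite -ux.
  have k0 : kappa h d (s y) != 0.
    by apply/eqP => k0; move: xk; rewrite k0 mulr0 => /eqP; rewrite eq_sym oner_eq0.
  split=> //; rewrite [LHS]ux; congr (_ *: _).
  by apply: (mulIf k0); rewrite xk mulVf.
- by apply: P => // y Uy; rewrite sU.
Qed.

Lemma Lframe_exists y0 : exists U s, @Lframe R n U s /\ U y0.
Proof.
have [V [u [oV V0 su Hu]]] := local_section y0.
have line y h d : V y -> sdiag (mx_of (g_of y)) h d ->
    exists2 x, x != 0 & (u y : ext) = x *: Eps h d y.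
  move=> Vy sd; have [u0 + _] := Hu y Vy; have [dl _ _] := frame_ofP sd.
  rewrite dl => /vlineP[x ux]; exists x => //.
  by apply/eqP => x0; move/eqP: u0; apply; rewrite ux x0; exact: scale0r.
have P : sign_of y0 <> Neg -> exists s : forall y, Lfib y,
    (forall y, V y -> s y != 0) /\ smooth_on V (fun y => as_vec (s y) : extS).
  move=> sN; exists (fun y => of_vec (sign_of y) (det_line y) (u y)).
  have K y (Vy : V y) : exists h d x, [/\ sdiag (mx_of (g_of y)) h d, x != 0,
      (u y : ext) = x *: Eps h d y, (NZ d (z1_of y) <= NZ d (z2_of y))%N &
      kappa h d (of_vec (sign_of y) (det_line y) (u y) : Lfib y) = x].
    have [h [d sd]] := Un_sdiag (g_of y); have [x x0 ux] := line y h d Vy sd.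
    have sy : sign_of y <> Neg by have [_ _ ->] := Hu y Vy.
    have le := sign_nNeg sd sy; exists h, d, x; split=> //.
    have := kappa_of_vec sd x le; rewrite (veps_le h le) => E.
    by apply: etrans E; rewrite ux.
  split=> [y Vy|].
    have [h [d [x [sd x0 _ _ kx]]]] := K y Vy; apply/eqP => e.
    by move/eqP: x0; apply; rewrite -kx e; exact: kappa0.
  apply: smooth_on_eq su => y Vy; have [h [d [x [sd x0 ux le kx]]]] := K y Vy.
  apply: esym; apply: (etrans (kappa_as_vec sd _ le)); rewrite (veps_le h le).
  by rewrite [RHS]ux; congr (_ *: _).
have H : sign_of y0 = Neg \/ sign_of y0 <> Neg by case: (sign_of y0); [right|left|right].
case: H => [sN|sN].
  (* Over Y^[2]_- the frame is the functional dual to u. *)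
  exists V, (fun y => of_fun (sign_of y) (det_line y) (fun v => quot v (u y))).
  split=> //; split=> //; constructor 2; split=> [y Vy|].
    by have [_ _ ->] := Hu y Vy.
  exists u => // y Vy; have [_ ul sy] := Hu y Vy; split=> //.
  have [h [d sd]] := Un_sdiag (g_of y); have [x x0 ux] := line y h d Vy sd.
  have [uh _ _ _] := sd.
  have le : (NZ d (z2_of y) <= NZ d (z1_of y))%N by apply: ltnW (Neg_lt sd _); rewrite sy.
  have e0 := veps_neq0 (NZ d (z2_of y)) (NZ d (z1_of y)) uh.
  have uv : (u y : ext) = x *: veps h (NZ d (z2_of y)) (NZ d (z1_of y)).
    by rewrite (veps_ge h le).
  have Q a : quot (a *: veps h (NZ d (z2_of y)) (NZ d (z1_of y))) (u y) = a / x.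
    by rewrite [X in quot _ X]uv quot_line.
  have Q1 : quot (veps h (NZ d (z2_of y)) (NZ d (z1_of y))) (u y) = x^-1.
    by have := Q 1; rewrite scale1r mul1r.
  rewrite [X in as_fun _ X]uv; apply: (etrans (kappa_as_fun sd _ x le)).
  have K := kappa_of_fun sd (f := fun v => quot v (u y)) le.
  have {}K := etrans (K (fun a => etrans (Q a) (esym (congr1 ( *%R a) Q1)))) Q1.
  by apply: (etrans (congr1 ( *%R x) K)); rewrite divff.
have [s [s0 ss]] := P sN; exists V, s; split=> //; split=> //.
case E : (sign_of y0) => //.
  by constructor 1; split=> // y Vy; have [_ _ ->] := Hu y Vy.
by constructor 3; split=> // y Vy; have [_ _ ->] := Hu y Vy.
Qed.

Lemma L_hdot_smooth U s : @Lframe R n U s ->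
  [/\ opn U, forall y, U y -> s y != 0 &
      smooth_on U (fun y => @hdot R _ L y (s y) (s y) : complex_space R)].
Proof.
move=> F; have [oU _] := F; have [b [v [sv Hv]]] := Lframe_rep F.
have sn : csm U (fun y => ext_dot (v y : ext) (v y)).
  apply/csmP => y Uy; apply: csc_ext_dot; exact: (smooth_on_extP _ _).1 sv y Uy.
have E y : U y -> [/\ s y != 0, ext_dot (v y : ext) (v y) != 0 &
    @hdot R _ L y (s y) (s y) =
    if b then (ext_dot (v y : ext) (v y))^-1 else ext_dot (v y : ext) (v y)].
  move=> Uy; have [h [d sd]] := Un_sdiag (g_of y); have [uh _ _ _] := sd.
  have [_ k0 vE] := Hv y Uy h d sd.
  have e1 : ext_dot (Eps h d y) (Eps h d y) = 1 by exact: veps_norm.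
  split.
  - by apply/eqP => e; move/eqP: k0; apply; rewrite e; exact: kappa0.
  - rewrite vE ext_dotZl ext_dotZr e1 mulr1 mulf_neq0 ?conjC_eq0 //.
      by case: (b); rewrite ?invr_eq0.
    by case: (b); rewrite ?invr_eq0.
  - apply: (etrans (hdot_kappa sd (s y) (s y))); rewrite vE ext_dotZl ext_dotZr e1 mulr1.
    by case: (b); rewrite // fmorphV /= -invfM invrK.
split=> [//|y Uy|]; first by have [] := E y Uy.
case: b {Hv} E => E.
  apply: (@smooth_on_eq _ _ (complex_space R) _ (fun y => (ext_dot (v y : ext) (v y))^-1)).
    by move=> y Uy; have [_ _ ->] := E y Uy.
  apply/csmP => y Uy; apply: cscV; last exact: (csmP _ _).1 sn y Uy.
  by move=> _ ->; have [] := E y Uy.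
by apply: smooth_on_eq sn => y Uy; have [_ _ ->] := E y Uy.
Qed.

Lemma L_transition U s V t : @Lframe R n U s -> @Lframe R n V t ->
  exists2 c : Y2 R n -> complex_space R, smooth_on (U `&` V)%classic c &
    forall y, (U `&` V)%classic y -> t y = (c y : C) *: (s y : L y).
Proof.
move=> FU FV; have [b [v [sv Hv]]] := Lframe_rep FU; have [b' [w [sw Hw]]] := Lframe_rep FV.
have nv y (Uy : U y) : (v y : ext) != 0 := frame_rep_neq0 (conj sv Hv) Uy.
have nw y (Vy : V y) : (w y : ext) != 0 := frame_rep_neq0 (conj sw Hw) Vy.
have sv' : smooth_on (U `&` V)%classic v by apply: smooth_on_sub sv => y [].
have sw' : smooth_on (U `&` V)%classic w by apply: smooth_on_sub sw => y [].
(* Dual frames transform inversely, so v and w exchange roles when b holds. *)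
exists (fun y => if b then ratio (v y) (w y) else ratio (w y) (v y)).
  case: (b); first by apply: csm_ratio => // y [_ Vy]; exact: nw.
  by apply: csm_ratio => // y [Uy _]; exact: nv.
move=> y [Uy Vy]; have [h [d sd]] := Un_sdiag (g_of y); have [uh _ _ _] := sd.
have [eb k0 vE] := Hv y Uy h d sd; have [eb' l0 wE] := Hw y Vy h d sd.
have e1 : ext_dot (Eps h d y) (Eps h d y) = 1 by exact: veps_norm.
apply: (kappa_inj sd); apply: esym; apply: (etrans (linear_scale _ (s y) (kappa_linear sd))).
rewrite /GRing.scale /= vE wE -eb' eb; case: (b).
  by rewrite ratio_line ?invr_eq0 // invrK mulrAC mulVf // mul1r.
by rewrite ratio_line // mulfVK.
Qed.

Lemma L_line_bundle : is_hermitian_line_bundle L.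
Proof.
split; [exact: L_dim | exact: L_hdot | exact: Lframe_exists | exact: L_hdot_smooth |].
exact: L_transition.
Qed.

End Frames.

(** * Smoothness of the product *)

Section Product.
Import mathcomp.boot.finset.
Variables (R : realType) (n : nat).
Local Notation C := R[i].
Local Notation M := 'M[C]_n.
Local Notation ext := (ext R n).
Local Notation extS := (ffun_space R {set 'I_n}).
Local Notation B := (basic_gerbe R n).
Local Notation Y3 := (fib3 (@Ypi R n)).
Implicit Types (h : M) (d : 'rV[C]_n) (k : Un R n) (s t r : ext).

(* The coefficient of the product of two frames in a third one, over (z1, z2), (z2, z3) and
   (z1, z3), is the ratio of prod_num and prod_den at the vectors s, t, r of [frame_rep]; the
   flags tell which frames consist of functionals. Dualising moves a factor to the other side,
   so that each ratio compares two vectors of the same line. Two of the flag combinations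
   cannot occur. *)
Definition prod_num (b1 b2 b3 : bool) s t r : ext :=
  match b1, b2, b3 with
  | false, false, _ => wedge s t
  | false, true, false => s
  | false, true, true => wedge r s
  | true, false, false => t
  | true, false, true => wedge t r
  | true, true, _ => r
  end.

Definition prod_den (b1 b2 b3 : bool) s t r : ext :=
  match b1, b2, b3 with
  | false, false, _ => r
  | false, true, false => wedge r t
  | false, true, true => t
  | true, false, false => wedge s r
  | true, false, true => s
  | true, true, _ => wedge t s
  end.

Definition pw (b : bool) (x : C) := if b then x^-1 else x.

Lemma prod_ratio h (N1 N2 N3 : nat) b1 b2 b3 s t r (x y z : C) :
  h \is unitarymx -> (N2 < N1)%N = b1 -> (N3 < N2)%N = b2 -> (N3 < N1)%N = b3 ->
  x != 0 -> y != 0 -> z != 0 ->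
  s = pw b1 x *: veps h (minn N1 N2) (maxn N1 N2) ->
  t = pw b2 y *: veps h (minn N2 N3) (maxn N2 N3) ->
  r = pw b3 z *: veps h (minn N1 N3) (maxn N1 N3) ->
  prod_den b1 b2 b3 s t r != 0 /\
  ratio (prod_num b1 b2 b3 s t r) (prod_den b1 b2 b3 s t r) = x * y / z.
Proof.
move=> uh e1 e2 e3 x0 y0 z0 -> -> ->.
have E p q (a b c : C) : a != 0 -> b / a = c ->
    a *: veps h p q != 0 /\ ratio (b *: veps h p q) (a *: veps h p q) = c.
  move=> a0 <-; rewrite scaler_eq0 negb_or a0 (veps_neq0 p q uh); split=> //.
  by apply: ratio_line => //; exact: veps_norm.
have W (p q m : nat) (a b : C) : (p <= q)%N -> (q <= m)%N ->
    wedge (a *: veps h p q) (b *: veps h q m) = (a * b) *: veps h p m.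
  by move=> pq qr; rewrite wedgeZl wedgeZr veps_wedge // (scalerA a).
move: e1 e2 e3; case: b1; case: b2; case: b3 => l1 l2 l3 /=; rewrite /pw.
- have k1 := ltnW l1; have k2 := ltnW l2; have k3 := ltnW l3.
  rewrite (minn_idPr k1) (maxn_idPl k1) (minn_idPr k2) (maxn_idPl k2) (minn_idPr k3) (maxn_idPl k3).
  by rewrite W //; apply: E; [rewrite mulf_neq0 ?invr_eq0 | field; rewrite x0 y0 z0].
- by move/negbT: l3; rewrite (ltn_trans l2 l1).
- have k1 := ltnW l1; have k3 := ltnW l3; have k2 : (N2 <= N3)%N by rewrite leqNgt l2.
  rewrite (minn_idPr k1) (maxn_idPl k1) (minn_idPl k2) (maxn_idPr k2) (minn_idPr k3) (maxn_idPl k3).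
  by rewrite W //; apply: E; [rewrite ?invr_eq0 | field; rewrite x0 z0].
- have k1 := ltnW l1; have k2 : (N2 <= N3)%N by rewrite leqNgt l2.
  have k3 : (N1 <= N3)%N by rewrite leqNgt l3.
  rewrite (minn_idPr k1) (maxn_idPl k1) (minn_idPl k2) (maxn_idPr k2) (minn_idPl k3) (maxn_idPr k3).
  by rewrite W //; apply: E; [rewrite mulf_neq0 ?invr_eq0 | field; rewrite x0 z0].
- have k1 : (N1 <= N2)%N by rewrite leqNgt l1.
  have k2 := ltnW l2; have k3 := ltnW l3.
  rewrite (minn_idPl k1) (maxn_idPr k1) (minn_idPr k2) (maxn_idPl k2) (minn_idPr k3) (maxn_idPl k3).
  by rewrite W //; apply: E; [rewrite ?invr_eq0 | field; rewrite y0 z0].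
- have k1 : (N1 <= N2)%N by rewrite leqNgt l1.
  have k2 := ltnW l2; have k3 : (N1 <= N3)%N by rewrite leqNgt l3.
  rewrite (minn_idPl k1) (maxn_idPr k1) (minn_idPr k2) (maxn_idPl k2) (minn_idPl k3) (maxn_idPr k3).
  by rewrite W //; apply: E; [rewrite mulf_neq0 ?invr_eq0 | field; rewrite y0 z0].
- have k1 : (N1 <= N2)%N by rewrite leqNgt l1.
  have k2 : (N2 <= N3)%N by rewrite leqNgt l2.
  by move: l3; rewrite ltnNge (leq_trans k1 k2).
- have k1 : (N1 <= N2)%N by rewrite leqNgt l1.
  have k2 : (N2 <= N3)%N by rewrite leqNgt l2.
  have k3 := leq_trans k1 k2.
  rewrite (minn_idPl k1) (maxn_idPr k1) (minn_idPl k2) (maxn_idPr k2) (minn_idPl k3) (maxn_idPr k3).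
  by rewrite W //; apply: E.
Qed.

Lemma smooth_on_prod_num (X : space R) (U : set X) b1 b2 b3 (s t r : X -> extS) :
  smooth_on U s -> smooth_on U t -> smooth_on U r ->
  smooth_on U (fun x => prod_num b1 b2 b3 (s x) (t x) (r x) : extS).
Proof.
by move=> ss st sr; case: b1; case: b2; case: b3 => //=; exact: smooth_on_wedge.
Qed.

Lemma smooth_on_prod_den (X : space R) (U : set X) b1 b2 b3 (s t r : X -> extS) :
  smooth_on U s -> smooth_on U t -> smooth_on U r ->
  smooth_on U (fun x => prod_den b1 b2 b3 (s x) (t x) (r x) : extS).
Proof.
by move=> ss st sr; case: b1; case: b2; case: b3 => //=; exact: smooth_on_wedge.
Qed.

Local Notation Y := (Yspace R n).

Lemma smooth_Y3_1 : smooth (fun y : Y3 => (sval y).1.1 : Y).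
Proof.
have s1 : smooth (fun y : Y3 => (sval y).1 : prod_space Y Y).
  exact: (@smooth_on_comp _ Y3 (prod_space (prod_space Y Y) Y) (prod_space Y Y)
    classical_sets.setT classical_sets.setT (fun q => sval q) (fun q => q.1)
    (fun _ _ => I) (@smooth_on_val _ _ _ _) (@smooth_on_fst _ _ _ _)).
exact: (@smooth_on_comp _ Y3 (prod_space Y Y) Y
    classical_sets.setT classical_sets.setT (fun q => (sval q).1) (fun q => q.1)
    (fun _ _ => I) s1 (@smooth_on_fst _ _ _ _)).
Qed.

Lemma smooth_Y3_2 : smooth (fun y : Y3 => (sval y).1.2 : Y).
Proof.
have s1 : smooth (fun y : Y3 => (sval y).1 : prod_space Y Y).
  exact: (@smooth_on_comp _ Y3 (prod_space (prod_space Y Y) Y) (prod_space Y Y)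
    classical_sets.setT classical_sets.setT (fun q => sval q) (fun q => q.1)
    (fun _ _ => I) (@smooth_on_val _ _ _ _) (@smooth_on_fst _ _ _ _)).
exact: (@smooth_on_comp _ Y3 (prod_space Y Y) Y
    classical_sets.setT classical_sets.setT (fun q => (sval q).1) (fun q => q.2)
    (fun _ _ => I) s1 (@smooth_on_snd _ _ _ _)).
Qed.

Lemma smooth_Y3_3 : smooth (fun y : Y3 => (sval y).2 : Y).
Proof.
exact: (@smooth_on_comp _ Y3 (prod_space (prod_space Y Y) Y) Y
    classical_sets.setT classical_sets.setT (fun q => sval q) (fun q => q.2)
    (fun _ _ => I) (@smooth_on_val _ _ _ _) (@smooth_on_snd _ _ _ _)).
Qed.

Lemma smooth_p12 : smooth (@p12 _ _ _ (@Ypi R n)).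
Proof.
apply: smooth_on_subspace; apply: smooth_on_pair; [exact: smooth_Y3_1|exact: smooth_Y3_2].
Qed.

Lemma smooth_p23 : smooth (@p23 _ _ _ (@Ypi R n)).
Proof.
apply: smooth_on_subspace; apply: smooth_on_pair; [exact: smooth_Y3_2|exact: smooth_Y3_3].
Qed.

Lemma smooth_p13 : smooth (@p13 _ _ _ (@Ypi R n)).
Proof.
apply: smooth_on_subspace; apply: smooth_on_pair; [exact: smooth_Y3_1|exact: smooth_Y3_3].
Qed.

Lemma bprod_smooth_basic : bprod_smooth B.
Proof.
move=> U s V t W r FU FV FW.
have [b1 [u [su Hu]]] := Lframe_rep FU; have [b2 [v [sv Hv]]] := Lframe_rep FV.
have [b3 [w [sw Hw]]] := Lframe_rep FW.
pose D := [set y : Y3 | [/\ U (p12 y), V (p23 y) & W (p13 y)]]%classic.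
pose num (y : Y3) : extS := prod_num b1 b2 b3 (u (p12 y)) (v (p23 y)) (w (p13 y)).
pose den (y : Y3) : extS := prod_den b1 b2 b3 (u (p12 y)) (v (p23 y)) (w (p13 y)).
have su' : smooth_on D (fun y => u (p12 y)).
  apply: smooth_on_comp su; first by move=> y [].
  exact: smooth_on_sub (fun _ _ => I) smooth_p12.
have sv' : smooth_on D (fun y => v (p23 y)).
  apply: smooth_on_comp sv; first by move=> y [].
  exact: smooth_on_sub (fun _ _ => I) smooth_p23.
have sw' : smooth_on D (fun y => w (p13 y)).
  apply: smooth_on_comp sw; first by move=> y [].
  exact: smooth_on_sub (fun _ _ => I) smooth_p13.
have key (y : Y3) h d : D y -> sdiag (mx_of (g_of (p12 y))) h d ->
    [/\ kappa h d (r (p13 y)) != 0, (den y : ext) != 0 & ratio (num y) (den y) =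
    kappa h d (s (p12 y)) * kappa h d (t (p23 y)) / kappa h d (r (p13 y))].
  move=> [Uy Vy Wy] sd; have [uh _ _ _] := sd.
  have sd2 : sdiag (mx_of (g_of (p23 y))) h d.
    by have -> : g_of (p23 y) = g_of (p12 y) by exact: esym (svalP y).1.
  have [e1 x0 uE] := Hu _ Uy h d sd; have [e2 y0 vE] := Hv _ Vy h d sd2.
  have [e3 z0 wE] := Hw _ Wy h d sd.
  by have [] := prod_ratio uh e1 e2 e3 x0 y0 z0 uE vE wE.
exists (fun y => ratio (num y) (den y)).
  apply: csm_ratio; [exact: smooth_on_prod_num|exact: smooth_on_prod_den|].
  move=> y Dy; have [h [d sd]] := Un_sdiag (g_of (p12 y)).
  by have [] := key y h d Dy sd.
move=> y Uy Vy Wy; have [h [d sd]] := Un_sdiag (g_of (p12 y)).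
have [z0 _ E] := key y h d (And3 Uy Vy Wy) sd.
have cp : composable (p12 y) (p23 y) (p13 y) by [].
have sd3 : sdiag (mx_of (g_of (p13 y))) h d by exact: sd.
apply: (kappa_inj sd3); apply: (etrans (kappa_Lprod _ _ cp sd)).
apply: esym; apply: (etrans (linear_scale _ _ (kappa_linear sd3))).
by rewrite E /GRing.scale /= mulfVK.
Qed.

Lemma basic_is_bundle_gerbe : is_bundle_gerbe B.
Proof.
split.
- split; [exact: is_manifold_Un|exact: is_manifold_Y|exact: Ypi_surj|exact: submersion_Ypi].
- exact: L_line_bundle.
- exact: Lprod_bilinear.
- exact: bprod_smooth_basic.
- exact: Lprod_assoc.
Qed.

End Product.

(** * The action *)

Section Action.
Import mathcomp.boot.finset.
Variables (R : realType) (n : nat).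
Local Notation C := R[i].
Local Notation M := 'M[C]_n.
Local Notation ext := (ext R n).
Local Notation extS := (ffun_space R {set 'I_n}).
Local Notation B := (basic_gerbe R n).
Local Notation moved := (@moved R (Un R n) (Un R n) B (@adjY R n)).
Implicit Types (h : M) (d : 'rV[C]_n) (y a b c : Y2 R n) (k : Un R n).

Definition adjY2 y k : Y2 R n :=
  exist (fun q : prod_space (Yspace R n) (Yspace R n) => Ypi q.1 = Ypi q.2)
    (adjY (sval y).1 k, adjY (sval y).2 k) (congr1 (fun g => adj g k) (svalP y)).

Lemma moved_adjY2 y k : moved y k (adjY2 y k).
Proof. by []. Qed.

Lemma moved_eq y k y' : moved y k y' -> y' = adjY2 y k.
Proof.
by case: y' => [[y1 y2] H] [e1 e2]; apply: eq_exist; exact: (congr2 pair e1 e2).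
Qed.

Lemma smooth_adjY2 : smooth (fun q : prod_space (Y2 R n) (Un R n) => adjY2 q.1 q.2).
Proof.
have [_ _ sa] := @smooth_right_action_adjY R n.
have S (f : Y2 R n -> Yspace R n) : smooth f ->
    smooth (fun q : prod_space (Y2 R n) (Un R n) => adjY (f q.1) q.2).
  move=> sf; have sp : smooth (fun q : prod_space (Y2 R n) (Un R n) =>
      (f q.1, q.2) : prod_space (Yspace R n) (Un R n)).
    apply: smooth_on_pair; last exact: smooth_on_snd.
    exact: (@smooth_on_comp _ (prod_space (Y2 R n) (Un R n)) (Y2 R n) (Yspace R n)
      classical_sets.setT classical_sets.setT (fun q => q.1) f (fun _ _ => I)
      (@smooth_on_fst _ _ _ _) sf).
  exact: (@smooth_on_comp _ (prod_space (Y2 R n) (Un R n))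
    (prod_space (Yspace R n) (Un R n)) (Yspace R n)
    classical_sets.setT classical_sets.setT (fun q => (f q.1, q.2))
    (fun p => adjY p.1 p.2) (fun _ _ => I) sp sa).
by apply: smooth_on_subspace; apply: smooth_on_pair;
  [exact: (S (fun y => (sval y).1) (@smooth_Y2_1 R n)) | exact: (S (fun y => (sval y).2) (@smooth_Y2_2 R n))].
Qed.

Lemma Lact_right_action :
  @is_right_action_on_P R (Un R n) (Un R n) B (@adjY R n) (fun y k y' p => @Lact R n y k y' p).
Proof.
split=> [y mv p|y y' y'' g k mg mk p].
  have [h [d sd]] := Un_sdiag (g_of y); have E := kappa_Lact p mv sd.
  have e1 : (mx_of (gone (Un R n)))^t* *m h = h by rewrite [mx_of _]/(1%:M) trC1 mul1mx.
  by rewrite e1 in E; exact: (kappa_inj sd E).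
have [h [d sd]] := Un_sdiag (g_of y).
have [_ act _] := @smooth_right_action_adjY R n.
have mgk : moved y (gmul g k) y''.
  by case: mg mk => [e1 e2] [f1 f2]; split; rewrite ?f1 ?f2 ?e1 ?e2 act.
have sd' := moved_sdiag mg sd; have sd'' := moved_sdiag mk sd'.
have E1 := etrans (kappa_Lact (Lact g y' p) mk sd') (kappa_Lact p mg sd).
have E2 := kappa_Lact p mgk sd.
have eM : (mx_of (gmul g k))^t* *m h = (mx_of k)^t* *m ((mx_of g)^t* *m h).
  by rewrite [mx_of (gmul g k)]/(mx_of g *m mx_of k) trC_mul mulmxA.
rewrite eM in E2; exact: (kappa_inj sd'' (etrans E1 (esym E2))).
Qed.

Lemma Lact_morphisms :
  @acts_by_bundle_morphisms R (Un R n) (Un R n) B (@adjY R n) (fun y k y' p => @Lact R n y k y' p).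
Proof.
move=> y k y' mv; have [h [d sd]] := Un_sdiag (g_of y).
have sd' := moved_sdiag mv sd; have K p := kappa_Lact p mv sd.
split=> [x p q|p q].
  apply: (kappa_inj sd'); apply: (etrans (K _)); apply: (etrans (kappa_linear sd x p q)).
  apply: esym; apply: (etrans (kappa_linear sd' x _ _)).
  exact: (congr2 (fun u w : C^o => x *: u + w) (K p) (K q)).
apply: (etrans (hdot_kappa sd' _ _)); apply: etrans (esym (hdot_kappa sd p q)).
exact: (congr2 (fun u w : C => u * w^*) (K p) (K q)).
Qed.

Lemma Lact_product :
  @commutes_with_product R (Un R n) (Un R n) B (@adjY R n) (fun y k y' p => @Lact R n y k y' p).
Proof.
move=> a b c a' b' c' k cp cp' ma mb mc p q.
have [h [d sa]] := Un_sdiag (g_of a); have [gb gc _] := composable_z cp.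
have sb : sdiag (mx_of (g_of b)) h d by rewrite gb.
have sc : sdiag (mx_of (g_of c)) h d by rewrite gc.
have E1 := etrans (kappa_Lact (Lprod c p q) mc sc) (kappa_Lprod p q cp sa).
have E2 := kappa_Lprod (Lact k a' p) (Lact k b' q) cp' (moved_sdiag ma sa).
rewrite (kappa_Lact p ma sa) (kappa_Lact q mb sb) in E2.
exact: (kappa_inj (moved_sdiag mc sc) (etrans E1 (esym E2))).
Qed.

(** The coefficient compares, in the fibre over y k, the push-forward of the vector behind s with
    the vector behind t. For functionals the ratio is inverted, as the dual of a pushed functional
    is the pushed dual vector. The action preserves z1, z2 and the spectrum, so both frames are of
    the same kind. *)
Lemma Lact_smooth :
  @smooth_on_P R (Un R n) (Un R n) B (@adjY R n) (fun y k y' p => @Lact R n y k y' p).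
Proof.
move=> U s V t FU FV.
have [b1 [u [su Hu]]] := Lframe_rep FU; have [b2 [v [sv Hv]]] := Lframe_rep FV.
pose P := prod_space (Y2 R n) (Un R n).
pose D := [set q : P | U q.1 /\ V (adjY2 q.1 q.2)]%classic.
pose f (q : P) : extS := ext_map ((mx_of q.2)^t*) (u q.1).
pose g (q : P) : extS := v (adjY2 q.1 q.2).
have sg : smooth_on D g.
  apply: smooth_on_comp sv; first by move=> q [].
  exact: smooth_on_sub (fun _ _ => I) smooth_adjY2.
have su' : smooth_on D (fun q => u q.1).
  by apply: smooth_on_comp su; [move=> q [] | exact: smooth_on_fst].
have sk : smooth_on D (fun q => mx_of q.2 : mx_space R n n).
  by apply: smooth_on_mx_of; exact: smooth_on_snd.
have sf : smooth_on D f.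
  apply/smooth_on_extP => q Dq; apply: esc_map.
    by apply: msc_trC; exact: (smooth_on_mxP _ _).1 sk q Dq.
  exact: (smooth_on_extP _ _).1 su' q Dq.
have key y k h d : D (y, k) -> sdiag (mx_of (g_of y)) h d ->
    let y' := adjY2 y k in let x := kappa h d (s y) in
    let z := kappa ((mx_of k)^t* *m h) d (t y') in
    let e := veps ((mx_of k)^t* *m h) (Nmin d y) (Nmax d y) in
    [/\ b1 = b2, x != 0, z != 0 & ext_dot e e = 1 /\
     (f (y, k) : ext) = (if b1 then x^-1 else x) *: e /\
     (g (y, k) : ext) = (if b2 then z^-1 else z) *: e].
  move=> [Uy Vy] sd y' x z e; have mv := moved_adjY2 y k.
  have sd' := moved_sdiag mv sd; have [uh _ _ _] := sd'.
  have [e1 x0 uE] := Hu _ Uy h d sd; have [e2 z0 vE] := Hv _ Vy _ d sd'.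
  split; [by rewrite -e1 -e2 | exact: x0 | exact: z0 |].
  split; first exact: veps_norm.
  split; last exact: vE.
  apply: (etrans (congr1 (ext_map ((mx_of k)^t*)) uE)); apply: (etrans (ext_mapZ _ _ _)).
  apply: (congr1 (fun w : ext => (if b1 then x^-1 else x) *: w)); exact: ext_map_comp.
have nf q : D q -> (f q : ext) != 0 /\ (g q : ext) != 0.
  case: q => y k Dq; have [h [d sd]] := Un_sdiag (g_of y).
  have [_ x0 z0 [e1 [-> ->]]] := key y k h d Dq sd.
  have e0 := unit_neq0 e1.
  rewrite !scaler_eq0 !negb_or e0 !andbT; split; first by case: (b1); rewrite ?invr_eq0.
  by case: (b2); rewrite ?invr_eq0.
exists (fun q => if b1 then ratio (g q) (f q) else ratio (f q) (g q)).
  apply: (@smooth_on_sub _ _ _ D).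
    (* The target point is unique, so the existential in the domain becomes a condition on
       [adjY2 y k]. *)
    by move=> [y k] [Uy [y' mv Vy']]; split=> //; rewrite -(moved_eq mv).
  case: (b1); apply: csm_ratio => // q Dq; by have [] := nf q Dq.
move=> y k y' mv Uy; rewrite (moved_eq mv) => Vy.
have [h [d sd]] := Un_sdiag (g_of y); have {}mv := moved_adjY2 y k.
have sd' := moved_sdiag mv sd.
have [eb x0 z0 [e1 [fE gE]]] := key y k h d (conj Uy Vy) sd.
apply: (kappa_inj sd'); apply: (etrans (kappa_Lact _ mv sd)); apply: esym.
apply: (etrans (linear_scale _ _ (kappa_linear sd'))).
rewrite /GRing.scale /= fE gE -eb; case: (b1).
  by rewrite ratio_line ?invr_eq0 // invrK mulrAC mulVf // mul1r.
by rewrite ratio_line // mulfVK.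
Qed.

End Action.

Theorem lemma5p1 (R : realType) (n : nat) :
  @strongly_equivariant_bundle_gerbe R (Un R n) (Un R n) (@adj R n)
    (basic_gerbe R n) (@adjY R n).
Proof.
split.
- exact: is_lie_group_Un.
- exact: smooth_right_action_adj.
- exact: basic_is_bundle_gerbe.
exists (fun y k y' p => @Lact R n y k y' p); split.
- exact: smooth_right_action_adjY.
- by [].
- exact: Lact_right_action.
- exact: Lact_morphisms.
- by split; [exact: Lact_smooth | exact: Lact_product].
Qed.
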